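(* Let $p(n)\in(0,1)$, $n\in\mathbb N$, be a sequence with $p(n)\to 1$ as $n\to\infty$ and $(1-p(n))^{k}n^{p(n)}\to\infty$ as $n\to\infty$ for every $k\in\mathbb N$. Perform Bernoulli bond percolation with parameter $p(n)$ on a random recursive tree $T_n$ on $\{0,1,\dots,n\}$. Let $\mathcal C^{(n)}_\emptyset$ be the size of the cluster containing the root $0$ and let $\mathbf C^{(n)}_1\ge\mathbf C^{(n)}_2\ge\dots$ be the sizes of all the other clusters, in decreasing order (with $\mathbf C^{(n)}_i=0$ if there are fewer than $i$ such clusters). Then, as $n\to\infty$, $\mathcal C^{(n)}_\emptyset\sim n^{p(n)}$ in probability (i.e. $n^{-p(n)}\mathcal C^{(n)}_\emptyset\to1$ in probability). Moreover, for each fixed $\ell\in\mathbb N$, there is the convergence in distribution $$\left(\frac{(1-p(n))^{-1}}{n^{p(n)}}\mathbf C^{(n)}_1,\dots,\frac{(1-p(n))^{-1}}{n^{p(n)}}\mathbf C^{(n)}_\ell\right)\Longrightarrow(\mathcal Z_1,\dots,\mathcal Z_\ell),$$ where $\mathcal Z_1>\mathcal Z_2>\dots$ are the atoms of a Poisson random measure on $(0,\infty)$ with intensity $\nu(da)=a^{-2}\,da$.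
   Context: Random recursive tree: an increasing tree on a finite totally ordered vertex set is a tree rooted at the smallest vertex such that labels increase along every path from the root. $T_n$ is a uniformly random increasing tree on $\{0,1,\dots,n\}$; its root is $0$. Bernoulli bond percolation with parameter $p$ on $T_n$: given $T_n$, each edge is removed with probability $1-p$, independently of the others. The connected components that result are the percolation clusters, and the size of a cluster is its number of vertices. *)

(* Defs.v *)
From mathcomp Require Import all_boot all_order all_algebra.
From mathcomp Require Import all_classical all_reals all_analysis measurable_realfun.

Set Implicit Arguments.
Unset Strict Implicit.
Unset Printing Implicit Defensive.

Import Order.TTheory GRing.Theory Num.Theory.
Import numFieldNormedType.Exports.

Local Open Scope classical_set_scope.
Local Open Scope ring_scope.

(* A simple graph on {0, ..., n} is given by its set of edges, an edge being
   a two-element set of vertices. *)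
Notation graph n := {set {set 'I_n.+1}}.

Definition adj n (E : graph n) : rel 'I_n.+1 :=
  fun x y => (x != y) && ([set x; y]%SET \in E).

(* In a simple graph every edge gives a closed walk of length 2, so the cycles
   are the closed walks without repeated vertex of length at least 3. *)
Definition is_tree n (E : graph n) : Prop :=
  [/\ (forall e, e \in E -> #|e| = 2%N),
      (forall x y, connect (adj E) x y) &
      (forall c, ucycle (adj E) c -> (size c <= 2)%N)].

Definition is_increasing_tree n (E : graph n) : Prop :=
  is_tree E /\
  forall s : seq 'I_n.+1, path (adj E) ord0 s -> uniq (ord0 :: s) ->
    sorted (fun x y : 'I_n.+1 => (x < y)%N) (ord0 :: s).

Definition increasing_tree n : pred (graph n) :=
  fun E => `[< is_increasing_tree E >].
Arguments increasing_tree : clear implicits.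

Definition cluster n (F : graph n) (x : 'I_n.+1) : {set 'I_n.+1} :=
  [set y | connect (adj F) x y]%SET.

Definition root_cluster_size n (F : graph n) : nat := #|cluster F ord0|.

Definition other_clusters n (F : graph n) : {set {set 'I_n.+1}} :=
  ([set cluster F x | x : 'I_n.+1] :\ cluster F ord0)%SET.

(* Indexed from 0, and equal to 0 past the number of clusters. *)
Definition other_cluster_size n (F : graph n) (i : nat) : nat :=
  nth 0%N (sort geq [seq #|C| | C : {set 'I_n.+1} in other_clusters F]) i.

(* Expectation of a function f of the set F of edges left by Bernoulli bond
   percolation with parameter p on T: the tree T is uniform among increasing
   trees, and given T each edge is in F with probability p, independently. *)
Definition percE (R : realType) n (p : R) (f : graph n -> R) : R :=
  (#|increasing_tree n|%:R)^-1 *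
  \sum_(T | increasing_tree n T) \sum_(F : graph n | F \subset T)
    (\prod_(e in T) (if e \in F then p else 1 - p)) * f F.

Definition percP (R : realType) n (p : R) (A : pred (graph n)) : R :=
  percE p (fun F => (A F)%:R).

Section PoissonRandomMeasure.
Context d (Om : measurableType d) (R : realType) (P : probability Om R).

Definition mutually_independent m (X : 'I_m -> Om -> \bar R) : Prop :=
  forall B : 'I_m -> set (\bar R), (forall i, measurable (B i)) ->
    P (\bigcap_i (X i @^-1` B i)) = (\prod_i fine (P (X i @^-1` B i)))%:E.

(* The mass function is written out because poisson_pmf takes the value 1
   everywhere when the rate is 0. *)
Definition poisson_distributed (X : Om -> \bar R) (lam : \bar R) : Prop :=
  if lam is r%:E then
    forall k : nat, P (X @^-1` [set k%:R%:E]) =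
                    (expR (- r) * r ^+ k / k`!%:R)%:E
  else {ae P, forall w, X w = +oo%E}.

Definition poisson_random_measure d' (S : measurableType d')
    (nu : set S -> \bar R) (N : R.-ker Om ~> S) : Prop :=
  (forall A, measurable A -> poisson_distributed (N ^~ A) (nu A)) /\
  (forall m (A : 'I_m -> set S), (forall i, measurable (A i)) ->
    trivIset setT A -> mutually_independent (fun i w => N w (A i))).

(* Z_0 > Z_1 > ... is the list of all the atoms of the point measure N. *)
Definition ranked_atoms (N : R.-ker Om ~> R)
    (Z : nat -> {RV P >-> R}) : Prop :=
  {ae P, forall w, (forall i, Z i.+1 w < Z i w) /\
    forall A, measurable A -> N w A = (\sum_(i <oo) \d_(Z i w) A)%E}.

End PoissonRandomMeasure.

(* The measure a^-2 da on (0, oo), as a measure on R giving no mass to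
   (-oo, 0]. *)
Definition inv_square_intensity (R : realType)
    (A : set R) : \bar R :=
  (\int[lebesgue_measure]_(a in A `&` [set a : R | (0 < a)%R]) (a ^- 2)%:E)%E.

(* Main.v *)
(* With probability [1 - p] a new vertex of the recursive tree starts its own
   cluster, otherwise it joins a cluster with probability proportional to its
   size, so the cluster sizes form a Markov chain.  For the root cluster C the
   means of C and C (C + 1) are explicit products, and the second moment method
   gives the first claim.  For the other clusters let e = 1 - p and stop the chain
   at time about B / e.  At that time the clusters are finite, and their number of
   size k is close to a Poisson variable of mean B / (k (k + 1)), independently
   for different k: the chain is compared step by step with a walk with
   independent increments.  From time B / e to time n, an L^2 estimate shows that
   the rescaled size of a cluster stays close to (its size at time B / e) / B, and
   that the clusters born later are negligible, up to errors that vanish when B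
   grows.  Finally, the interval (k / B, (k + 1) / B] has intensity B / (k (k + 1)), so
   rounding the atoms of the Poisson measure down to multiples of 1 / B yields
   exactly the same limit. *)
Require Import Defs.
From mathcomp Require Import all_boot all_order all_algebra.
From mathcomp Require Import all_classical all_reals all_analysis measurable_realfun.
From mathcomp Require Import ring lra zify.

Set Implicit Arguments.
Unset Strict Implicit.
Unset Printing Implicit Defensive.

Import Order.TTheory GRing.Theory Num.Theory.
Import numFieldNormedType.Exports.

(** * Increasing trees: removing the last vertex *)

(** Two stages are forced by the cost of the comparison with the walk: exchanging one step at total
    size i costs O(e^2) + O(e / i), which is affordable for O(B / e) steps but not up to time n. The
    jump law of the walk is the stationary profile of the chain: growth and births at rate e balance
    when, at total size i, about e i / (k + 1) clusters are larger than k. In the second stage a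
    cluster of size x at time B / e is multiplied in mean by a factor close to e n^p / B, so the
    normalisation 1 / (e n^p) turns it into x / B. The squared deviations, summed over the clusters
    of size at most K, are of order (1 + 1/2 + ... + 1/K) / B in the limit. Hence K / B is fixed at
    a level L that covers the relevant range, and B is large enough to beat the harmonic sum; B
    tends to infinity only after n. The argument works with expectations only: the chain and the
    walk are operators on functions of the state, and the comparison is a telescoping sum of
    operators rather than a coupling. *)

Section GraphExtension.
Variable n : nat.
Implicit Types (F T : graph n) (x y j : 'I_n.+1).

Definition emb : 'I_n.+1 -> 'I_n.+2 := widen_ord (leqnSn n.+1).

Lemma emb_inj : injective emb.
Proof. by move=> x y /(congr1 val) /= xy; apply: val_inj. Qed.

Lemma emb_neq_max x : emb x != ord_max.
Proof. by apply/eqP => /(congr1 val) /= E; have := ltn_ord x; rewrite E ltnn. Qed.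

Lemma emb0 : emb ord0 = ord0.
Proof. exact: val_inj. Qed.

Lemma embP (u : 'I_n.+2) : u != ord_max -> exists x, u = emb x.
Proof.
move=> u_max; have un : (u < n.+1)%N.
  by have := ltn_ord u; rewrite ltnS leq_eqVlt => /orP[/eqP E|//];
     case/eqP: u_max; apply: val_inj.
by exists (Ordinal un); apply: val_inj.
Qed.

Variant emb_spec (u : 'I_n.+2) : Prop :=
| EmbOld x of u = emb x
| EmbMax of u = ord_max.

Lemma embVmax u : emb_spec u.
Proof.
by have [->|/embP[x ->]] := eqVneq u ord_max; [apply: EmbMax|apply: EmbOld].
Qed.

Lemma map_embP (s : seq 'I_n.+2) : ord_max \notin s ->
  exists s0 : seq 'I_n.+1, s = map emb s0.
Proof.
elim: s => [|u s IH]; first by exists [::].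
rewrite in_cons negb_or eq_sym => /andP[/embP[x ->] /IH[s0 ->]].
by exists (x :: s0).
Qed.

Definition embE F : graph n.+1 := [set emb @: e | e : {set 'I_n.+1} in F]%SET.

(** This serves both for the growth of the tree and for the event that the new edge survives
    percolation; if it is removed, the new vertex stays isolated, which is [embE]. *)
Definition addE F j : graph n.+1 := ([set emb j; ord_max] |: embE F)%SET.

Lemma mem_embE F (e : {set 'I_n.+1}) : ((emb @: e)%SET \in embE F) = (e \in F).
Proof. by rewrite mem_imset //; exact: imset_inj emb_inj. Qed.

Lemma emb_set2 x y : (emb @: [set x; y] = [set emb x; emb y])%SET.
Proof. by rewrite imsetU1 imset_set1. Qed.

Lemma max_notin_emb (e : {set 'I_n.+1}) : ord_max \notin (emb @: e)%SET.
Proof. by apply/imsetP => -[x _ E]; have := emb_neq_max x; rewrite -E eqxx. Qed.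

Lemma new_edge_notin_embE F j : [set emb j; ord_max]%SET \notin embE F.
Proof.
apply/imsetP => -[e _ E]; have := max_notin_emb e.
by rewrite -E !inE eqxx orbT.
Qed.

Lemma new_edge_inj x y :
  ([set emb x; ord_max] == [set emb y; ord_max])%SET = (x == y).
Proof.
apply/eqP/eqP => [/setP/(_ (emb x))|->//].
by rewrite !inE eqxx (negbTE (emb_neq_max x)) orbF /= => /esym; rewrite orbF => /eqP/emb_inj.
Qed.

Lemma mem_addE F j (e : {set 'I_n.+1}) : ((emb @: e)%SET \in addE F j) = (e \in F).
Proof.
rewrite !inE mem_embE; case: eqP => // E.
by have := max_notin_emb e; rewrite E !inE eqxx orbT.
Qed.

Lemma adj_sym m (E : graph m) : symmetric (adj E).
Proof. by move=> x y; rewrite /adj eq_sym finset.setUC. Qed.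

Lemma connect_adj_sym m (E : graph m) : connect_sym (adj E).
Proof. exact/sym_connect_sym/adj_sym. Qed.

Lemma adj_embE F x y : adj (embE F) (emb x) (emb y) = adj F x y.
Proof. by rewrite /adj (inj_eq (@emb_inj)) -emb_set2 mem_embE. Qed.

Lemma adj_embE_max F x : adj (embE F) (emb x) ord_max = false.
Proof. by rewrite /adj (negbTE (new_edge_notin_embE _ _)) andbF. Qed.

Lemma adj_addE F j x y : adj (addE F j) (emb x) (emb y) = adj F x y.
Proof. by rewrite /adj (inj_eq (@emb_inj)) -emb_set2 mem_addE. Qed.

Lemma adj_addE_max F j x : adj (addE F j) (emb x) ord_max = (x == j).
Proof.
by rewrite /adj emb_neq_max !inE (negbTE (new_edge_notin_embE _ _)) orbF new_edge_inj.
Qed.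

(** The retraction that contracts the new edge: [insub] fails only at the new vertex, which then
    falls back to [j]. *)
Definition attach j (u : 'I_n.+2) : 'I_n.+1 := odflt j (insub (val u)).

Lemma attach_emb j x : attach j (emb x) = x.
Proof. by rewrite /attach /= valK. Qed.

Lemma attach_max j : attach j ord_max = j.
Proof. by rewrite /attach insubN //= ltnn. Qed.

Lemma connect_map (A B : finType) (h : A -> B) (a : rel A) (b : rel B) :
  (forall u v, a u v -> connect b (h u) (h v)) ->
  forall u v, connect a u v -> connect b (h u) (h v).
Proof.
move=> ab u _ /connectP[s s_path ->]; elim: s u s_path => //= v s IH u.
by case/andP => /ab uv /IH; apply: connect_trans.
Qed.

(** Both [emb] and its retraction [attach j] send adjacent vertices to connected ones, and every
    vertex is connected to its retract. *)
Lemma connect_addE F j u v :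
  connect (adj (addE F j)) u v = connect (adj F) (attach j u) (attach j v).
Proof.
have old x y : connect (adj F) x y -> connect (adj (addE F j)) (emb x) (emb y).
  by apply: (connect_map (h := emb)) => {}x {}y xy; apply: connect1; rewrite adj_addE.
have retract w : connect (adj (addE F j)) w (emb (attach j w)).
  case: (embVmax w) => [x|] ->; first by rewrite attach_emb.
  by rewrite attach_max; apply: connect1; rewrite adj_sym adj_addE_max.
apply/idP/idP.
  apply: (connect_map (h := attach j)) => {}u {}v.
  case: (embVmax u) => [x|] ->; case: (embVmax v) => [y|] ->;
    rewrite ?attach_emb ?attach_max ?adj_addE ?adj_addE_max; do ?exact: connect1.
  - by move/eqP ->.
  - by rewrite adj_sym adj_addE_max => /eqP ->.
  - by rewrite /adj eqxx.
move=> /old uv; apply: connect_trans (retract u) (connect_trans uv _).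
by rewrite connect_adj_sym.
Qed.

Lemma connect_embE F x y :
  connect (adj (embE F)) (emb x) (emb y) = connect (adj F) x y.
Proof.
apply/idP/idP; last first.
  by apply: (connect_map (h := emb)) => {}x {}y xy; apply: connect1; rewrite adj_embE.
(* [embE F] is contained in [addE F x], whose connectivity is known; attaching at [x] is an
   arbitrary choice. *)
move=> xy; rewrite -[X in connect _ X _](attach_emb x) -[X in connect _ _ X](attach_emb x) -connect_addE.
apply: connect_sub xy => u v; rewrite /adj => /andP[uv uvF].
by apply: connect1; rewrite /adj uv !inE uvF orbT.
Qed.

Lemma connect_embE_max F x : connect (adj (embE F)) (emb x) ord_max = false.
Proof.
rewrite connect_adj_sym; apply/connectP => -[[|v s] /=].
  by move=> _ /eqP; rewrite (negbTE (emb_neq_max x)).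
case/andP => + _; case: (embVmax v) => [y|] ->; first by rewrite adj_sym adj_embE_max.
by rewrite /adj eqxx.
Qed.

(** The only neighbour of the new vertex is [j]. A cycle through the new vertex would visit [j]
    twice, and a simple path from the root can only end there, at the largest label. *)
Lemma addE_increasing T j : is_increasing_tree T -> is_increasing_tree (addE T j).
Proof.
move=> [[card_T conn_T acyc_T] inc_T].
have path_emb x s : path (adj (addE T j)) (emb x) (map emb s) = path (adj T) x s.
  by rewrite path_map; apply: eq_path => u v; exact: adj_addE.
split; first split.
- move=> e; rewrite !inE => /orP[/eqP ->|/imsetP[e0 e0T ->]].
    by rewrite cards2 emb_neq_max.
  by rewrite card_imset ?card_T //; exact: (@emb_inj).
- by move=> u v; rewrite connect_addE.
- move=> c /andP[c_cycle c_uniq]; have [c_max|c_max] := boolP (ord_max \in c); last first.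
    have [s E] := map_embP c_max; rewrite E size_map; apply: acyc_T; move: c_cycle c_uniq.
    rewrite E map_inj_uniq; last exact: (@emb_inj).
    rewrite /ucycle => + ->; rewrite andbT.
    by case: s {E} => //= x s; rewrite -map_rcons path_emb.
  have [i s E] := rot_to c_max; rewrite -(size_rot i) E.
  move: c_cycle c_uniq; rewrite -(rot_cycle i) -(rot_uniq i) E.
  case: s {E} => [|x [|y s]] //=.
  rewrite -cats1 cat_path /= andbT => /andP[jx /andP[_ /andP[_ yj]]].
  move=> /andP[max_s /andP[x_s _]].
  have z_s : last y s \in y :: s by exact: mem_last.
  move: (last y s) z_s yj => z z_s zj.
  case: (embVmax x) jx => [x0|] E; last by move: max_s; rewrite E inE eqxx.
  case: (embVmax z) zj => [z0|] E'; last first.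
    by move: max_s; rewrite in_cons negb_or -E' z_s andbF.
  rewrite E E' adj_addE_max adj_sym adj_addE_max => /eqP ? /eqP ?; subst.
  by rewrite z_s in x_s.
- move=> s s_path s_uniq; have [s_max|s_max] := boolP (ord_max \in s); last first.
    have [s0 E] := map_embP s_max; move: s_path s_uniq.
    rewrite E -emb0 path_emb -map_cons map_inj_uniq; last exact: (@emb_inj).
    move=> s0_path s0_uniq; have := inc_T _ s0_path s0_uniq.
    by rewrite sorted_map.
  case/splitPr: s_max s_path s_uniq => s1 s2.
  rewrite cat_path [path _ _ (_ :: _)]/= => /andP[s1_path /andP[s1_max s2_path]].
  rewrite -cat_cons cat_uniq => /andP[s1_uniq /andP[]].
  rewrite /= negb_or => /andP[max_s1 disj] /andP[max_s2 s2_uniq].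
  have [t E] : exists t, ord0 :: s1 = map emb t by apply: map_embP.
  case: t E => // z t [Ez Es1].
  have {}Ez : z = ord0 by apply: val_inj; rewrite /= -Ez.
  subst z; move: s1_max; rewrite Es1 -emb0 last_map adj_addE_max => /eqP Ej.
  have E2 : s2 = [::].
    case: s2 {s2_uniq max_s2} s2_path disj => //= v s2 /andP[+ _].
    case: (embVmax v) => [y|] ->; last by rewrite /adj eqxx.
    rewrite adj_sym adj_addE_max => /eqP ->; rewrite -Ej -last_map -Es1 emb0.
    by rewrite negb_or mem_last.
  rewrite E2 cats1 /= rcons_path; apply/andP; split.
    move: s1_path s1_uniq; rewrite Es1 -emb0 path_emb -map_cons map_inj_uniq; last exact: (@emb_inj).
    by move=> t_path t_uniq; have := inc_T _ t_path t_uniq; rewrite /= path_map.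
  by rewrite last_map /= ltn_ord.
Qed.

(** A simple path from the root increases, so it meets the largest vertex only at its end, and the
    other vertices stay connected without it. Two neighbours of that vertex would be joined by a
    path among the others and close a cycle, so [j] is unique. *)
Lemma increasing_addE (T : graph n.+1) : is_increasing_tree T ->
  exists T' : graph n, exists j, is_increasing_tree T' /\ T = addE T' j.
Proof.
move=> [[card_T conn_T acyc_T] inc_T].
pose T' : graph n := [set e : {set 'I_n.+1} | (emb @: e)%SET \in T]%SET.
have adjT' x y : adj T' x y = adj T (emb x) (emb y).
  by rewrite /adj (inj_eq (@emb_inj)) inE emb_set2.
have path_emb x s : path (adj T) (emb x) (map emb s) = path (adj T') x s.
  by rewrite path_map; apply: eq_path => u v; rewrite /= adjT'.
have max_last s : path (adj T) ord0 s -> uniq (ord0 :: s) -> ord_max \in s ->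
    exists s1, s = rcons s1 ord_max.
  move=> s_path s_uniq s_max; have := inc_T _ s_path s_uniq.
  case/splitPr: s_max => s1 [|v s2]; first by exists s1; rewrite cats1.
  by rewrite /= cat_path /= => /and4P[_ _ + _]; rewrite ltnNge leq_ord.
have conn0 x : connect (adj T') ord0 x.
  have /connectP[p0 p0_path] := conn_T ord0 (emb x).
  case/shortenP: p0_path => p p_path p_uniq _ Ex.
  have p_max : ord_max \notin p.
    apply/negP => /(max_last _ p_path p_uniq)[s1 E].
    by move/eqP: Ex; rewrite E last_rcons (negbTE (emb_neq_max x)).
  have [s E] := map_embP p_max; apply/connectP; exists s.
    by rewrite -path_emb emb0 -E.
  by apply: emb_inj; rewrite Ex E -emb0 last_map.
have conn x y : connect (adj T') x y.
  by apply: connect_trans (conn0 y); rewrite connect_adj_sym.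
have [j j_max] : exists j, adj T (emb j) ord_max.
  have /connectP[p0 p0_path] := conn_T ord0 ord_max.
  case/shortenP: p0_path => p p_path p_uniq _ Ex.
  have : ord_max \in (ord0 : 'I_n.+2) :: p by rewrite Ex mem_last.
  rewrite in_cons => /orP[//|p_max].
  have [s1 E] := max_last _ p_path p_uniq p_max.
  move: p_uniq p_path; rewrite E -rcons_cons rcons_uniq rcons_path.
  move=> /andP[s1_max _] /andP[_].
  have := mem_last (ord0 : 'I_n.+2) s1.
  case: (embVmax (last ord0 s1)) => [x|] ->; first by exists x.
  by rewrite (negbTE s1_max).
have j_uniq x : adj T (emb x) ord_max -> x = j.
  move=> x_max; apply/eqP/negPn/negP => xj.
  have /connectP[p0 p0_path] := conn x j.
  case/shortenP: p0_path => p p_path p_uniq _ Ej.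
  have p_nil : (0 < size p)%N by case: p Ej {p_path p_uniq} => //= Ej; rewrite Ej eqxx in xj.
  suff /acyc_T : ucycle (adj T) (ord_max :: map emb (x :: p)).
    by rewrite /= size_map; case: p p_nil {p_path p_uniq Ej}.
  apply/andP; split.
    rewrite /= rcons_path path_emb p_path last_map -Ej j_max andbT.
    by rewrite adj_sym x_max.
  rewrite cons_uniq map_inj_uniq; last exact: (@emb_inj).
  rewrite p_uniq andbT; apply/mapP => -[z _ E].
  by have := emb_neq_max z; rewrite -E eqxx.
have T_eq : T = addE T' j.
  apply/setP => e; apply/idP/idP; last first.
    rewrite !inE => /orP[/eqP ->|/imsetP[e0 + ->]]; last by rewrite inE.
    by case/andP: j_max.
  move=> eT; have /eqP/cards2P[u [v [uv Ee]]] := card_T _ eT.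
  have uvT : adj T u v by rewrite /adj uv -Ee.
  case: (embVmax u) uvT => [x|] Eu; case: (embVmax v) => [y|] Ev; subst u v.
  - by rewrite Ee -emb_set2 mem_addE inE emb_set2 => /andP[].
  - by move/j_uniq => xj; rewrite Ee xj !inE eqxx.
  - by rewrite adj_sym => /j_uniq yj; rewrite Ee yj finset.setUC !inE eqxx.
  - by rewrite eqxx in uv.
exists T', j; split=> //; split; first split => //.
- by move=> e; rewrite inE => /card_T; rewrite card_imset //; exact: (@emb_inj).
- move=> c /andP[c_cycle c_uniq]; rewrite -(size_map emb); apply: acyc_T.
  rewrite /ucycle map_inj_uniq; last exact: (@emb_inj).
  by rewrite c_uniq andbT; case: c c_cycle {c_uniq} => //= x s; rewrite -map_rcons path_emb.
move=> s s_path s_uniq; have := inc_T (map emb s).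
rewrite -emb0 path_emb s_path -map_cons map_inj_uniq; last exact: (@emb_inj).
by rewrite s_uniq sorted_map => /(_ isT isT).
Qed.

Lemma addE_inj : injective (fun Tj : graph n * 'I_n.+1 => addE Tj.1 Tj.2).
Proof.
move=> [T1 j1] [T2 j2] /= E.
have E1 : T1 = T2 by apply/setP => e; rewrite -(mem_addE T1 j1) E mem_addE.
congr pair => //; have := adj_addE_max T1 j1 j1.
by rewrite E adj_addE_max eqxx => /eqP.
Qed.

End GraphExtension.

(** * The one-step recursion of percolation on the tree *)

Section PercolationRecursion.
Local Open Scope ring_scope.
Variables (R : realType) (p : R) (n : nat).

Lemma embE_inj : injective (@embE n).
Proof. by move=> F1 F2 E; apply/setP => e; rewrite -mem_embE E mem_embE. Qed.

Lemma addEr_inj (j : 'I_n.+1) : injective (@addE n ^~ j).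
Proof. by move=> F1 F2 E; apply/setP => e; rewrite -(mem_addE _ j) E mem_addE. Qed.

Lemma embE_subset (F T : graph n) j : (embE F \subset addE T j) = (F \subset T).
Proof.
apply/fintype.subsetP/fintype.subsetP => FT e; first by rewrite -mem_embE => /FT; rewrite mem_addE.
by case/imsetP => e0 /FT eT ->; rewrite mem_addE.
Qed.

Lemma addE_subset (F T : graph n) j : (addE F j \subset addE T j) = (F \subset T).
Proof. by rewrite finset.subUset embE_subset finset.sub1set !inE eqxx. Qed.

Lemma mem_embE_imset (e : {set 'I_n.+2}) (T : graph n) j : e \in addE T j ->
  e != [set emb j; ord_max]%SET -> exists2 e0, e0 \in T & e = (@emb n @: e0)%SET.
Proof. by rewrite !inE => /orP[->//|/imsetP[e0 ? ->] _]; exists e0. Qed.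

Lemma sub_addE_with (T : graph n) j :
  [set F : graph n.+1 | (F \subset addE T j) && ([set emb j; ord_max]%SET \in F)]%SET =
  [set addE F j | F in powerset T]%SET.
Proof.
apply/setP => F; rewrite inE; apply/andP/imsetP => [[FT Fj]|[F0 F0T ->]]; last first.
  by rewrite addE_subset -powersetE F0T !inE eqxx.
exists [set e : {set 'I_n.+1} | (@emb n @: e)%SET \in F]%SET.
  rewrite powersetE; apply/fintype.subsetP => e; rewrite inE => /(fintype.subsetP FT).
  by rewrite mem_addE.
apply/setP => e; have [->|e_new] := eqVneq e [set emb j; ord_max]%SET.
  by rewrite Fj !inE eqxx.
apply/idP/idP => [eF|].
  have [e0 e0T E] := mem_embE_imset (fintype.subsetP FT _ eF) e_new.
  by rewrite E mem_addE inE -E.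
by case/mem_embE_imset => // e0; rewrite inE => + ->.
Qed.

Lemma sub_addE_without (T : graph n) j :
  [set F : graph n.+1 | (F \subset addE T j) && ([set emb j; ord_max]%SET \notin F)]%SET =
  [set embE F | F in powerset T]%SET.
Proof.
apply/setP => F; rewrite inE; apply/andP/imsetP => [[FT Fj]|[F0 F0T ->]]; last first.
  by rewrite embE_subset -powersetE F0T new_edge_notin_embE.
exists [set e : {set 'I_n.+1} | (@emb n @: e)%SET \in F]%SET.
  rewrite powersetE; apply/fintype.subsetP => e; rewrite inE => /(fintype.subsetP FT).
  by rewrite mem_addE.
apply/setP => e; apply/idP/idP => [eF|].
  have e_new : e != [set emb j; ord_max]%SET by apply: contraNneq Fj => <-.
  have [e0 e0T E] := mem_embE_imset (fintype.subsetP FT _ eF) e_new.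
  by rewrite E mem_embE inE -E.
by case/imsetP => // e0; rewrite inE => + ->.
Qed.

Definition edge_weight m (T F : graph m) : R := \prod_(e in T) (if e \in F then p else 1 - p).

Lemma edge_weight_with (T F : graph n) j :
  edge_weight (addE T j) (addE F j) = p * edge_weight T F.
Proof.
rewrite /edge_weight big_setU1 ?new_edge_notin_embE //= !inE eqxx /=; congr (_ * _).
rewrite big_imset /=; last by move=> ? ? _ _; exact: (imset_inj (@emb_inj n)).
by apply: eq_bigr => e _; rewrite mem_addE.
Qed.

Lemma edge_weight_without (T F : graph n) j :
  edge_weight (addE T j) (embE F) = (1 - p) * edge_weight T F.
Proof.
rewrite /edge_weight big_setU1 ?new_edge_notin_embE //= (negbTE (new_edge_notin_embE _ _)).
congr (_ * _).
rewrite big_imset /=; last by move=> ? ? _ _; exact: (imset_inj (@emb_inj n)).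
by apply: eq_bigr => e _; rewrite mem_embE.
Qed.

Lemma perc_sum_addE (T : graph n) j (g : graph n.+1 -> R) :
  \sum_(F : graph n.+1 | F \subset addE T j) edge_weight (addE T j) F * g F =
  \sum_(F : graph n | F \subset T)
     edge_weight T F * (p * g (addE F j) + (1 - p) * g (embE F)).
Proof.
rewrite (bigID (fun F : graph n.+1 => [set emb j; ord_max]%SET \in F)) /=.
rewrite [X in _ + X = _](_ : _ = \sum_(F in [set embE F | F in powerset T]%SET)
    edge_weight (addE T j) F * g F); last first.
  by apply: eq_bigl => F; rewrite -(sub_addE_without T j) inE.
rewrite [X in X + _ = _](_ : _ = \sum_(F in [set addE F j | F in powerset T]%SET)
    edge_weight (addE T j) F * g F); last first.
  by apply: eq_bigl => F; rewrite -(sub_addE_with T j) inE.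
rewrite big_imset /=; last by move=> ? ? _ _; exact: addEr_inj.
rewrite big_imset /=; last by move=> ? ? _ _; exact: embE_inj.
rewrite -big_split /=; apply: eq_big => F; first by rewrite powersetE.
by rewrite edge_weight_with edge_weight_without => _; ring.
Qed.

Lemma incr_imset :
  [set T | increasing_tree n.+1 T]%SET =
  [set addE Tj.1 Tj.2 | Tj in [set Tj : graph n * 'I_n.+1 | increasing_tree n Tj.1]%SET]%SET.
Proof.
apply/setP => T; rewrite inE; apply/asboolP/imsetP => [/increasing_addE[T' [j [T'inc ->]]]|].
  by exists (T', j); rewrite // inE; apply/asboolP.
by move=> [[T' j]]; rewrite inE => /asboolP T'inc ->; apply: addE_increasing.
Qed.

Lemma sum_incr (G : graph n.+1 -> R) :
  \sum_(T | increasing_tree n.+1 T) G T =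
  \sum_(T | increasing_tree n T) \sum_j G (addE T j).
Proof.
transitivity (\sum_(T in [set T | increasing_tree n.+1 T]%SET) G T).
  by apply: eq_bigl => T; rewrite inE.
rewrite incr_imset big_imset /=; last by move=> ? ? _ _; exact: addE_inj.
rewrite pair_big /=; apply: eq_bigl => Tj; by rewrite inE andbT.
Qed.

Lemma card_incr : #|increasing_tree n.+1| = (#|increasing_tree n| * n.+1)%N.
Proof.
rewrite -cardsE incr_imset card_imset; last exact: addE_inj.
rewrite (_ : [set Tj | _]%SET = finset.setX [set T | increasing_tree n T]%SET [set: 'I_n.+1]%SET).
  by rewrite cardsX cardsT card_ord cardsE.
by apply/setP => Tj; rewrite !inE andbT.
Qed.

(** The larger trees correspond to pairs of a smaller tree and an attachment vertex [j], all equally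
    likely; the new edge is kept or removed independently of the rest. *)
Lemma percE_step (g : graph n.+1 -> R) :
  percE p g = percE p (fun F : graph n =>
    n.+1%:R^-1 * \sum_j (p * g (addE F j) + (1 - p) * g (embE F))).
Proof.
rewrite /percE card_incr natrM invfM -mulrA; congr (_ * _).
rewrite (sum_incr (fun T => \sum_(F : graph n.+1 | F \subset T) edge_weight T F * g F)).
rewrite mulr_sumr; apply: eq_bigr => T _.
under eq_bigr do rewrite perc_sum_addE.
rewrite exchange_big /= mulr_sumr; apply: eq_bigr => F _.
by rewrite -mulr_sumr; rewrite mulrCA.
Qed.

End PercolationRecursion.

Local Open Scope ring_scope.

(** * The Markov chain of cluster sizes *)

(* A state lists the cluster sizes in order of birth, the root cluster first, so
   that a cluster keeps its index when the tree grows; a new vertex starts its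
   own cluster with probability [1 - p] and otherwise joins a cluster chosen
   with probability proportional to its size. *)
Definition chain_step (R : realType) (p : R) (phi : seq nat -> R) (s : seq nat) : R :=
  (1 - p) * phi (rcons s 1%N) +
  p / (sumn s)%:R * \sum_(a < size s) (nth 0%N s a)%:R * phi (incr_nth s a).

(* [c] numbers the clusters. *)
Definition cluster_sizes n (F : graph n) (s : seq nat) : Prop :=
  exists c : 'I_n.+1 -> nat,
  [/\ forall x, (c x < size s)%N,
      forall x y, connect (adj F) x y = (c x == c y),
      forall a, (a < size s)%N -> nth 0%N s a = #|[set x | c x == a]%SET|,
      c ord0 = 0%N & all (leq 1) s].

Section ClusterSizes.
Variable n : nat.
Implicit Types (F : graph n) (s : seq nat).

Lemma card_old_new (c : 'I_n.+2 -> nat) a :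
  #|[set u | c u == a]%SET| = (#|[set x | c (emb x) == a]%SET| + (c ord_max == a))%N.
Proof.
rewrite -!sum1dep_card big_mkcond [in RHS]big_mkcond /= big_ord_recr /=.
by congr (_ + _)%N; apply: eq_bigr => x _; rewrite (_ : widen_ord _ x = emb x) //; apply: val_inj.
Qed.

Lemma sumn_label s (c : 'I_n.+1 -> nat) : (forall x, (c x < size s)%N) ->
  (forall a, (a < size s)%N -> nth 0%N s a = #|[set x | c x == a]%SET|) -> sumn s = n.+1.
Proof.
move=> c_lt c_card; rewrite sumnE (big_nth 0%N) big_mkord.
under eq_bigr => a _ do rewrite c_card // -sum1dep_card.
rewrite -[RHS]card_ord -sum1_card.
by rewrite (partition_big (fun x => Ordinal (c_lt x)) xpredT).
Qed.

Lemma sumn_cluster_sizes F s : cluster_sizes F s -> sumn s = n.+1.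
Proof. by case=> c [c_lt _ c_card _ _]; apply: sumn_label c_lt c_card. Qed.

Lemma cluster_sizes_embE F s : cluster_sizes F s -> cluster_sizes (embE F) (rcons s 1%N).
Proof.
case=> c [c_lt c_conn c_card c0 s_pos].
(* The new singleton takes the first free label; the default [ord0] of [attach] is never reached in
   the other branch. *)
pose c' (u : 'I_n.+2) := if u == ord_max then size s else c (attach ord0 u).
have c'emb x : c' (emb x) = c x by rewrite /c' (negbTE (emb_neq_max x)) attach_emb.
have c'max : c' ord_max = size s by rewrite /c' eqxx.
exists c'; split.
- move=> u; rewrite size_rcons; case: (embVmax u) => [x|] ->; last by rewrite c'max.
  by rewrite c'emb ltnS ltnW.
- move=> u v; case: (embVmax u) => [x|] ->; case: (embVmax v) => [y|] ->; rewrite ?c'emb ?c'max.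
  + by rewrite connect_embE c_conn.
  + by rewrite connect_embE_max; apply/esym/negbTE; rewrite neq_ltn c_lt.
  + by rewrite connect_adj_sym connect_embE_max; apply/esym/negbTE; rewrite neq_ltn c_lt orbT.
  + by rewrite connect0 eqxx.
- move=> a; rewrite size_rcons ltnS leq_eqVlt => a_le.
  rewrite card_old_new c'max nth_rcons.
  have -> : [set x | c' (emb x) == a]%SET = [set x | c x == a]%SET.
    by apply/setP => x; rewrite !inE c'emb.
  case/orP: a_le => [/eqP ->|a_lt]; last first.
    by rewrite a_lt c_card // gtn_eqF ?addn0.
  rewrite ltnn eqxx; apply/eqP; rewrite -{1}[1%N]add0n eqn_add2r eq_sym cards_eq0.
  apply/eqP/setP => x; rewrite !inE; apply/negbTE; by rewrite neq_ltn c_lt.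
- by rewrite -emb0 c'emb.
- by rewrite all_rcons.
Qed.

(** The numbering [c] is exposed because the entry to increment is [c j], which [cluster_sizes]
    hides. *)
Lemma cluster_sizes_addE F s (c : 'I_n.+1 -> nat) j :
  (forall x, (c x < size s)%N) ->
  (forall x y, connect (adj F) x y = (c x == c y)) ->
  (forall a, (a < size s)%N -> nth 0%N s a = #|[set x | c x == a]%SET|) ->
  c ord0 = 0%N -> all (leq 1) s ->
  cluster_sizes (addE F j) (incr_nth s (c j)).
Proof.
move=> c_lt c_conn c_card c0 s_pos; exists (c \o attach j).
have s_size : size (incr_nth s (c j)) = size s by rewrite size_incr_nth c_lt.
split.
- by move=> x; rewrite s_size; exact: c_lt.
- by move=> x y; rewrite connect_addE c_conn.
- move=> a; rewrite s_size => a_lt; rewrite card_old_new /= attach_max nth_incr_nth addnC c_card //.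
  by congr (#|pred_of_set _| + _)%N; apply/setP => x; rewrite !inE /= attach_emb.
- by rewrite -emb0 /= attach_emb.
- apply/(all_nthP 0%N) => i; rewrite s_size => i_lt; rewrite nth_incr_nth.
  by rewrite (leq_trans (all_nthP 0%N s_pos i i_lt)) // leq_addl.
Qed.

End ClusterSizes.

Section ClusterSizesChain.
Variables (R : realType) (p : R).

(** Grouping the attachment vertices by cluster turns a uniform vertex into a cluster chosen in
    proportion to its size. *)
Lemma chain_step_average n (F : graph n) s (g : graph n.+1 -> R) (phi : seq nat -> R) :
  (forall F' s', cluster_sizes F' s' -> g F' = phi s') -> cluster_sizes F s ->
  n.+1%:R^-1 * (\sum_j (p * g (addE F j) + (1 - p) * g (embE F))) = chain_step p phi s.
Proof.
move=> gphi Fs; have s_sum := sumn_cluster_sizes Fs.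
rewrite /chain_step s_sum -(gphi _ _ (cluster_sizes_embE Fs)).
case: Fs => c [c_lt c_conn c_card c0 s_pos].
rewrite big_split /= sumr_const card_ord mulrDr addrC; congr (_ + _).
  by rewrite -[(_ * _) *+ _]mulr_natl mulKf ?pnatr_eq0.
rewrite -mulr_sumr mulrA [_^-1 * p]mulrC; congr (_ * _).
rewrite (partition_big (fun x => Ordinal (c_lt x)) xpredT) //=; apply: eq_bigr => a _.
rewrite c_card // -sum1dep_card natr_sum mulr_suml; apply: eq_bigr => j /eqP Ej.
rewrite mul1r (gphi _ (incr_nth s a)) // -(congr1 val Ej) /=.
exact: cluster_sizes_addE.
Qed.

Lemma increasing_tree0 (T : graph 0) : increasing_tree 0 T = (T == finset.set0).
Proof.
apply/asboolP/eqP => [[[card_T _ _] _]|->].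
  apply/setP => e; rewrite inE; apply/negP => /card_T e2.
  by have := max_card (pred_of_set e); rewrite e2 card_ord.
have small (s : seq 'I_1) : uniq s -> (size s <= 1)%N.
  by move/card_uniqP <-; rewrite -[X in (_ <= X)%N](card_ord 1) max_card.
split; first split.
- by move=> e; rewrite inE.
- by move=> x y; rewrite !ord1 connect0.
- by move=> c /andP[_ /small /leqW].
- by move=> s _ /small /=; case: s.
Qed.

Lemma cluster_sizes0 : cluster_sizes (finset.set0 : graph 0) [:: 1%N].
Proof.
exists (fun=> 0%N); split => //.
- by move=> x y; rewrite !ord1 connect0.
- case=> // _; by rewrite (_ : finset _ = [set: 'I_1]%SET) ?cardsT ?card_ord //.
Qed.

(** [chain_step] is the transition operator acting on functions of the state, so its iterates at the
    one-vertex state are expectations. From here on graphs are needed only to read off the sizes. *)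
Lemma percE_chain n (g : graph n -> R) (phi : seq nat -> R) :
  (forall F s, cluster_sizes F s -> g F = phi s) ->
  percE p g = iter n (chain_step p) phi [:: 1%N].
Proof.
elim: n g phi => [|n IH] g phi gphi.
  rewrite /percE (eq_card (B := pred1 finset.set0)); last first.
    by move=> T; rewrite [LHS]increasing_tree0.
  rewrite card1 invr1 mul1r (eq_bigl (pred1 finset.set0)); last exact: increasing_tree0.
  rewrite big_pred1_eq (eq_bigl (pred1 finset.set0)); last by move=> F; rewrite finset.subset0.
  by rewrite big_pred1_eq finset.big_set0 mul1r (gphi _ _ cluster_sizes0).
rewrite percE_step iterSr; apply: IH => F s Fs.
exact: chain_step_average.
Qed.

Lemma root_cluster_sizeE n (F : graph n) s : cluster_sizes F s ->
  root_cluster_size F = nth 0%N s 0.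
Proof.
case=> c [c_lt c_conn c_card c0 s_pos]; rewrite /root_cluster_size c_card; last first.
  by rewrite (leq_trans _ (c_lt ord0)).
congr #|pred_of_set _|; apply/setP => x.
by rewrite !inE c_conn c0 eq_sym.
Qed.

(** Positive entries make the blocks of the labelling nonempty, hence distinct for distinct labels:
    the clusters other than that of the root correspond one to one to the labels from 1 on. *)
Lemma other_cluster_sizeE n (F : graph n) s i : cluster_sizes F s ->
  other_cluster_size F i = nth 0%N (sort geq (behead s)) i.
Proof.
case=> c [c_lt c_conn c_card c0 s_pos]; rewrite /other_cluster_size.
pose block a := [set x | c x == a]%SET.
have cl_block x : Defs.cluster F x = block (c x).
  by apply/setP => y; rewrite !inE c_conn eq_sym.
have block_ex a : (a < size s)%N -> exists x, c x = a.
  move=> a_lt; have := all_nthP 0%N s_pos a a_lt; rewrite c_card // card_gt0.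
  by case/set0Pn => x; rewrite inE => /eqP <-; exists x.
have block_inj a b : (a < size s)%N -> block a = block b -> a = b.
  by case/block_ex => x <- /setP/(_ x); rewrite !inE eqxx => /esym/eqP.
have others : perm_eq (enum (other_clusters F)) [seq block a | a <- iota 1 (size s).-1].
  apply: uniq_perm; first exact: enum_uniq.
    rewrite map_inj_in_uniq ?iota_uniq // => a b; rewrite !mem_iota => a_in _.
    by apply: block_inj; lia.
  move=> C; rewrite mem_enum !inE; apply/andP/mapP => [[C0 /imsetP[x _ EC]]|[a + ->]].
    exists (c x); last by rewrite EC cl_block.
    rewrite mem_iota; have := c_lt x; move: C0; rewrite EC !cl_block c0.
    by case: (c x) => [|k]; [rewrite eqxx | lia].
  rewrite mem_iota => a_in; have a_lt : (a < size s)%N by lia.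
  split; last by have [x Ex] := block_ex _ a_lt; apply/imsetP; exists x; rewrite // cl_block Ex.
  rewrite cl_block c0; apply/eqP => /block_inj -/(_ a_lt); lia.
congr nth; apply/perm_sortP.
- by move=> x y; rewrite /geq /=; exact: leq_total.
- by move=> x y z; rewrite /geq /= => yx xz; exact: leq_trans xz yx.
- by move=> x y; rewrite /geq /= andbC -eqn_leq => /eqP.
rewrite /image_mem; apply: perm_trans (perm_map _ others) _.
rewrite -map_comp (_ : map _ _ = behead s) //.
apply: (@eq_from_nth _ 0%N); rewrite size_map size_iota ?size_behead // => k k_lt.
rewrite (nth_map 0%N) ?size_iota // nth_iota // /= nth_behead add1n c_card //; lia.
Qed.

End ClusterSizesChain.

(** * Expectations under the chain *)

Section Reachable.
Implicit Types s t u : seq nat.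

(** Not the exact set of states after [m] steps, but three properties of them that compose and
    suffice to compare expectations. *)
Definition reachable m s t : Prop :=
  [/\ sumn t = (sumn s + m)%N, (size s <= size t)%N & (nth 0%N s 0 <= nth 0%N t 0)%N].

Lemma sumn_rcons s x : sumn (rcons s x) = (sumn s + x)%N.
Proof. by rewrite -cats1 sumn_cat /= addn0. Qed.

Lemma reachable_rcons s : (0 < sumn s)%N -> reachable 1 s (rcons s 1%N).
Proof.
case: s => // a s _; split => //=; first by rewrite sumn_rcons; lia.
by rewrite size_rcons; lia.
Qed.

Lemma sumn_incr s a : sumn (incr_nth s a) = (sumn s).+1.
Proof.
elim: s a => [|x s IH] [|a] //=; last by rewrite IH addnS.
by elim: a => //= a ->.
Qed.

Lemma reachable_incr s a : (a < size s)%N -> reachable 1 s (incr_nth s a).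
Proof.
move=> a_lt; split; last by rewrite nth_incr_nth; lia.
  by rewrite sumn_incr addn1.
by rewrite size_incr_nth a_lt.
Qed.

Lemma reachable_trans m k s t u : reachable m s t -> reachable k t u -> reachable (m + k) s u.
Proof. by move=> [A B C] [D E F]; split; [lia | apply: leq_trans E | apply: leq_trans F]. Qed.

Lemma reachable_sumn_gt0 m s t : (0 < sumn s)%N -> reachable m s t -> (0 < sumn t)%N.
Proof. by move=> s0 [-> _ _]; lia. Qed.

End Reachable.

Section ChainBasics.
Variables (R : realType) (p : R).
Hypotheses (p_ge0 : 0 <= p) (p_le1 : p <= 1).
Implicit Types (phi psi : seq nat -> R) (s t : seq nat) (w : nat -> R) (g : nat -> R).

Notation chain m := (iter m (chain_step p)).

Lemma chain_step_le phi psi s : (0 < sumn s)%N ->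
  (forall t, reachable 1 s t -> phi t <= psi t) -> chain_step p phi s <= chain_step p psi s.
Proof.
have q_ge0 : 0 <= 1 - p by rewrite subr_ge0.
move=> s0 le; rewrite /chain_step; apply: lerD.
  by apply: ler_wpM2l; [exact: q_ge0 | exact: le (reachable_rcons s0)].
apply: ler_wpM2l; first by rewrite divr_ge0.
by apply: ler_sum => a _; apply: ler_wpM2l => //; exact/le/reachable_incr.
Qed.

Lemma chain_le m phi psi s : (0 < sumn s)%N ->
  (forall t, reachable m s t -> phi t <= psi t) -> chain m phi s <= chain m psi s.
Proof.
elim: m s => [|m IH] s s0 le; first by apply: le; split; rewrite ?addn0.
rewrite !iterS; apply: chain_step_le => // t st; apply: IH; first exact: reachable_sumn_gt0 st.
by move=> u tu; apply: le; exact: reachable_trans st tu.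
Qed.

Lemma eq_chain m phi psi s : (0 < sumn s)%N ->
  (forall t, reachable m s t -> phi t = psi t) -> chain m phi s = chain m psi s.
Proof.
by move=> s0 e; apply/eqP; rewrite eq_le !chain_le // => t st; rewrite e.
Qed.

Lemma chain_stepD phi psi s :
  chain_step p (fun t => phi t + psi t) s = chain_step p phi s + chain_step p psi s.
Proof.
rewrite /chain_step; under eq_bigr do rewrite mulrDr.
by rewrite big_split /=; ring.
Qed.

Lemma chain_stepZ a phi s : chain_step p (fun t => a * phi t) s = a * chain_step p phi s.
Proof.
rewrite /chain_step; under eq_bigr do rewrite mulrCA.
by rewrite -mulr_sumr; ring.
Qed.

Lemma chain_step_ext phi psi : phi =1 psi -> chain_step p phi =1 chain_step p psi.
Proof.
by move=> e s; rewrite /chain_step e; congr (_ + _ * _); apply: eq_bigr => a _; rewrite e.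
Qed.

Lemma chain_ext m phi psi : phi =1 psi -> chain m phi =1 chain m psi.
Proof. by move=> e; elim: m => //= m IH; exact: chain_step_ext. Qed.

Lemma chainD m phi psi s :
  chain m (fun t => phi t + psi t) s = chain m phi s + chain m psi s.
Proof.
elim: m s => // m IH s; rewrite !iterS -chain_stepD; exact: chain_step_ext.
Qed.

Lemma chainZ m a phi s : chain m (fun t => a * phi t) s = a * chain m phi s.
Proof.
elim: m s => // m IH s; rewrite !iterS -chain_stepZ; exact: chain_step_ext.
Qed.

Lemma sum_size_sumn s : \sum_(a < size s) (nth 0%N s a)%:R = (sumn s)%:R :> R.
Proof. by rewrite sumnE (big_nth 0%N) big_mkord natr_sum. Qed.

Lemma chain_step_cst c s : (0 < sumn s)%N -> chain_step p (fun=> c) s = c.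
Proof.
move=> s0; rewrite /chain_step -mulr_suml sum_size_sumn.
by field; rewrite pnatr_eq0 -lt0n.
Qed.

Lemma chain_cst m c s : (0 < sumn s)%N -> chain m (fun=> c) s = c.
Proof.
elim: m s => // m IH s s0; rewrite iterS -[RHS](chain_step_cst c s0).
apply: (@eq_chain 1) => // t st; exact/IH/(reachable_sumn_gt0 s0 st).
Qed.

Lemma chain_ge0 m phi s : (0 < sumn s)%N -> (forall t, reachable m s t -> 0 <= phi t) ->
  0 <= chain m phi s.
Proof. by move=> s0 ge; rewrite -(chain_cst m 0 s0); apply: chain_le. Qed.

Lemma chain_norm_le m phi psi s : (0 < sumn s)%N ->
  (forall t, reachable m s t -> `|phi t| <= psi t) -> `|chain m phi s| <= chain m psi s.
Proof.
move=> s0 le; rewrite ler_norml; apply/andP; split; last first.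
  by apply: chain_le => // t /le; rewrite ler_norml => /andP[].
rewrite -[X in X <= _]mulN1r -chainZ; apply: chain_le => // t /le.
by rewrite mulN1r ler_norml => /andP[].
Qed.

(** The index weight lets one drift formula serve the root, the other clusters, and the clusters
    compared with their size in an earlier state. *)
Definition stat w g s := \sum_(j < size s) w j * g (nth 0%N s j).

Lemma stat_rcons w g s x : stat w g (rcons s x) = stat w g s + w (size s) * g x.
Proof.
rewrite /stat size_rcons big_ord_recr /= nth_rcons ltnn eqxx; congr (_ + _).
by apply: eq_bigr => j _; rewrite nth_rcons ltn_ord.
Qed.

Lemma stat_incr w g s a : (a < size s)%N ->
  stat w g (incr_nth s a) = stat w g s + w a * (g (nth 0%N s a).+1 - g (nth 0%N s a)).
Proof.
move=> a_lt; rewrite /stat size_incr_nth a_lt.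
rewrite (bigD1 (Ordinal a_lt)) //= [in RHS](bigD1 (Ordinal a_lt)) //=.
rewrite nth_incr_nth eqxx add1n.
rewrite [X in _ + X = _](_ : _ = \sum_(i < size s | i != Ordinal a_lt) w i * g (nth 0%N s i)); first by ring.
apply: eq_bigr => j ja; rewrite nth_incr_nth.
have /negbTE -> : a != j by apply: contra ja => /eqP E; apply/eqP/val_inj.
by rewrite add0n.
Qed.

Lemma chain_step_stat w g s : (0 < sumn s)%N ->
  chain_step p (stat w g) s = stat w g s +
    p / (sumn s)%:R * stat w (fun x => x%:R * (g x.+1 - g x)) s + (1 - p) * (w (size s) * g 1%N).
Proof.
move=> s0; rewrite /chain_step stat_rcons.
under eq_bigr => a _ do rewrite stat_incr // mulrDr.
rewrite big_split /= -mulr_suml sum_size_sumn.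
rewrite [X in _ / _ * (_ + X)](_ : _ = stat w (fun x => x%:R * (g x.+1 - g x)) s); last first.
  by apply: eq_bigr => a _; rewrite mulrCA.
by field; rewrite pnatr_eq0 -lt0n.
Qed.

Lemma chain_step_root g s : (0 < sumn s)%N ->
  chain_step p (fun t => g (nth 0%N t 0)) s =
  g (nth 0%N s 0) + p / (sumn s)%:R * ((nth 0%N s 0)%:R * (g (nth 0%N s 0).+1 - g (nth 0%N s 0))).
Proof.
move=> s0; pose w j : R := (j == 0%N)%:R.
have statw h t : (0 < sumn t)%N -> stat w h t = h (nth 0%N t 0).
  case: t => // x t _; rewrite /stat /= big_ord_recl /= /w eqxx mul1r big1 ?addr0 // => i _.
  by rewrite mul0r.
have -> : chain_step p (fun t => g (nth 0%N t 0)) s = chain_step p (stat w g) s.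
  by apply: (@eq_chain 1) => // t st; rewrite statw // (reachable_sumn_gt0 s0 st).
rewrite chain_step_stat // !statw // /w.
by case: s s0 => //= x s _; rewrite mul0r mulr0 addr0.
Qed.

(* [growth q i m] is the factor by which a statistic with relative drift [q / i]
   grows in [m] steps from total size [i]. *)
Definition growth (q : R) i m : R := \prod_(k < m) (1 + q / (i + k)%:R).

Lemma growth_gt0 q i m : 0 <= q -> 0 < growth q i m.
Proof.
by move=> q0; apply: prodr_gt0 => k _; rewrite ltr_wpDr // divr_ge0.
Qed.

Lemma growthS q i m : growth q i m.+1 = growth q i m * (1 + q / (i + m)%:R).
Proof. by rewrite /growth big_ord_recr. Qed.

Lemma growthD q i m k : growth q i (m + k) = growth q i m * growth q (i + m) k.
Proof.
rewrite /growth big_split_ord /=; congr (_ * _).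
by apply: eq_bigr => j _; rewrite addnA.
Qed.

(** A statistic with relative drift exactly [q / i] becomes a martingale once divided by the growth
    factor. *)
Lemma chain_growth q phi m s : (0 < sumn s)%N ->
  (forall t, (0 < sumn t)%N -> (size s <= size t)%N -> chain_step p phi t = phi t * (1 + q / (sumn t)%:R)) ->
  chain m phi s = phi s * growth q (sumn s) m.
Proof.
move=> s0 step; elim: m => [|m IH]; first by rewrite /growth big_ord0 mulr1.
rewrite iterSr growthS mulrA -IH mulrC -chainZ; apply: eq_chain => // t st.
rewrite step ?(reachable_sumn_gt0 s0 st) //; last by case: st.
by rewrite mulrC; case: st => ->.
Qed.

Lemma chain_root1 m s : (0 < sumn s)%N ->
  chain m (fun t => (nth 0%N t 0)%:R) s = (nth 0%N s 0)%:R * growth p (sumn s) m.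
Proof.
move=> s0; apply: (chain_growth (phi := fun t => (nth 0%N t 0)%:R)) => // t t0 _.
by rewrite (chain_step_root (fun x => x%:R)) // -natr1; field; rewrite pnatr_eq0 -lt0n.
Qed.

(** The rising factorial, unlike the square, is an eigenfunction of the growth: [x ((x + 1) (x + 2)
    - x (x + 1)) = 2 x (x + 1)]. *)
Lemma chain_root2 m s : (0 < sumn s)%N ->
  chain m (fun t => (nth 0%N t 0)%:R * (nth 0%N t 0).+1%:R) s =
  (nth 0%N s 0)%:R * (nth 0%N s 0).+1%:R * growth (2 * p) (sumn s) m.
Proof.
move=> s0; apply: (chain_growth (phi := fun t => (nth 0%N t 0)%:R * (nth 0%N t 0).+1%:R)) => // t t0 _.
rewrite (chain_step_root (fun x => x%:R * x.+1%:R)) // -!natr1; field.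
by rewrite pnatr_eq0 -lt0n.
Qed.

End ChainBasics.

(** * First moments of the non-root clusters *)

Section ChainMoments.
Variables (R : realType) (p : R).
Hypotheses (p_ge0 : 0 <= p) (p_le1 : p <= 1).
Implicit Types (phi psi : seq nat -> R) (s t : seq nat) (w : nat -> R) (g : nat -> R).

Notation chain m := (iter m (chain_step p)).

(** Its mean bounds the probability that some non-root cluster exceeds [K]. *)
Definition large_count (K : nat) : seq nat -> R :=
  stat (fun j => (0 < j)%N%:R) (fun x => (K < x)%N%:R).

(** Up to a factor [K] it dominates the sum of squares that enters the two-time estimate. *)
Definition small_mass (K : nat) : seq nat -> R :=
  stat (fun j => (0 < j)%N%:R) (fun x => (x <= K)%N%:R * x%:R).

Lemma statB w g h s : stat w g s - stat w h s = stat w (fun x => g x - h x) s.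
Proof. by rewrite /stat -sumrB; apply: eq_bigr => j _; rewrite mulrBr. Qed.

Lemma statZ a w g s : a * stat w g s = stat w (fun x => a * g x) s.
Proof. by rewrite /stat mulr_sumr; apply: eq_bigr => j _; rewrite mulrCA. Qed.

Lemma eq_stat w g h s : g =1 h -> stat w g s = stat w h s.
Proof. by move=> e; apply: eq_bigr => j _; rewrite e. Qed.

Lemma stat_ge0 w g s : (forall j, 0 <= w j) -> (forall x, 0 <= g x) -> 0 <= stat w g s.
Proof. by move=> w0 g0; apply: sumr_ge0 => j _; apply: mulr_ge0. Qed.

(** Only a cluster of size exactly [K] can cross the threshold, and the difference of the two counts
    is the number of those. At [K = 0] the predecessor is harmless, its factor being 0, and every
    new cluster counts. *)
Lemma chain_step_large_count K s : (0 < sumn s)%N ->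
  chain_step p (large_count K) s =
  large_count K s + p / (sumn s)%:R * (K%:R * (large_count K.-1 s - large_count K s)) +
  (1 - p) * (K == 0%N)%:R.
Proof.
move=> s0; rewrite chain_step_stat //.
have -> : (0 < size s)%N by case: s s0.
rewrite mul1r ltnS leqn0; congr (_ + _ * _ + _).
rewrite statB statZ; apply: eq_stat => x.
case: K => [|K]; first by rewrite ltn0Sn subrr mul0r; case: x => [|x]; rewrite ?mul0r // subrr mulr0.
rewrite /= [(K.+1 < x.+1)%N]ltnS.
case: (ltngtP K.+1 x) => [h|h|<-].
- by rewrite ?(ltnW h) !subrr !mulr0.
- by rewrite !subrr !mulr0.
- by rewrite ?leqnn ?ltnSn ?ltnn.
Qed.

Lemma nth_nonroot_le s j : (0 < j)%N -> (nth 0%N s 0 + nth 0%N s j <= sumn s)%N.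
Proof.
case: s j => [|x s] [|j] //= _; rewrite leq_add2l.
by elim: s j => [|y s IH] [|j] //=; [lia | apply: leq_trans (IH j) _; lia].
Qed.

(* [1 / (K + 1)] solves the stationary equation
   [K (f (K - 1) - f K) = f K] of the drift. *)
Lemma chain_large_count K m :
  chain m (large_count K) [:: 1%N] <= (1 - p) * m.+1%:R / K.+1%:R.
Proof.
have [p0 p1] := (p_ge0, p_le1).
elim: m K => [|m IH] K.
  rewrite /= /large_count /stat big_ord1 /= mul0r mulr1.
  by rewrite divr_ge0 // subr_ge0.
(* The coefficient [1 - p K / (m + 1)] below must be nonnegative, which [K <= m + 1] ensures. For
   larger [K] the count vanishes: the total size is [m + 2] and the root cluster holds at least one
   vertex. *)
have [mK|Km] := ltnP m.+1 K.
  rewrite (_ : chain m.+1 _ _ = chain m.+1 (fun=> 0) [:: 1%N]); last first.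
    apply: eq_chain => // t [t_sum _ t_head]; apply: big1 => j _.
    case: j => -[|j] jt; first by rewrite mul0r.
    have := @nth_nonroot_le t j.+1 isT; rewrite /= in t_sum t_head * => h.
    by rewrite (_ : (K < nth 0%N t j.+1)%N = false) ?mulr0 //; lia.
  rewrite chain_cst // divr_ge0 // mulr_ge0 // subr_ge0 //.
rewrite iterSr.
have -> : chain m (chain_step p (large_count K)) [:: 1%N] =
    chain m (fun t => (1 - p * K%:R / m.+1%:R) * large_count K t +
   (p * K%:R / m.+1%:R * large_count K.-1 t + (1 - p) * (K == 0%N)%:R)) [:: 1%N].
  apply: eq_chain => // t st; rewrite chain_step_large_count; last exact: (@reachable_sumn_gt0 m [:: 1%N]).
  case: st => -> _ _; rewrite /= add1n; field; by rewrite ?natr1 ?nat1r pnatr_eq0.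
rewrite chainD chainZ chainD chainZ chain_cst //.
have m1_gt0 : 0 < m.+1%:R :> R by rewrite ltr0n.
have c_ge0 : 0 <= 1 - p * K%:R / m.+1%:R.
  rewrite subr_ge0 ler_pdivrMr // mul1r (le_trans _ (_ : K%:R <= _)) ?ler_nat //.
  by rewrite ler_piMl.
case: K Km c_ge0 => [|K] Km c_ge0.
  rewrite !mulr0 !mul0r subr0 !mul1r add0r eqxx mulr1 divr1.
  have := IH 0%N; rewrite divr1 => IH0; rewrite -natr1 mulrDr mulr1; exact: lerD.
rewrite [K.+1.-1]/= [(K.+1 == 0)%N]/= mulr0 addr0.
apply: le_trans (lerD (ler_wpM2l c_ge0 (IH K.+1)) (ler_wpM2l _ (IH K))) _.
  by rewrite divr_ge0 // mulr_ge0.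
have K1 : 0 < K.+1%:R :> R by rewrite ltr0n.
have K2 : 0 < K.+2%:R :> R by rewrite ltr0n.
rewrite -subr_ge0.
(* The slack left once both induction bounds are inserted. *)
rewrite (_ : _ - _ = (1 - p) * (1 - p) / K.+2%:R); last first.
  rewrite -!natr1; field; rewrite !natr1 !pnatr_eq0 //=.
by rewrite divr_ge0 // mulr_ge0 // subr_ge0.
Qed.

Lemma chain_sum (I : Type) (r : seq I) (phi : I -> seq nat -> R) m s : (0 < sumn s)%N ->
  chain m (fun t => \sum_(i <- r) phi i t) s = \sum_(i <- r) chain m (phi i) s.
Proof.
move=> s0; elim: r => [|i r IH].
  by rewrite big_nil -[RHS](chain_cst p_ge0 p_le1 m 0 s0); apply: chain_ext => t; rewrite big_nil.
rewrite big_cons -IH -chainD; apply: chain_ext => t; by rewrite big_cons.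
Qed.

(** A size [x <= K] is the number of [k < K] with [k < x], so the mass is at most a sum of
    [large_count k]; the harmonic sum originates here. *)
Lemma chain_small_mass K m :
  chain m (small_mass K) [:: 1%N] <= \sum_(0 <= k < K) (1 - p) * m.+1%:R / k.+1%:R.
Proof.
apply: (le_trans (chain_le p_ge0 p_le1 (psi := fun t => \sum_(0 <= k < K) large_count k t) _ _)) => //.
  move=> t _; rewrite /large_count /small_mass /stat exchange_big /=.
  apply: ler_sum => j _; rewrite -mulr_sumr; apply: ler_wpM2l => //.
  move: (nth 0%N t j) => x; case: leqP => [xK|_]; last by rewrite mul0r sumr_ge0.
  rewrite mul1r -natr_sum ler_nat.
  rewrite (@big_cat_nat _ _ _ x) //= -[X in (X <= _)%N]addn0 leq_add //.
  rewrite big_nat_cond (eq_bigr (fun=> 1%N)); last by move=> k /andP[/andP[_ ->]].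
  by rewrite -big_nat_cond sum_nat_const_nat subn0 muln1.
rewrite chain_sum //; apply: ler_sum => k _; exact: chain_large_count.
Qed.

Lemma chain_growth_le q phi m s : (0 < sumn s)%N -> 0 <= q ->
  (forall t, (0 < sumn t)%N -> chain_step p phi t <= phi t * (1 + q / (sumn t)%:R)) ->
  chain m phi s <= phi s * growth q (sumn s) m.
Proof.
move=> s0 q0 step; elim: m => [|m IH]; first by rewrite /growth big_ord0 mulr1.
rewrite iterSr growthS mulrA.
apply: (@le_trans _ _ (chain m phi s * (1 + q / (sumn s + m)%:R))); last first.
  by apply: ler_wpM2r => //; rewrite addr_ge0 // divr_ge0.
rewrite mulrC -chainZ; apply: chain_le => // t st.
rewrite mulrC; case: (st) => <- _ _; apply: step; exact: reachable_sumn_gt0 st.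
Qed.

(** * Squared deviations between two times *)

Section TwoTimes.
Variables (a b : R) (K : nat).
Hypotheses (a_ge0 : 0 <= a) (b_ge0 : 0 <= b) (p_gt : 1 / 2 < p).

(** Past the end of [t] the default size is 0, which is at most [K]: clusters born after [t] are
    tracked too, with reference size 0. *)
Definition tracked (t : seq nat) j : R := ((0 < j) && (nth 0%N t j <= K))%N%:R.

(** In use [t] is the state at the horizon and [s] the final one, [a] is the final normalisation and
    [b = 1 / B]. *)
Definition sq_dev (t s : seq nat) : R :=
  \sum_(j < size s) tracked t j * (a * (nth 0%N s j)%:R - b * (nth 0%N t j)%:R) ^+ 2.

Definition small_sq (t : seq nat) : R := stat (tracked t) (fun x => x%:R ^+ 2) t.

Lemma tracked_ge0 t j : 0 <= tracked t j. Proof. by rewrite /tracked. Qed.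

Lemma small_massE t : small_mass K t = stat (tracked t) (fun x => x%:R) t.
Proof.
apply: eq_bigr => j _; rewrite mulrA; congr (_ * _).
by rewrite /tracked; case: (0 < j)%N; case: leqP; rewrite ?mul1r ?mul0r.
Qed.

Lemma sum_extend (F : nat -> R) t s : (size t <= size s)%N ->
  (forall j, (size t <= j)%N -> F j = 0) -> \sum_(j < size s) F j = \sum_(j < size t) F j.
Proof.
move=> ts F0; rewrite -!(big_mkord xpredT F) (@big_cat_nat _ _ _ (size t)) //=.
rewrite [X in _ + X]big_nat_cond [X in _ + X]big1 ?addr0 // => j /andP[/andP[tj _] _].
exact: F0.
Qed.

(* Adding [2 (1 - p) / (2 p - 1)] times the total size to the sum of the
   [s (s + 1)] absorbs the clusters born after time [sumn t]. *)
Lemma chain_sq_dev m t : (0 < sumn t)%N ->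
  chain m (sq_dev t) t <=
  a ^+ 2 * growth (2 * p) (sumn t) m *
    (small_sq t + small_mass K t + 2 * (1 - p) / (2 * p - 1) * (sumn t)%:R)
  - 2 * a * b * growth p (sumn t) m * small_sq t + b ^+ 2 * small_sq t.
Proof.
move=> t0; have [p0 p1 pg] := And3 p_ge0 p_le1 p_gt.
(* The square is expanded with [x (x + 1)] in place of [x ^ 2], since its growth is exactly
   multiplicative; in the cross term [f1] the weight vanishes on the clusters born after [t]. *)
pose f2 := stat (tracked t) (fun x => x%:R * x.+1%:R) : seq nat -> R.
pose f1 := stat (fun j => tracked t j * (nth 0%N t j)%:R) (fun x => x%:R) : seq nat -> R.
(* The solution of [2 (1 - p) + c = 2 p c]: births add at most [2 (1 - p)] per step, the total size
   grows by 1, and the sum must have relative drift at most [2 p / i]. *)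
pose c : R := 2 * (1 - p) / (2 * p - 1).
have c_ge0 : 0 <= c by rewrite /c divr_ge0 //; lra.
have p2 : 0 < 2 * p - 1 by lra.
apply: (@le_trans _ _ (chain m (fun s => a ^+ 2 * (f2 s + c * (sumn s)%:R) +
    (- (2 * a * b) * f1 s + b ^+ 2 * small_sq t)) t)).
  apply: chain_le => // s [_ ts _].
  have -> : small_sq t = \sum_(j < size s) tracked t j * (nth 0%N t j)%:R ^+ 2.
    rewrite (@sum_extend (fun j => tracked t j * (nth 0%N t j)%:R ^+ 2) t) // => j tj.
    by rewrite nth_default // expr0n mulr0.
  rewrite mulrDr [X in _ <= X + _]addrC -addrA; apply: ler_wpDl.
    by rewrite mulr_ge0 ?sqr_ge0 // mulr_ge0 ?c_ge0.
  rewrite /sq_dev /f2 /f1 /stat !mulr_sumr -!big_split /=.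
  apply: ler_sum => j _; have := tracked_ge0 t j.
  set T := tracked t j; set x := (nth 0%N s j); set y := nth 0%N t j => T0.
  rewrite -subr_ge0 -[x.+1%:R]natr1.
  rewrite (_ : _ - _ = T * (a ^+ 2 * x%:R)); last by ring.
  by rewrite !mulr_ge0 ?sqr_ge0.
rewrite chainD [X in _ + X <= _]chainD !chainZ chain_cst //.
have Ef1 : chain m f1 t = small_sq t * growth p (sumn t) m.
  rewrite (chain_growth p_ge0 p_le1 (q := p)) //.
    by congr (_ * _); apply: eq_bigr => j _; rewrite -mulrA expr2.
  move=> s s0 ts; rewrite chain_step_stat // nth_default // mulr0 !mul0r mulr0 addr0.
  rewrite [stat _ (fun x => _ * _) s](_ : _ = f1 s); last first.
    by apply: eq_bigr => j _; rewrite -natr1 [_ + 1]addrC addrK mulr1.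
  by rewrite -/f1; ring.
have Ef2 : chain m (fun s => f2 s + c * (sumn s)%:R) t <=
    (f2 t + c * (sumn t)%:R) * growth (2 * p) (sumn t) m.
  apply: (chain_growth_le (phi := fun s => f2 s + c * (sumn s)%:R)) => //; first by lra.
  move=> s s0; rewrite chain_stepD chain_stepZ.
  have -> : chain_step p (fun t => (sumn t)%:R) s = (sumn s).+1%:R :> R.
    rewrite -(chain_step_cst p (sumn s).+1%:R s0).
    by apply: (@eq_chain _ _ p_ge0 p_le1 1) => // u [-> _ _]; rewrite addn1.
  rewrite chain_step_stat // -/f2 mul1r.
  have i0 : (sumn s)%:R != 0 :> R by rewrite pnatr_eq0 -lt0n.
  have w1 : tracked t (size s) <= 1 by rewrite /tracked lern1 leq_b1.
  rewrite [stat _ _ s](_ : _ = 2 * f2 s); last first.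
    by rewrite statZ; apply: eq_stat => x; rewrite -!natr1; ring.
  apply: (@le_trans _ _ (f2 s + p / (sumn s)%:R * (2 * f2 s) + (1 - p) * 2 + c * (sumn s).+1%:R)).
    rewrite lerD2r lerD2l -[leRHS]mulr1 -mulrA; apply: ler_wpM2l; first by rewrite subr_ge0.
    by rewrite mulrC; apply: ler_wpM2l.
  rewrite -natr1 le_eqVlt; apply/orP; left; apply/eqP; rewrite /c; field.
  by rewrite i0 /=; lra.
rewrite Ef1.
have -> : small_sq t + small_mass K t = f2 t.
  rewrite small_massE /small_sq /stat -big_split; apply: eq_bigr => j _ /=.
  by rewrite -mulrDr -natr1; congr (_ * _); ring.
apply: (@le_trans _ _ (a ^+ 2 * ((f2 t + c * (sumn t)%:R) * growth (2 * p) (sumn t) m) +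
  (- (2 * a * b) * (small_sq t * growth p (sumn t) m) + b ^+ 2 * small_sq t))).
  by rewrite lerD2r; apply: ler_wpM2l; rewrite ?sqr_ge0.
by rewrite le_eqVlt; apply/orP; left; apply/eqP; rewrite /c; ring.
Qed.

Lemma small_sq_ge0 t : 0 <= small_sq t.
Proof. by apply: stat_ge0 => [j|x]; rewrite ?tracked_ge0 ?sqr_ge0. Qed.

Lemma small_sq_le t : small_sq t <= K%:R * small_mass K t.
Proof.
rewrite /small_sq /small_mass statZ; apply: ler_sum => j _; rewrite /tracked.
case: (0 < j)%N; rewrite ?mul0r //= mul1r.
case: leqP => h; rewrite ?mul0r ?mulr0 // !mul1r expr2.
by apply: ler_wpM2r; rewrite ?ler_nat.
Qed.

(** Two nested expectations, up to the horizon and beyond it. The coefficient in absolute value,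
    which carries the factor [K], vanishes in the limit when [a G1] tends to [b] and [a ^ 2 G2] to
    [b ^ 2]. *)
Lemma chain_chain_sq_dev m0 m (mu := \sum_(0 <= k < K) (1 - p) * m0.+1%:R / k.+1%:R)
  (G1 := growth p m0.+1 m) (G2 := growth (2 * p) m0.+1 m) :
  chain m0 (fun t => chain m (sq_dev t) t) [:: 1%N] <=
  `|a ^+ 2 * G2 - 2 * a * b * G1 + b ^+ 2| * (K%:R * mu) +
  a ^+ 2 * G2 * (mu + 2 * (1 - p) / (2 * p - 1) * m0.+1%:R).
Proof.
have [p0 p1 pg] := And3 p_ge0 p_le1 p_gt.
set A := a ^+ 2 * G2 - _ + _; set c := 2 * (1 - p) / _.
have G2_ge0 : 0 <= a ^+ 2 * G2.
  by rewrite mulr_ge0 ?sqr_ge0 //; apply/ltW/growth_gt0; lra.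
apply: (@le_trans _ _ (chain m0 (fun t => (`|A| * K%:R + a ^+ 2 * G2) * small_mass K t +
    a ^+ 2 * G2 * (c * m0.+1%:R)) [:: 1%N])).
  apply: chain_le => // t st; have t0 : (0 < sumn t)%N by exact: (@reachable_sumn_gt0 m0 [:: 1%N]).
  apply: (le_trans (chain_sq_dev m t0)).
  have -> : sumn t = m0.+1 by case: st => -> _ _; rewrite /= add1n.
  rewrite -/G1 -/G2 -/c.
  rewrite (_ : _ + _ = A * small_sq t + a ^+ 2 * G2 * small_mass K t + a ^+ 2 * G2 * (c * m0.+1%:R)); last first.
    by rewrite /A; ring.
  rewrite lerD2r [leRHS]mulrDl lerD2r; apply: (@le_trans _ _ (`|A| * small_sq t)).
    by apply: ler_wpM2r; rewrite ?small_sq_ge0 // ler_norm.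
  by rewrite -mulrA; apply: ler_wpM2l; rewrite ?small_sq_le.
rewrite chainD chainZ chain_cst // [in leRHS]mulrDr addrA lerD2r.
rewrite [leRHS](_ : _ = (`|A| * K%:R + a ^+ 2 * G2) * mu); last by ring.
rewrite chainZ; apply: ler_wpM2l; last exact: chain_small_mass.
by rewrite addr_ge0 // mulr_ge0.
Qed.

End TwoTimes.
End ChainMoments.

Definition symmetric_fun (A : Type) (H : seq nat -> A) : Prop :=
  forall t u, perm_eq t u -> H t = H u.

(** * The multinomial walk *)

(* At each step the walk adds a cluster of size [k + 1] with probability
   [e / ((k + 1) (k + 2))]: it has nearly the mean counts of the chain,
   but independent increments. *)
Section Walk.
Variables (R : realType) (e : R) (K : nat).
Hypotheses (e_ge0 : 0 <= e) (e_le1 : e <= 1).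
Implicit Types (H : seq nat -> R) (t : seq nat) (k x : nat).

Definition rate k : R := e / (k.+1%:R * k.+2%:R).

Definition walk H t : R := H t + \sum_(k < K) rate k * (H (k.+1 :: t) - H t).

Definition walkE i H : R := iter i walk H [::].

Lemma rate_ge0 k : 0 <= rate k.
Proof. by rewrite /rate divr_ge0. Qed.

(** Summation by parts with [1 / (k + 1) - 1 / (k + 2) = 1 / ((k + 1) (k + 2))]. For constant [D] it
    gives the total rate of the walk; in general it converts growth of clusters into arrivals of
    sizes. *)
Lemma abel_rate (D : nat -> R) N :
  \sum_(k < N) k.+2%:R^-1 * (D k.+1 - D k) =
  \sum_(k < N) (k.+1%:R * k.+2%:R)^-1 * D k - D 0%N + N.+1%:R^-1 * D N.
Proof.
elim: N => [|N IH]; first by rewrite !big_ord0 invr1 mul1r add0r addNr.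
rewrite !big_ord_recr /= IH -!natr1; field.
by rewrite !natr1 !pnatr_eq0.
Qed.

Lemma sum_rate : \sum_(k < K) rate k = e * (1 - K.+1%:R^-1).
Proof.
have := abel_rate (fun=> 1) K; rewrite big1 => [|k _]; last by rewrite subrr mulr0.
move=> h; rewrite /rate -mulr_sumr; congr (_ * _).
rewrite [X in 0 = X - _ + _](_ : _ = \sum_(k < K) (k.+1%:R * k.+2%:R)^-1) in h; last first.
  by apply: eq_bigr => k _; rewrite mulr1.
move: h; rewrite mulr1; move: (\sum_(_ < _) _) (_^-1) => S x h.
by rewrite -[LHS]subr0 h; ring.
Qed.

Lemma sum_rate_le : \sum_(k < K) rate k <= e.
Proof.
rewrite sum_rate -[leRHS]mulr1; apply: ler_wpM2l => //.
Qed.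

Lemma walk_ext H1 H2 : H1 =1 H2 -> walk H1 =1 walk H2.
Proof. by move=> E t; rewrite /walk E; congr (_ + _); apply: eq_bigr => k _; rewrite !E. Qed.

Lemma iter_walk_ext i H1 H2 : H1 =1 H2 -> iter i walk H1 =1 iter i walk H2.
Proof. by move=> E; elim: i => //= i IH; exact: walk_ext. Qed.

Lemma walkE_ext i H1 H2 : H1 =1 H2 -> walkE i H1 = walkE i H2.
Proof. by move=> E; exact: iter_walk_ext. Qed.

Lemma walkED i H1 H2 : walkE i (fun t => H1 t + H2 t) = walkE i H1 + walkE i H2.
Proof.
rewrite /walkE; elim: i [::] => // i IH t; rewrite !iterS.
rewrite (walk_ext IH) /walk addrACA -big_split /=; congr (_ + _).
by apply: eq_bigr => k _; ring.
Qed.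

Lemma walkEZ i a H : walkE i (fun t => a * H t) = a * walkE i H.
Proof.
rewrite /walkE; elim: i [::] => // i IH t; rewrite !iterS.
rewrite (walk_ext IH) /walk mulrDr mulr_sumr; congr (_ + _).
by apply: eq_bigr => k _; ring.
Qed.

Lemma walkEB i H1 H2 : walkE i (fun t => H1 t - H2 t) = walkE i H1 - walkE i H2.
Proof.
rewrite -[X in _ = _ + X]mulN1r -walkEZ -walkED.
by apply: walkE_ext => t; rewrite mulN1r.
Qed.

Lemma walkE_cst i c : walkE i (fun=> c) = c.
Proof.
rewrite /walkE; elim: i [::] => // i IH t; rewrite iterS (walk_ext IH) /walk.
by rewrite big1 ?addr0 // => k _; rewrite subrr mulr0.
Qed.

Lemma walkE_sum (I : Type) (r : seq I) i (H : I -> seq nat -> R) :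
  walkE i (fun t => \sum_(j <- r) H j t) = \sum_(j <- r) walkE i (H j).
Proof.
elim: r => [|j r IH].
  by rewrite big_nil -[RHS](walkE_cst i 0); apply: walkE_ext => t; rewrite big_nil.
rewrite big_cons -IH -walkED; apply: walkE_ext => t; by rewrite big_cons.
Qed.

Lemma walk_le H1 H2 t : (forall u, H1 u <= H2 u) -> walk H1 t <= walk H2 t.
Proof.
move=> le; have wE H : walk H t = (1 - \sum_(k < K) rate k) * H t + \sum_(k < K) rate k * H (k.+1 :: t).
  rewrite /walk mulrBl mul1r mulr_suml -addrA -sumrN -big_split; congr (_ + _).
  by apply: eq_bigr => k _ /=; ring.
rewrite !wE lerD //.
  by apply: ler_wpM2l => //; rewrite subr_ge0 (le_trans sum_rate_le).
by apply: ler_sum => k _; apply: ler_wpM2l => //; exact: rate_ge0.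
Qed.

Lemma walkE_le i H1 H2 : (forall u, H1 u <= H2 u) -> walkE i H1 <= walkE i H2.
Proof.
rewrite /walkE => le; elim: i [::] => // i IH t.
by rewrite !iterS; exact: walk_le.
Qed.

Lemma walkE_norm i H1 H2 : (forall u, `|H1 u| <= H2 u) -> `|walkE i H1| <= walkE i H2.
Proof.
move=> le; rewrite ler_norml; apply/andP; split.
  rewrite -mulN1r -walkEZ; apply: walkE_le => u.
  by have := le u; rewrite mulN1r ler_norml => /andP[].
by apply: walkE_le => u; have := le u; rewrite ler_norml => /andP[].
Qed.

Lemma walkE_norm_le i H M : (forall u, `|H u| <= M) -> `|walkE i H| <= M.
Proof. by move=> le; rewrite -[leRHS](walkE_cst i M); exact: walkE_norm. Qed.

Lemma walkES i H : walkE i.+1 H =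
  walkE i H + \sum_(k < K) rate k * (walkE i (fun t => H (k.+1 :: t)) - walkE i H).
Proof.
rewrite /walkE iterSr -/(walkE i (walk H)) walkED walkE_sum; congr (_ + _).
by apply: eq_bigr => k _; rewrite walkEZ walkEB.
Qed.

(* The analogue for the walk of the Mecke formula of a Poisson measure. *)
Lemma walkE_mecke i (F : nat -> seq nat -> R) : (forall x, symmetric_fun (F x)) ->
  walkE i.+1 (fun t => \sum_(x <- t) F x (rem x t)) =
  i.+1%:R * \sum_(k < K) rate k * walkE i (F k.+1).
Proof.
elim: i F => [|i IH] F symF.
  rewrite /walkE /= /walk big_nil add0r mul1r; apply: eq_bigr => k _.
  by rewrite subr0 big_cons big_nil addr0 /= eqxx.
pose G (F : nat -> seq nat -> R) t := \sum_(x <- t) F x (rem x t).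
(* Either the entry [k] itself is removed, or it stays as a spectator; for repeated values symmetry
   makes the choice of the occurrence immaterial. *)
have Gcons k t : G F (k :: t) = F k t + G (fun x u => F x (k :: u)) t.
  rewrite /G big_cons /= eqxx; congr (_ + _); apply: eq_big_seq => x xt.
  by case: eqP => // ->; apply: symF; apply: perm_to_rem.
have IH' : walkE i.+1 (G F) = i.+1%:R * \sum_(k < K) rate k * walkE i (F k.+1) by exact: IH.
rewrite -/(G F) walkES IH'; set A := \sum_(k < K) _.
have E (k : 'I_K) : walkE i.+1 (fun t => G F (k.+1 :: t)) = walkE i.+1 (F k.+1) +
    i.+1%:R * \sum_(j < K) rate j * walkE i (fun u => F j.+1 (k.+1 :: u)).
  rewrite (walkE_ext _ (Gcons _)) walkED (IH (fun x u => F x (k.+1 :: u))) // => x t u tu.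
  by apply: symF; rewrite perm_cons.
under eq_bigr do rewrite E.
rewrite [RHS](_ : _ = \sum_(k < K) rate k * walkE i.+1 (F k.+1) +
   i.+1%:R * \sum_(k < K) rate k * walkE i.+1 (F k.+1)); last by rewrite -[in LHS]nat1r mulrDl mul1r.
have B : \sum_(k < K) rate k * walkE i.+1 (F k.+1) = A +
    \sum_(k < K) rate k * (\sum_(j < K) rate j * walkE i (fun u => F j.+1 (k.+1 :: u)) - A).
  under eq_bigr do rewrite walkES mulrDr mulr_sumr.
  rewrite big_split /= -/A exchange_big /=; congr (_ + _); apply: eq_bigr => k _.
  by rewrite /A -sumrB mulr_sumr; apply: eq_bigr => j _; ring.
rewrite [X in _ = _ + _ * X]B [X in _ = _ + X]mulrDr [X in _ = _ + (_ + X)]mulr_sumr.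
rewrite [RHS]addrCA -[in RHS]big_split /=; congr (_ + _).
by apply: eq_bigr => k _; ring.
Qed.

End Walk.

(** * The chain seen through its small non-root clusters *)

Section TailChain.
Variables (R : realType) (p : R) (K : nat).
Hypotheses (p_ge0 : 0 <= p) (p_le1 : p <= 1).
Implicit Types (H Psi : seq nat -> R) (s t : seq nat) (k x i m : nat).

Notation chain m := (iter m (chain_step p)).

Definition push x t : seq nat := if (x <= K)%N then x :: t else t.

Lemma perm_push x t u : perm_eq t u -> perm_eq (push x t) (push x u).
Proof. by rewrite /push; case: ifP; rewrite ?perm_cons. Qed.

Lemma push_filter x t : push x (seq.filter (leq^~ K) t) = seq.filter (leq^~ K) (x :: t).
Proof. by rewrite /push /=. Qed.

Definition shifts H t := \sum_(x <- t) x%:R * (H (push x.+1 (rem x t)) - H t).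

(* The chain without its root cluster and without the clusters larger than [K].
   The maximum makes the step a contraction even on the lists of total size
   larger than [i], which the walk can reach. *)
Definition tail_step i H t : R :=
  H t + (1 - p) * (H (push 1 t) - H t) + p / (maxn i (sumn t))%:R * shifts H t.

(** With the root and the large clusters forgotten, the total size cannot be read off the list; it
    is carried as [i] and grows by 1 at each step. *)
Fixpoint tail_chain i m H : seq nat -> R :=
  if m is m'.+1 then tail_step i (tail_chain i.+1 m' H) else H.

Lemma perm_rem x t u : perm_eq t u -> perm_eq (rem x t) (rem x u).
Proof.
move=> tu; have [xt|xt] := boolP (x \in t); last first.
  by rewrite !rem_id // -(perm_mem tu).
rewrite -(perm_cons x); apply: perm_trans (perm_trans tu _).
  by rewrite perm_sym perm_to_rem.
by rewrite perm_to_rem // -(perm_mem tu).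
Qed.

Lemma symmetric_shifts H : symmetric_fun H -> symmetric_fun (shifts H).
Proof.
move=> symH t u tu; rewrite /shifts (perm_big _ tu) (symH _ _ tu); apply: eq_bigr => x _.
congr (_ * (_ - _)); exact/symH/perm_push/perm_rem.
Qed.

Lemma symmetric_tail_step i H : symmetric_fun H -> symmetric_fun (tail_step i H).
Proof.
move=> symH t u tu; rewrite /tail_step (symmetric_shifts symH tu) (symH _ _ tu).
by rewrite (symH _ _ (perm_push 1 tu)) (perm_sumn tu).
Qed.

Lemma symmetric_tail_chain i m H : symmetric_fun H -> symmetric_fun (tail_chain i m H).
Proof. by move=> symH; elim: m i => //= m IH i; exact/symmetric_tail_step/IH. Qed.

Lemma sumn_natr t : (sumn t)%:R = \sum_(x <- t) x%:R :> R.
Proof. by rewrite sumnE natr_sum. Qed.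

Lemma shifts_norm H M t : (forall u, `|H u| <= M) -> `|shifts H t| <= 2 * M * (sumn t)%:R.
Proof.
move=> HM; rewrite /shifts (le_trans (ler_norm_sum _ _ _)) // sumn_natr mulr_sumr.
apply: ler_sum => x _; rewrite normrM ger0_norm // mulrC; apply: ler_wpM2r => //.
by apply: (le_trans (ler_normB _ _)); rewrite mulrDl !mul1r lerD.
Qed.

Lemma tail_step_norm i H M t : (forall u, `|H u| <= M) -> (0 < i)%N -> `|tail_step i H t| <= M.
Proof.
move=> HM i0; have [p0 p1] := (p_ge0, p_le1); have q0 : 0 <= 1 - p by rewrite subr_ge0.
set D := maxn i (sumn t); have D0 : 0 < D%:R :> R by rewrite ltr0n leq_max i0.
(* Thanks to the maximum every coefficient is nonnegative, and this is a convex combination of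
   values of [H]. *)
have DE : tail_step i H t = (1 - p) * H (push 1 t) + p / D%:R * ((D - sumn t)%:R * H t +
    \sum_(x <- t) x%:R * H (push x.+1 (rem x t))).
  rewrite /tail_step -/D /shifts.
  have -> : \sum_(x <- t) x%:R * (H (push x.+1 (rem x t)) - H t) =
     \sum_(x <- t) x%:R * H (push x.+1 (rem x t)) - (sumn t)%:R * H t.
    by rewrite sumn_natr mulr_suml -sumrB; apply: eq_bigr => x _; rewrite mulrBr.
  rewrite natrB ?leq_maxr //; field; exact: lt0r_neq0.
rewrite DE (le_trans (ler_normD _ _)) // -[leRHS](_ : (1 - p) * M + p / D%:R * ((D - sumn t)%:R * M + (sumn t)%:R * M) = _); last first.
  by rewrite natrB ?leq_maxr //; field; exact: lt0r_neq0.
apply: lerD; first by rewrite normrM (ger0_norm q0); apply: ler_wpM2l.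
have pD : 0 <= p / D%:R by rewrite divr_ge0.
rewrite normrM (ger0_norm pD); apply: ler_wpM2l => //.
rewrite (le_trans (ler_normD _ _)) //; apply: lerD.
  by rewrite normrM normr_nat; apply: ler_wpM2l.
rewrite (le_trans (ler_norm_sum _ _ _)) // sumn_natr mulr_suml; apply: ler_sum => x _.
by rewrite normrM normr_nat; apply: ler_wpM2l.
Qed.

Lemma tail_chain_norm i m H M t : (forall u, `|H u| <= M) -> (0 < i)%N -> `|tail_chain i m H t| <= M.
Proof.
move=> HM; elim: m i t => [|m IH] i t i0; first exact: HM.
by apply: tail_step_norm => // u; exact: IH.
Qed.

Notation small := (seq.filter (leq^~ K)).

Lemma perm_swap2 (y z : nat) t : perm_eq [:: y, z & t] [:: z, y & t].
Proof. exact: permEl (perm_catCA [:: y] [:: z] t). Qed.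

Lemma perm_incr_nth t a : (a < size t)%N ->
  perm_eq (incr_nth t a) ((nth 0%N t a).+1 :: rem (nth 0%N t a) t).
Proof.
elim: t a => // x t IH [|a] /=; first by rewrite eqxx perm_refl.
rewrite ltnS => a_lt; set y := nth 0%N t a.
have E : perm_eq (x :: incr_nth t a) (y.+1 :: x :: rem y t).
  apply: (@perm_trans _ [:: x, y.+1 & rem y t]); last exact: perm_swap2.
  by rewrite perm_cons IH.
apply: perm_trans E _; rewrite perm_cons; case: eqP => [->|_]; last exact: perm_refl.
by rewrite perm_sym perm_to_rem // mem_nth.
Qed.

Lemma small_rem_in x t : x \in t -> (x <= K)%N -> perm_eq (small (rem x t)) (rem x (small t)).
Proof.
move=> xt xK; rewrite -(perm_cons x).
have -> : x :: small (rem x t) = small (x :: rem x t) by rewrite /= xK.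
apply: (@perm_trans _ (small t)); first by rewrite perm_filter // perm_sym perm_to_rem.
by rewrite perm_to_rem // mem_filter xK.
Qed.

Lemma small_rem_notin x t : x \in t -> ~~ (x <= K)%N -> perm_eq (small (rem x t)) (small t).
Proof.
move=> xt /negbTE xK; have -> : small (rem x t) = small (x :: rem x t) by rewrite /= xK.
by rewrite perm_filter // perm_sym perm_to_rem.
Qed.

Lemma sum_incr_nth H t : symmetric_fun H ->
  \sum_(a < size t) (nth 0%N t a)%:R * (H (small (incr_nth t a)) - H (small t)) =
  shifts H (small t).
Proof.
move=> symH; rewrite -(big_mkord xpredT (fun a => (nth 0%N t a)%:R * (H (small (incr_nth t a)) - H (small t)))).
rewrite big_nat (eq_bigr (fun a => (nth 0%N t a)%:R * (H (push (nth 0%N t a).+1 (small (rem (nth 0%N t a) t))) - H (small t)))); last first.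
  move=> a /andP[_ a_lt]; rewrite push_filter; congr (_ * (_ - _)); apply: symH.
  by apply: perm_filter; exact: perm_incr_nth.
rewrite -big_nat -(big_nth 0%N xpredT (fun x => x%:R * (H (push x.+1 (small (rem x t))) - H (small t)))).
rewrite (bigID (leq^~ K)) /= [X in _ + X]big_seq_cond [X in _ + X]big1 ?addr0; last first.
  move=> x /andP[xt xK]; have xK1 : (x.+1 <= K)%N = false by apply/negbTE; move: xK; lia.
  by rewrite /push xK1 (symH _ _ (small_rem_notin xt xK)) subrr mulr0.
rewrite /shifts big_filter big_seq_cond [RHS]big_seq_cond; apply: eq_bigr => x /andP[xt xK].
by congr (_ * (_ - _)); apply/symH/perm_push/small_rem_in.
Qed.

(** Growth of the root leaves the list unchanged and a large cluster never becomes small again, so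
    given the total size the reduced list evolves on its own. *)
Lemma chain_tail_chain m H s : symmetric_fun H -> (0 < sumn s)%N ->
  chain m (fun t => H (small (behead t))) s = tail_chain (sumn s) m H (small (behead s)).
Proof.
move=> symH; elim: m s => // m IH s s0; rewrite iterS.
have Hs : s != [::] by case: s s0.
transitivity (chain_step p (fun t => tail_chain (sumn s).+1 m H (small (behead t))) s).
  apply: (eq_chain p_ge0 p_le1 (m := 1)) => // t st.
  by rewrite IH ?(reachable_sumn_gt0 s0 st) //; case: st => -> _ _; rewrite addn1.
have := symmetric_tail_chain (sumn s).+1 m symH; rewrite /=.
move: (tail_chain (sumn s).+1 m H) => Psi symPsi.
case: s s0 {Hs} => // h t s0; rewrite /= /chain_step /= big_ord_recl /=.
have -> : Psi (small (rcons t 1%N)) = Psi (push 1 (small t)).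
  by apply: symPsi; rewrite push_filter perm_filter // perm_rcons.
have small_le : (sumn (small t) <= sumn t)%N.
  by elim: t {s0} => //= x t IHt; case: ifP => _ /=; lia.
(* The maximum is inert on genuine states, whose small clusters total at most the whole size. *)
rewrite /tail_step (maxn_idPl _); last by rewrite (leq_trans small_le) // leq_addl.
rewrite -sum_incr_nth //.
rewrite [X in _ = _ + _ * X](_ : _ = \sum_(a < size t) (nth 0%N t a)%:R * Psi (small (incr_nth t a)) -
   (sumn t)%:R * Psi (small t)); last first.
  by rewrite -sum_size_sumn mulr_suml -sumrB; apply: eq_bigr => a _; rewrite mulrBr.

rewrite natrD; field; by rewrite -natrD pnatr_eq0 -lt0n.
Qed.

End TailChain.

(** * Replacing the steps of the chain by steps of the walk *)

Section WalkComparison.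
Variables (R : realType) (p : R) (K : nat).
Hypotheses (p_ge0 : 0 <= p) (p_le1 : p <= 1).
Implicit Types (H Psi : seq nat -> R) (s t : seq nat) (k x i m : nat).

Notation chain m := (iter m (chain_step p)).
Notation e := (1 - p).
Notation drate := (rate (1 - p)).
Notation qE := (walkE (1 - p) K).

Let e_ge0 : 0 <= e. Proof. by rewrite subr_ge0. Qed.
Let e_le1 : e <= 1. Proof. by rewrite lerBlDr lerDl. Qed.

(** The walk moves with probability at most [e] at each step. *)
Lemma walkE_succ_norm i H M : (forall t, `|H t| <= M) ->
  `|qE i.+1 H - qE i H| <= 2 * M * e.
Proof.
move=> HM; have M0 : 0 <= M by exact: le_trans (HM [::]).
rewrite walkES addrAC subrr add0r (le_trans (ler_norm_sum _ _ _)) //.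
apply: (@le_trans _ _ (\sum_(k < K) drate k * (2 * M))).
  apply: ler_sum => k _; rewrite normrM (ger0_norm (rate_ge0 e_ge0 _)).
  apply: ler_wpM2l; first exact: rate_ge0.
  by rewrite (le_trans (ler_normB _ _)) // mulrDl mul1r lerD //; apply: walkE_norm_le.
rewrite -mulr_suml mulrC; apply: ler_wpM2l; last exact: sum_rate_le.
by rewrite mulr_ge0.
Qed.

Definition shift_mean := \sum_(k < K) drate k * k.+1%:R.

Lemma rate_le k : drate k <= e / (k.+1%:R * k.+1%:R).
Proof.
apply: ler_wpM2l => //; rewrite lef_pV2 ?posrE ?mulr_gt0 ?ltr0n //.
by apply: ler_wpM2l => //; rewrite ler_nat.
Qed.

Lemma shift_mean_ge0 : 0 <= shift_mean.
Proof. by apply: sumr_ge0 => k _; rewrite mulr_ge0 // rate_ge0. Qed.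

Lemma sum_rate_sq_le : \sum_(k < K) drate k * k.+1%:R ^+ 2 <= K%:R * e.
Proof.
apply: (@le_trans _ _ (\sum_(k < K) e)); last by rewrite sumr_const card_ord mulr_natl.
apply: ler_sum => k _; apply: (@le_trans _ _ (e / (k.+1%:R * k.+1%:R) * k.+1%:R ^+ 2)).
  by apply: ler_wpM2r; [rewrite sqr_ge0 | exact: rate_le].
by rewrite -expr2 divfK // expf_neq0 // pnatr_eq0.
Qed.

Lemma shift_mean_le : shift_mean <= K%:R * e.
Proof.
apply: le_trans sum_rate_sq_le; apply: ler_sum => k _; apply: ler_wpM2l; first exact: rate_ge0.
by rewrite expr2 ler_peMr // ler1n.
Qed.

Lemma walkE_sumn i : qE i (fun t => (sumn t)%:R) = i%:R * shift_mean.
Proof.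
elim: i => [|i IH]; first by rewrite /walkE /= mul0r.
rewrite walkES IH -natr1 mulrDl mul1r; congr (_ + _); apply: eq_bigr => k _; congr (_ * _).
rewrite (walkE_ext _ _ _ (H2 := fun t => k.+1%:R + (sumn t)%:R)); last by move=> t; rewrite /= natrD.
by rewrite walkED walkE_cst IH addrK.
Qed.

Lemma walkE_sumn_sq i :
  qE i (fun t => (sumn t)%:R ^+ 2) <= K%:R ^+ 2 * e ^+ 2 * i%:R ^+ 2 + K%:R * e * i%:R.
Proof.
apply: (@le_trans _ _ (shift_mean ^+ 2 * i%:R ^+ 2 + K%:R * e * i%:R)); last first.
  rewrite lerD2r; apply: ler_wpM2r; first by rewrite sqr_ge0.
  by rewrite -exprMn ler_sqr ?nnegrE ?shift_mean_ge0 ?mulr_ge0 //; exact: shift_mean_le.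
elim: i => [|i IH]; first by rewrite /walkE /= expr0n mulr0 mulr0 addr0.
rewrite walkES.
rewrite (eq_bigr (fun k : 'I_K => drate k * k.+1%:R * (2 * i%:R * shift_mean) + drate k * k.+1%:R ^+ 2)); last first.
  move=> k _; rewrite (walkE_ext _ _ _ (H2 := fun t => k.+1%:R ^+ 2 + (2 * k.+1%:R * (sumn t)%:R + (sumn t)%:R ^+ 2))); last first.
    by move=> t; rewrite /= natrD; ring.
  by rewrite walkED walkE_cst walkED walkEZ walkE_sumn; ring.
rewrite big_split /= -mulr_suml -/shift_mean.
have := IH; have := sum_rate_sq_le; have := sqr_ge0 shift_mean.
move: (\sum_(k < K) _) (walkE _ _ _ _) (shift_mean) (K%:R * e : R) => A B S D h1 h2 h3.
rewrite -[i.+1%:R]natr1; have i0 : 0 <= i%:R :> R by [].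
move: (i%:R : R) i0 h3 => I I0 h3; nra.
Qed.

(** Size [k + 1] is present with mean [(i + 1) e / ((k + 1) (k + 2))] and grows at speed [k + 1].
    [abel_rate] rewrites this flux as arrivals of the sizes 1, ..., K at the rates of the walk,
    minus arrivals of size 1 at rate [e], which the births of the chain will supply. *)
Lemma walkE_shifts i Psi : symmetric_fun Psi ->
  qE i.+1 (shifts K Psi) = i.+1%:R * (\sum_(k < K) drate k *
     (qE i (fun t => Psi (push K k.+1 t)) - qE i Psi) -
   e * (qE i (fun t => Psi (push K 1 t)) - qE i Psi)).
Proof.
move=> symP; pose F x t := x%:R * (Psi (push K x.+1 t) - Psi (x :: t)).
rewrite (walkE_ext _ _ _ (H2 := fun t => \sum_(x <- t) F x (rem x t))); last first.
  move=> t; rewrite /shifts big_seq_cond [RHS]big_seq_cond; apply: eq_bigr => x /andP[xt _].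
  by rewrite /F (symP _ _ (perm_to_rem xt)).
rewrite walkE_mecke; last first.
  move=> x t u tu; rewrite /F; congr (_ * (_ - _)); first exact/symP/perm_push.
  by apply: symP; rewrite perm_cons.
congr (_ * _); pose D k := qE i (fun t => Psi (push K k.+1 t)).
(* A cluster that grows past [K] is dropped, which gives the boundary value of the summation by
   parts. *)
have DK : D K = qE i Psi by apply: walkE_ext => t; rewrite /push ltnn.
rewrite (eq_bigr (fun k : 'I_K => e * (k.+2%:R^-1 * (D k.+1 - D k)))); last first.
  move=> k _; rewrite /F walkEZ walkEB -/(D k.+1).
  rewrite (_ : qE i (fun t => Psi (k.+1 :: t)) = D k); last first.
    by apply: walkE_ext => t; rewrite /push ltn_ord.
  by rewrite /rate; field; rewrite !(natr1, nat1r, natrD, pnatr_eq0) //= -?natrD ?pnatr_eq0.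
rewrite -mulr_sumr abel_rate.
have E : \sum_(k < K) drate k * (D k - D K) = e * (\sum_(k < K) (k.+1%:R * k.+2%:R)^-1 * D k) - (\sum_(k < K) drate k) * D K.
  by rewrite mulr_suml mulr_sumr -sumrB; apply: eq_bigr => k _; rewrite /rate; ring.
rewrite -DK E sum_rate -/(D 0%N); ring.
Qed.

(* By [walkE_mecke] and summation by parts, the growth of the clusters turns the
   new clusters of size [1] into the increments of the walk, up to [O(e ^ 2)]. *)
Lemma walk_tail_step i Psi M : symmetric_fun Psi -> (forall t, `|Psi t| <= M) ->
  `|qE i.+1 (tail_step p K i.+1 Psi) - qE i.+2 Psi| <=
  12 * M * e ^+ 2 + 2 * M * (K%:R ^+ 2 * e ^+ 2 + K%:R * e / i.+1%:R).
Proof.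
move=> symP PM; have M0 : 0 <= M by exact: le_trans (PM [::]).
(* [U] is the step without the maximum. The two differ only where the list of the walk has total
   size above [i + 1], which the second moment of that total controls. *)
pose U t := Psi t + e * (Psi (push K 1 t) - Psi t) + p / i.+1%:R * shifts K Psi t.
have i0 : 0 < i.+1%:R :> R by rewrite ltr0n.
have clip : `|qE i.+1 (tail_step p K i.+1 Psi) - qE i.+1 U| <=
    2 * M * (K%:R ^+ 2 * e ^+ 2 + K%:R * e / i.+1%:R).
  rewrite -walkEB; apply: (@le_trans _ _ (qE i.+1 (fun t => 2 * M / i.+1%:R ^+ 2 * (sumn t)%:R ^+ 2))).
    apply: walkE_norm => // t; rewrite /tail_step /U opprD addrACA subrr add0r -mulrBl.
    case: (leqP (sumn t) i.+1) => [ti|it].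
      by rewrite subrr mul0r normr0 mulr_ge0 ?sqr_ge0 // divr_ge0 ?mulr_ge0 // sqr_ge0.
    have t0 : 0 < (sumn t)%:R :> R by rewrite ltr0n (leq_trans _ it).
    have it' : i.+1%:R <= (sumn t)%:R :> R by rewrite ler_nat ltnW.
    rewrite normrM; apply: (@le_trans _ _ (i.+1%:R^-1 * (2 * M * (sumn t)%:R))).
      apply: ler_pM => //; last exact: shifts_norm.
      rewrite distrC ger0_norm; last first.
        by rewrite subr_ge0; apply: ler_wpM2l => //; rewrite lef_pV2.
      apply: (@le_trans _ _ (p / i.+1%:R)); first by rewrite lerBlDr lerDl divr_ge0.
      by rewrite ler_piMl // invr_ge0.
    rewrite [leRHS](_ : _ = i.+1%:R^-1 * (2 * M * ((sumn t)%:R * ((sumn t)%:R / i.+1%:R)))); last first.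
      by field; exact: lt0r_neq0.
    rewrite ler_wpM2l ?invr_ge0 //; apply: ler_wpM2l; first by rewrite mulr_ge0.
    by rewrite ler_peMr // ler_pdivlMr // mul1r.
  rewrite walkEZ; apply: (@le_trans _ _ (2 * M / i.+1%:R ^+ 2 * (K%:R ^+ 2 * e ^+ 2 * i.+1%:R ^+ 2 + K%:R * e * i.+1%:R))).
    by apply: ler_wpM2l; [rewrite divr_ge0 ?mulr_ge0 ?sqr_ge0 | exact: walkE_sumn_sq].
  rewrite le_eqVlt; apply/orP; left; apply/eqP; field; exact: lt0r_neq0.
apply: (le_trans (ler_distD (qE i.+1 U) _ _)); rewrite addrC; apply: lerD clip.
(* The Mecke formula lowers the walk by one step, so growth appears with [Y], at time [i], and
   births with [X], at time [i + 1]; the two are [O(e)] apart. *)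
pose X k := qE i.+1 (fun t => Psi (push K k.+1 t)) - qE i.+1 Psi.
pose Y k := qE i (fun t => Psi (push K k.+1 t)) - qE i Psi.
have XE k j : qE j (fun t => Psi (push K k.+1 t)) - qE j Psi = qE j (fun t => Psi (push K k.+1 t) - Psi t).
  by rewrite walkEB.
have PM2 k t : `|Psi (push K k t) - Psi t| <= 2 * M.
  by rewrite (le_trans (ler_normB _ _)) // mulrDl mul1r lerD.
have YM k : `|Y k| <= 2 * M by rewrite /Y XE walkE_norm_le.
have XYM k : `|X k - Y k| <= 4 * M * e.
  rewrite /X /Y !XE; apply: (le_trans (walkE_succ_norm i (PM2 k.+1))).
  by rewrite le_eqVlt; apply/orP; left; apply/eqP; ring.
have UE : qE i.+1 U = qE i.+1 Psi + e * X 0%N + p * (\sum_(k < K) drate k * Y k - e * Y 0%N).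
  rewrite /U walkED walkED !walkEZ walkEB walkE_shifts // -/(X 0%N) -/(Y 0%N).
  by rewrite mulrA divfK //; exact: lt0r_neq0.
have WE : qE i.+2 Psi = qE i.+1 Psi + \sum_(k < K) drate k * X k.
  rewrite walkES; congr (_ + _); apply: eq_bigr => k _; congr (_ * (_ - _)).
  by apply: walkE_ext => t; rewrite /push ltn_ord.
(* With [p = 1 - e] the terms of order [e] cancel; each remaining one is [e] times a quantity of
   order [e]. *)
have dE : qE i.+1 U - qE i.+2 Psi =
   e * (X 0%N - Y 0%N) + e * e * Y 0%N - \sum_(k < K) drate k * (X k - Y k) - e * \sum_(k < K) drate k * Y k.
  have -> : \sum_(k < K) drate k * (X k - Y k) = \sum_(k < K) drate k * X k - \sum_(k < K) drate k * Y k.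
    by rewrite -sumrB; apply: eq_bigr => k _; ring.
  by rewrite UE WE; ring.
have sum_bound (Z : nat -> R) c : (forall k, `|Z k| <= c) -> `|\sum_(k < K) drate k * Z k| <= e * c.
  move=> Zc; rewrite (le_trans (ler_norm_sum _ _ _)) //.
  apply: (@le_trans _ _ (\sum_(k < K) drate k * c)).
    apply: ler_sum => k _; rewrite normrM (ger0_norm (rate_ge0 e_ge0 _)).
    by apply: ler_wpM2l; [exact: rate_ge0 | exact: Zc].
  rewrite -mulr_suml; apply: ler_wpM2r; last exact: sum_rate_le.
  by exact: le_trans (Zc 0%N).
have E12 : 12 * M * e ^+ 2 = e * (4 * M * e) + e * e * (2 * M) + e * (4 * M * e) + e * (e * (2 * M)) by ring.
rewrite dE E12; apply: (le_trans (ler_normB _ _)); apply: lerD; last first.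
  by rewrite normrM (ger0_norm e_ge0); apply: ler_wpM2l => //; exact: sum_bound.
apply: (le_trans (ler_normB _ _)); apply: lerD; last exact: (sum_bound (fun k => X k - Y k)).
apply: (le_trans (ler_normD _ _)); apply: lerD.
  by rewrite normrM (ger0_norm e_ge0); apply: ler_wpM2l.
by rewrite normrM ger0_norm ?mulr_ge0 //; apply: ler_wpM2l; rewrite ?mulr_ge0.
Qed.

(** Telescoping in the manner of Lindeberg: one step at a time is exchanged, and the remaining steps
    of the chain preserve both the symmetry and the bound [M]. *)
Lemma walk_tail_chain i m H M : symmetric_fun H -> (forall t, `|H t| <= M) ->
  `|qE i.+1 (tail_chain p K i.+1 m H) - qE (i.+1 + m) H| <=
  \sum_(i <= j < i + m) (12 * M * e ^+ 2 + 2 * M * (K%:R ^+ 2 * e ^+ 2 + K%:R * e / j.+1%:R)).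
Proof.
move=> symH HM; elim: m i => [|m IH] i.
  by rewrite addn0 addn0 subrr normr0 big_geq.
apply: (le_trans (ler_distD (qE i.+2 (tail_chain p K i.+2 m H)) _ _)).
rewrite -[(i + m.+1)%N]addSnnS big_ltn ?leq_addr //; apply: lerD; last first.
  by have := IH i.+1; rewrite addSnnS.
apply: walk_tail_step; first exact: symmetric_tail_chain.
by move=> t; apply: tail_chain_norm.
Qed.

Lemma chain_walk m H M : symmetric_fun H -> (forall t, `|H t| <= M) ->
  `|chain m (fun t => H (seq.filter (leq^~ K) (behead t))) [:: 1%N] - qE m.+1 H| <=
  2 * M * e + M * e ^+ 2 * (12 + 2 * K%:R ^+ 2) * m%:R + 2 * M * K%:R * e * \sum_(0 <= j < m) j.+1%:R^-1.
Proof.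
move=> symH HM; rewrite chain_tail_chain //=.
(* The chain starts with total size 1 and an empty list, while the comparison wants a walk after one
   step; that first step costs [2 M e]. *)
have -> : tail_chain p K 1 m H [::] = qE 0 (tail_chain p K 1 m H) by [].
apply: (le_trans (ler_distD (qE 1 (tail_chain p K 1 m H)) _ _)).
rewrite -[leRHS]addrA; apply: lerD.
  by rewrite distrC; apply: walkE_succ_norm => t; apply: tail_chain_norm.
apply: (le_trans (walk_tail_chain 0 m symH HM)).
rewrite add0n (eq_bigr (fun j => (12 * M * e ^+ 2 + 2 * M * (K%:R ^+ 2 * e ^+ 2)) +
  2 * M * K%:R * e * j.+1%:R^-1)); last by move=> j _; ring.
rewrite big_split /= -mulr_sumr sumr_const_nat subn0 -[_ *+ m]mulr_natl lerD2r.
by rewrite le_eqVlt; apply/orP; left; apply/eqP; ring.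
Qed.

End WalkComparison.

Local Open Scope classical_set_scope.
Local Open Scope ring_scope.

(** * Poisson limit of the walk *)

Section ExpBounds.
Variable R : realType.
Implicit Types x : R.

Lemma one_sub_le_expR x : 1 - x <= expR (- x).
Proof. exact: expR_ge1Dx. Qed.

Lemma expR_le_one_sub x : 0 <= x -> x <= 1 / 2 -> expR (- (x + 2 * x ^+ 2)) <= 1 - x.
Proof.
move=> x0 x1; have y0 : 0 < 1 - x by lra.
rewrite expRN -[leRHS]invrK lef_pV2 ?posrE ?expR_gt0 ?invr_gt0 //.
apply: le_trans (expR_ge1Dx _).
(* On this range [(1 + x + 2 x ^ 2) (1 - x) = 1 + x ^ 2 (1 - 2 x) >= 1]. *)
rewrite -div1r ler_pdivrMr //; nra.
Qed.

Lemma cvg_one_sub_pow (e : nat -> R) (m : nat -> nat) (B c : R) :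
  0 <= c -> (forall n, 0 <= e n) -> e n @[n --> \oo] --> (0 : R) ->
  e n * (m n)%:R @[n --> \oo] --> B ->
  (1 - e n * c) ^+ m n @[n --> \oo] --> expR (- (B * c)).
Proof.
move=> c0 e0 e_to0 em.
have ec0 : e n * c @[n --> \oo] --> (0 : R) by rewrite -[0](mul0r c); apply: cvgM => //; exact: cvg_cst.
have ec_small : \forall n \near \oo, e n * c <= 1 / 2.
  by apply: (cvgr_le _ ec0); lra.
apply: (@squeeze_cvgr _ _ _ _ (fun n => expR (- (e n * (m n)%:R * c + e n * (m n)%:R * c * (2 * (e n * c)))))
   (fun n => expR (- (e n * (m n)%:R * c)))); last 2 first.
- have -> : B * c = B * c + B * c * (2 * 0) by rewrite !mulr0 addr0.
  apply: continuous_cvg; first exact: continuous_expR.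
  apply: cvgN; apply: cvgD; first by apply: cvgM => //; exact: cvg_cst.
  by apply: cvgM; apply: cvgM => //; exact: cvg_cst.
- apply: continuous_cvg; first exact: continuous_expR.
  by apply: cvgN; apply: cvgM => //; exact: cvg_cst.
near=> n.
have x0 : 0 <= e n * c by rewrite mulr_ge0.
have x1 : e n * c <= 1 / 2 by near: n.
apply/andP; split.
  rewrite [X in expR X](_ : _ = (m n)%:R * (- (e n * c + 2 * (e n * c) ^+ 2))); last by ring.
  rewrite expRM_natl; apply: lerXn2r; rewrite ?nnegrE ?expR_ge0 //; first by lra.
  exact: expR_le_one_sub.
rewrite [X in expR X](_ : _ = (m n)%:R * (- (e n * c))); last by ring.
rewrite expRM_natl; apply: lerXn2r; rewrite ?nnegrE ?expR_ge0 //; first by lra.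
exact: one_sub_le_expR.
Unshelve. all: by end_near.
Qed.

End ExpBounds.

Section PoissonLimit.
Variables (R : realType) (K : nat).
Implicit Types (e B : R) (a t : seq nat) (x i m : nat).

Definition poisson_rate B x : R := B / (x%:R * x.+1%:R).

(** The probability that independent Poisson numbers of clusters of sizes 1, ..., K form the
    multiset [a]: the divisors [(count_mem x a').+1] build up the factorials, and
    [B (1 - 1 / (K + 1))] is the total rate. The recursion mirrors that of the walk. *)
Fixpoint poisson_list B a : R :=
  if a is x :: a' then poisson_rate B x / (count_mem x a').+1%:R * poisson_list B a'
  else expR (- (B * (1 - K.+1%:R^-1))).

Definition perm_ind a t : R := (perm_eq t a)%:R.

Lemma symmetric_perm_ind a : symmetric_fun (perm_ind a).
Proof. by move=> t u tu; rewrite /perm_ind (permPl tu). Qed.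

Lemma walkE_perm_nil e i : 0 <= e -> e <= 1 ->
  walkE e K i (perm_ind [::]) = (1 - e * (1 - K.+1%:R^-1)) ^+ i.
Proof.
move=> e0 e1; elim: i => [|i IH]; first by rewrite expr0 /walkE.
rewrite walkES (eq_bigr (fun k : 'I_K => - (rate e k * walkE e K i (perm_ind [::])))); last first.
  move=> k _; rewrite (_ : walkE _ _ _ (fun t => _) = 0) ?sub0r ?mulrN //.
  rewrite -[RHS](walkE_cst e K i 0); apply: walkE_ext => t; rewrite /perm_ind.
  by case: (perm_eq _ _) / idP => // /perm_size.
by rewrite sumrN -mulr_suml IH sum_rate exprS; ring.
Qed.

Lemma count_rem_perm x a t : x \in t -> perm_eq (rem x t) a = perm_eq t (x :: a).
Proof.
by move=> xt; rewrite [RHS](permPl (perm_to_rem xt)) perm_cons.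
Qed.

(* With [F y r = (y == x) * perm_ind a r], [walkE_mecke] is a recursion for the
   point probabilities of the walk. *)
Lemma walkE_perm_cons e i x a : 0 <= e -> e <= 1 -> (0 < x <= K)%N ->
  walkE e K i.+1 (perm_ind (x :: a)) =
  e * i.+1%:R * (poisson_rate 1 x / (count_mem x a).+1%:R * walkE e K i (perm_ind a)).
Proof.
move=> e0 e1 /andP[x0 xK].
pose F y r : R := (y == x)%:R * perm_ind a r.
have E t : \sum_(y <- t) F y (rem y t) = (count_mem x a).+1%:R * perm_ind (x :: a) t.
  rewrite (eq_big_seq (fun y => (y == x)%:R * perm_ind (x :: a) t)); last first.
    move=> y yt; rewrite /F; case: eqP => [E|]; rewrite ?mul0r // !mul1r /perm_ind -E.
    by rewrite count_rem_perm.
  rewrite -mulr_suml -natr_sum -big_mkcond sum1_count /perm_ind.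
  have [/permP ->|] := boolP (perm_eq t _); last by rewrite !mulr0.
  by rewrite /= eqxx add1n.
have := @walkE_mecke R e K i F.
rewrite (walkE_ext _ _ _ E) walkEZ => mecke.
have c0 : (count_mem x a).+1%:R != 0 :> R by rewrite pnatr_eq0.
apply: (mulfI c0); rewrite mecke; last first.
  by move=> y t u tu; rewrite /F (symmetric_perm_ind a tu).
have xK' : (x.-1 < K)%N by lia.
rewrite (bigD1 (Ordinal xK')) //= big1 ?addr0; last first.
  move=> k kx; rewrite [walkE _ _ _ _](_ : _ = 0) ?mulr0 //.
  rewrite -[RHS](walkE_cst e K i 0); apply: walkE_ext => t; rewrite /F.
  rewrite (_ : (k.+1 == x) = false) ?mul0r //; apply: contraNF kx => /eqP kx.
  by apply/eqP/val_inj; rewrite /= -kx.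
rewrite prednK // (walkE_ext _ _ _ (H2 := perm_ind a)); last by move=> t; rewrite /F eqxx mul1r.
rewrite /rate /poisson_rate; case: x x0 {xK xK' F E mecke} c0 => // x _ c0 /=.
rewrite -!natr1 in c0 *; field; rewrite c0 !natr1 !pnatr_eq0 //.
Qed.

(** By induction on the list, for all [m] at once: each entry removed uses up one step, which does
    not change the limit of [e m]. *)
Lemma cvg_walkE_perm (e : nat -> R) (m : nat -> nat) B a :
  0 < B -> (forall n, 0 <= e n <= 1) -> e n @[n --> \oo] --> (0 : R) ->
  e n * (m n)%:R @[n --> \oo] --> B -> all (fun x => 0 < x <= K)%N a ->
  walkE (e n) K (m n) (perm_ind a) @[n --> \oo] --> poisson_list B a.
Proof.
move=> B0 e01 e_to0; have e0 n : 0 <= e n by case/andP: (e01 n).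
have e1 n : e n <= 1 by case/andP: (e01 n).
elim: a m => [|x a IH] m em /=.
  move=> _; under eq_fun do rewrite walkE_perm_nil //.
  by apply: cvg_one_sub_pow => //; rewrite subr_ge0 invf_le1 ?ler1n.
case/andP => xK /IH {}IH.
have m_pos : \forall n \near \oo, (0 < m n)%N.
  have : \forall n \near \oo, 0 < e n * (m n)%:R by exact: (cvgr_gt _ em).
  by apply: filterS => n; case: (m n) => //; rewrite mulr0 ltxx.
have em1 : e n * (m n).-1%:R @[n --> \oo] --> B.
  rewrite -[B]subr0; apply: cvg_trans (cvgB em e_to0); apply: near_eq_cvg.
  near=> n; transitivity (e n * (m n)%:R - e n) => //.
  have : (0 < m n)%N by near: n.
  by case: (m n) => //= k _; rewrite -natr1; ring.
have -> : poisson_rate B x / (count_mem x a).+1%:R * poisson_list B a =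
   B * (poisson_rate 1 x / (count_mem x a).+1%:R * poisson_list B a).
  by rewrite /poisson_rate; ring.
apply: cvg_trans (cvgM em (cvgM (cvg_cst (poisson_rate 1 x / (count_mem x a).+1%:R)) (IH _ em1))).
apply: near_eq_cvg; near=> n.
transitivity (e n * (m n)%:R * (poisson_rate 1 x / (count_mem x a).+1%:R * walkE (e n) K (m n).-1 (perm_ind a))) => //.
have : (0 < m n)%N by near: n.
by case: (m n) => //= k _; rewrite walkE_perm_cons.
Unshelve. all: by end_near.
Qed.

End PoissonLimit.

Section CountList.
Variable (K : nat).
Implicit Types (c : 'I_K -> nat) (r : seq 'I_K).

Definition count_list_on r c : seq nat := flatten [seq nseq (c k) k.+1 | k : 'I_K <- r].

Definition count_list c : seq nat := count_list_on (enum 'I_K) c.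

Lemma count_list_on_notin r c (k : 'I_K) : k \notin r -> count_mem k.+1 (count_list_on r c) = 0%N.
Proof.
elim: r => // j r IH; rewrite in_cons negb_or /count_list_on /= => /andP[kj kr].
rewrite count_cat -/(count_list_on r c) IH // addn0 count_nseq /=.
by rewrite eqSS (_ : (val j == val k) = false) ?mul0n //; apply/negbTE; rewrite eq_sym.
Qed.

Lemma count_list_on_in r c (k : 'I_K) : uniq r -> k \in r -> count_mem k.+1 (count_list_on r c) = c k.
Proof.
elim: r => // j r IH /= /andP[jr r_uniq]; rewrite /count_list_on /= count_cat -/(count_list_on r c) count_nseq /=.
rewrite in_cons; case: (eqVneq k j) => [->|kj] /= => [_|kr].
  by rewrite eqxx mul1n count_list_on_notin // addn0.
by rewrite IH // eqSS (_ : (val j == val k) = false) ?mul0n //; apply/negbTE; rewrite eq_sym.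
Qed.

Lemma count_mem_list c (k : 'I_K) : count_mem k.+1 (count_list c) = c k.
Proof. by rewrite count_list_on_in ?enum_uniq ?mem_enum. Qed.

Lemma count_list_all c : all (fun x => 0 < x <= K)%N (count_list c).
Proof.
apply/allP => x /flattenP[s /mapP[k _ ->]]; rewrite mem_nseq => /andP[_ /eqP ->].
by rewrite ltn_ord.
Qed.

End CountList.

Section PoissonSum.
Variables (R : realType) (K : nat).
Implicit Types (B M lam eta : R).

Definition poisson_weight lam j : R := expR (- lam) * lam ^+ j / j`!%:R.

Lemma poisson_list_nseq B m x a : count_mem x a = 0%N ->
  poisson_list K B (nseq m x ++ a) = poisson_rate B x ^+ m / m`!%:R * poisson_list K B a.
Proof.
move=> xa; elim: m => [|m IH]; first by rewrite expr0 fact0 divr1 mul1r.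
rewrite /= IH count_cat xa addn0 count_nseq /= eqxx mul1n exprS factS natrM.
by field; rewrite pnatr_eq0 -lt0n fact_gt0 /= nat1r pnatr_eq0.
Qed.

Lemma poisson_list_count B (c : 'I_K -> nat) :
  poisson_list K B (count_list c) = \prod_(k < K) poisson_weight (poisson_rate B k.+1) (c k).
Proof.
rewrite /poisson_weight.
have -> : \prod_(k < K) (expR (- poisson_rate B k.+1) * poisson_rate B k.+1 ^+ c k / (c k)`!%:R) =
    expR (- (B * (1 - K.+1%:R^-1))) * \prod_(k < K) (poisson_rate B k.+1 ^+ c k / (c k)`!%:R).
  under eq_bigr do rewrite -mulrA; rewrite big_split /=; congr (_ * _).
  by rewrite -expR_sum sumrN; congr (expR (- _)); exact: sum_rate.
rewrite -big_enum /= /count_list; have := enum_uniq 'I_K.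
elim: (enum 'I_K) => [_|k r IH /= /andP[kr r_uniq]]; first by rewrite big_nil mulr1.
rewrite /count_list_on /= -/(count_list_on r c) poisson_list_nseq ?count_list_on_notin //.
by rewrite IH // big_cons mulrCA.
Qed.

Lemma poisson_weight_series lam : (fun N => \sum_(j < N.+1) poisson_weight lam j) @ \oo --> (1 : R).
Proof.
have -> : (1 : R) = expR (- lam) * expR lam by rewrite -expRD addNr expR0.
have h : series (exp_coeff lam) @ \oo --> expR lam by exact: is_cvg_series_exp_coeff.
rewrite -cvg_shiftS in h.
apply: cvg_trans (cvgM (cvg_cst (expR (- lam))) h); apply: near_eq_cvg; near=> N.
transitivity (expR (- lam) * \sum_(0 <= j < N.+1) exp_coeff lam j) => //.
by rewrite mulr_sumr big_mkord; apply: eq_bigr => j _; rewrite /exp_coeff /= mulrA.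
Unshelve. all: by end_near.
Qed.

Lemma prod_cvg1 (I : Type) (r : seq I) (f : I -> nat -> R) :
  (forall i, f i @ \oo --> (1 : R)) ->
  (fun N => \prod_(i <- r) f i N) @ \oo --> (1 : R).
Proof.
move=> f1; elim: r => [|i r IH].
  by under eq_fun do rewrite big_nil; exact: cvg_cst.
under eq_fun do rewrite big_cons.
have h := cvgM (f1 i) IH; rewrite mulr1 in h; exact: h.
Qed.

Lemma poisson_box_cvg B :
  (fun N => \sum_(c : {ffun 'I_K -> 'I_N.+1}) poisson_list K B (count_list (fun k => c k))) @ \oo
  --> (1 : R).
Proof.
apply: cvg_trans (prod_cvg1 (index_enum 'I_K) (fun k : 'I_K => poisson_weight_series (poisson_rate B k.+1))).
apply: near_eq_cvg; near=> N; rewrite bigA_distr_bigA /=.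
by apply: eq_bigr => c _; rewrite poisson_list_count.
Unshelve. all: by end_near.
Qed.

(* At most one of the lists [count_list c] is a permutation of [t]. *)
Lemma box_approx (H : seq nat -> R) M N t : symmetric_fun H -> (forall u, `|H u| <= M) ->
  `|H t - \sum_(c : {ffun 'I_K -> 'I_N.+1}) H (count_list (fun k => c k)) *
        perm_ind R (count_list (fun k => c k)) t| <=
  M * (1 - \sum_(c : {ffun 'I_K -> 'I_N.+1}) perm_ind R (count_list (fun k => c k)) t).
Proof.
move=> symH HM; pose l (c : {ffun 'I_K -> 'I_N.+1}) := count_list (fun k => c k).
have [/existsP[c tc]|none] := boolP [exists c, perm_eq t (l c)]; last first.
  have none' c : perm_ind R (l c) t = 0.
    by rewrite /perm_ind (negbTE (_ : ~~ perm_eq t (l c))) //; move/existsPn: none; apply.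
  rewrite !big1 ?subr0 ?mulr1 // => c _; last by rewrite none' mulr0.
  exact: none'.
have uniq_c c' : c' != c -> perm_ind R (l c') t = 0.
  move=> cc'; rewrite /perm_ind; case: (boolP (perm_eq _ _)) => // tc'.
  case/eqP: cc'; apply/ffunP => k; apply: val_inj => /=.
  rewrite -(count_mem_list (fun k => c' k) k) -(count_mem_list (fun k => c k) k).
  by move/permP: tc => <-; move/permP: tc' => <-.
rewrite (bigD1 c) //= big1 => [|c' cc']; last by rewrite uniq_c // mulr0.
rewrite [X in _ <= M * (1 - X)](bigD1 c) //= big1 => [|c' cc']; last by rewrite uniq_c.
have -> : perm_ind R (count_list (fun k => c k)) t = 1 by rewrite /perm_ind tc.
by rewrite !addr0 mulr1 (symH _ _ tc) !subrr normr0 mulr0.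
Qed.

Lemma cvg_sum_fin (I : finType) (f : I -> nat -> R) (l : I -> R) :
  (forall i, f i @ \oo --> l i) -> (fun n => \sum_i f i n) @ \oo --> \sum_i l i.
Proof.
move=> fl; rewrite /index_enum; elim: (locked_with _ _) => [|i r IH].
  by rewrite big_nil; under eq_fun do rewrite big_nil; exact: cvg_cst.
rewrite big_cons; under eq_fun do rewrite big_cons.
exact: cvgD.
Qed.

(** Point probabilities converge on a finite box of counts. Off the box only the missing mass
    matters, and since that of the walk is one minus a finite sum, it converges to the missing mass
    of the Poisson law. *)
Lemma walk_poisson (e : nat -> R) (m : nat -> nat) B (H : seq nat -> R) M N eta :
  0 < B -> (forall n, 0 <= e n <= 1) -> e n @[n --> \oo] --> (0 : R) ->
  e n * (m n)%:R @[n --> \oo] --> B ->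
  symmetric_fun H -> (forall u, `|H u| <= M) -> 0 < eta ->
  \forall n \near \oo,
  `|walkE (e n) K (m n) H - \sum_(c : {ffun 'I_K -> 'I_N.+1}) H (count_list (fun k => c k)) *
        poisson_list K B (count_list (fun k => c k))| <=
  M * (1 - \sum_(c : {ffun 'I_K -> 'I_N.+1}) poisson_list K B (count_list (fun k => c k))) + eta.
Proof.
move=> B0 e01 e_to0 em symH HM eta0.
pose l (c : {ffun 'I_K -> 'I_N.+1}) := count_list (fun k => c k).
pose W n c := walkE (e n) K (m n) (perm_ind R (l c)).
have e0 n : 0 <= e n by case/andP: (e01 n).
have e1 n : e n <= 1 by case/andP: (e01 n).
have Wc c : W n c @[n --> \oo] --> poisson_list K B (l c).
  by apply: cvg_walkE_perm => //; exact: count_list_all.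
have bound n : `|walkE (e n) K (m n) H - \sum_c H (l c) * poisson_list K B (l c)| <=
   M * (1 - \sum_c W n c) + `|\sum_c H (l c) * W n c - \sum_c H (l c) * poisson_list K B (l c)|.
  apply: (le_trans (ler_distD (\sum_c H (l c) * W n c) _ _)); rewrite lerD2r.
  have -> : \sum_c H (l c) * W n c = walkE (e n) K (m n) (fun t => \sum_c H (l c) * perm_ind R (l c) t).
    by rewrite walkE_sum; apply: eq_bigr => c _; rewrite walkEZ.
  have -> : M * (1 - \sum_c W n c) = walkE (e n) K (m n) (fun t => M * (1 - \sum_c perm_ind R (l c) t)).
    by rewrite walkEZ walkEB walkE_cst walkE_sum.
  rewrite -walkEB; apply: walkE_norm => // u; exact: box_approx.
have lim : (fun n => M * (1 - \sum_c W n c) + `|\sum_c H (l c) * W n c - \sum_c H (l c) * poisson_list K B (l c)|) @ \oo -->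
   M * (1 - \sum_c poisson_list K B (l c)) + `|\sum_c H (l c) * poisson_list K B (l c) - \sum_c H (l c) * poisson_list K B (l c)|.
  apply: cvgD.
    apply: cvgM; first exact: cvg_cst.
    by apply: cvgB; [exact: cvg_cst | exact: cvg_sum_fin].
  apply: cvg_norm; apply: cvgB; last exact: cvg_cst.
  by apply: cvg_sum_fin => c; apply: cvgM => //; exact: cvg_cst.
rewrite subrr normr0 addr0 in lim.
near=> n; apply: (le_trans (bound n)); near: n.
by apply: (cvgr_le _ lim); rewrite ltrDl.
Unshelve. all: by end_near.
Qed.

End PoissonSum.

(** * Asymptotics of the growth factors *)

Section GrowthBounds.
Variable R : realType.
Implicit Types (c e p : R) (m r : nat).

Lemma ln_succ m : m.+2%:R^-1 <= ln m.+2%:R - ln m.+1%:R :> R /\ ln m.+2%:R - ln m.+1%:R <= m.+1%:R^-1 :> R.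
Proof.
have m1 : 0 < m.+1%:R :> R by rewrite ltr0n.
have m2 : 0 < m.+2%:R :> R by rewrite ltr0n.
rewrite -ln_div ?posrE //; split.
  rewrite -[_ / _]invrK lnV ?posrE ?invr_gt0 ?divr_gt0 // lerNr invf_div.
  rewrite (_ : m.+1%:R / m.+2%:R = 1 + (- m.+2%:R^-1)); last first.
    by rewrite -[m.+2%:R]natr1; field.
  by apply: (@le_ln1Dx R (- m.+2%:R^-1)); rewrite ltrN2 invf_lt1 // ltr1n.
rewrite (_ : m.+2%:R / m.+1%:R = 1 + m.+1%:R^-1); last first.
  by rewrite -[m.+2%:R]natr1; field; rewrite lt0r_neq0.
by apply: le_ln1Dx; rewrite (lt_trans (_ : _ < 0)) ?ltrN10 // invr_gt0.
Qed.

(* The ratio of the growth factors for [q * p] and for [q], where [q = 1, 2],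
   [c = q (1 - p)] and [r = q + 1]; it is [m ^ (- c)] up to a factor [expR (O(c))]. *)
Definition damping c r m : R := \prod_(k < m) (1 - c / (k + r)%:R).

Lemma damping_ge0 c r m : c <= 1 -> (2 <= r)%N -> 0 <= damping c r m.
Proof.
move=> c1 r2; apply: prodr_ge0 => k _.
rewrite subr_ge0 ler_pdivrMr ?mul1r ?ltr0n; last by lia.
by rewrite (le_trans c1) // ler1n; lia.
Qed.

(** The correction telescopes: its increment, [c] times [1 / (m + 1) - 1 / (m + 3)], pays for
    replacing [1 / (m + r)] by [ln (m + 2) - ln (m + 1)], and 3 / 2 makes it 0 at [m = 0]. *)
Lemma damping_upper c r m : 0 <= c <= 1 -> (2 <= r <= 3)%N ->
  damping c r m <= expR (- (c * ln m.+1%:R) + c * (3 / 2 - m.+1%:R^-1 - m.+2%:R^-1)).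
Proof.
move=> /andP[c0 c1] /andP[r2 r3]; elim: m => [|m IH].
  by rewrite /damping big_ord0 ln1 mulr0 oppr0 add0r invr1 (_ : 3 / 2 - 1 - _ = 0) ?mulr0 ?expR0 //; field.
have mr : 0 < (m + r)%:R :> R by rewrite ltr0n; lia.
have f0 : 0 <= 1 - c / (m + r)%:R.
  by rewrite subr_ge0 ler_pdivrMr // mul1r (le_trans c1) // ler1n; lia.
rewrite /damping big_ord_recr /= -/(damping c r m).
apply: (@le_trans _ _ (expR (- (c * ln m.+1%:R) + c * (3 / 2 - m.+1%:R^-1 - m.+2%:R^-1)) * expR (- (c / (m + r)%:R)))).
  by apply: ler_pM => //; [exact: damping_ge0 | exact: one_sub_le_expR].
rewrite -expRD ler_expR.
have [_ h] := ln_succ m.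
have h3 : m.+3%:R^-1 <= (m + r)%:R^-1 :> R by rewrite lef_pV2 ?posrE ?ltr0n ?ler_nat //; lia.
rewrite -subr_ge0 (_ : _ - _ = c * ((m + r)%:R^-1 - m.+3%:R^-1 + (m.+1%:R^-1 - (ln m.+2%:R - ln m.+1%:R)))); last by ring.
by rewrite mulr_ge0 // addr_ge0 // subr_ge0.
Qed.

(** Here the increment [2 c / ((m + 1) (m + 2))] pays for the quadratic term of [expR_le_one_sub];
    the linear term is favourable. *)
Lemma damping_lower c r m : 0 <= c <= 1 -> (2 <= r <= 3)%N ->
  expR (- (c * ln m.+1%:R) - 2 * c * (1 - m.+1%:R^-1)) <= damping c r m.
Proof.
move=> /andP[c0 c1] /andP[r2 r3]; elim: m => [|m IH].
  by rewrite /damping big_ord0 ln1 mulr0 oppr0 add0r invr1 subrr mulr0 oppr0 expR0.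
have mr : 0 < (m + r)%:R :> R by rewrite ltr0n; lia.
have m1 : 0 < m.+1%:R :> R by rewrite ltr0n.
have m2 : 0 < m.+2%:R :> R by rewrite ltr0n.
have inv_le : (m + r)%:R^-1 <= m.+2%:R^-1 :> R by rewrite lef_pV2 ?posrE ?ler_nat //; lia.
have inv0 : 0 < (m + r)%:R^-1 :> R by rewrite invr_gt0.
have inv2 : m.+2%:R^-1 <= 1 / 2 :> R.
  by rewrite ler_pdivlMr // mulrC ler_pdivrMr // mul1r ler_nat.
have x0 : 0 <= c / (m + r)%:R by rewrite divr_ge0 // ltW.
have x2 : c / (m + r)%:R <= m.+2%:R^-1.
  by rewrite (le_trans _ inv_le) // ler_piMl // ltW.
have := expR_le_one_sub x0 (le_trans x2 inv2) => step.
rewrite /damping big_ord_recr /= -/(damping c r m).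
apply: (@le_trans _ _ (expR (- (c * ln m.+1%:R) - 2 * c * (1 - m.+1%:R^-1)) *
   expR (- (c / (m + r)%:R + 2 * (c / (m + r)%:R) ^+ 2)))); last first.
  by apply: ler_pM => //; exact: expR_ge0.
rewrite -expRD ler_expR.
have [h _] := ln_succ m.
have mm : m.+1%:R^-1 - m.+2%:R^-1 = m.+1%:R^-1 * m.+2%:R^-1 :> R.
  rewrite -[m.+2%:R]natr1; field.
  by rewrite -natr1 in m2; rewrite !lt0r_neq0.
have m12 : m.+2%:R^-1 <= m.+1%:R^-1 :> R by rewrite lef_pV2 ?posrE // ler_nat.
have sq : (c / (m + r)%:R) ^+ 2 <= c * (m.+1%:R^-1 - m.+2%:R^-1).
  rewrite mm expr2; apply: (@le_trans _ _ (c / (m + r)%:R * m.+2%:R^-1)); first by apply: ler_wpM2l.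
  rewrite -mulrA; apply: ler_wpM2l => //; apply: ler_wpM2r; first by rewrite invr_ge0.
  exact: le_trans inv_le m12.
have lin : c * (m + r)%:R^-1 <= c * (ln m.+2%:R - ln m.+1%:R).
  by apply: ler_wpM2l => //; exact: le_trans inv_le h.
move: sq lin; set X := c / _; set L2 := ln m.+2%:R; set L1 := ln m.+1%:R.
move: (X ^+ 2) (m.+1%:R^-1) (m.+2%:R^-1) => Y u v; nra.
Qed.

Lemma damping_bounds c r m : 0 <= c <= 1 -> (2 <= r <= 3)%N ->
  expR (- (2 * c)) <= damping c r m * expR (c * ln m.+1%:R) <= expR (2 * c).
Proof.
move=> c01 r23; have /andP[c0 c1] := c01; apply/andP; split.
  rewrite -ler_pdivrMr ?expR_gt0 // -expRN -expRD; apply: le_trans (damping_lower m c01 r23).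
  rewrite ler_expR; have : 0 <= m.+1%:R^-1 :> R by rewrite invr_ge0.
  move: (m.+1%:R^-1) (ln _) => u L u0; nra.
rewrite -ler_pdivlMr ?expR_gt0 // -expRN -expRD; apply: le_trans (damping_upper m c01 r23) _.
rewrite ler_expR; have : 0 <= m.+1%:R^-1 :> R by rewrite invr_ge0.
have : 0 <= m.+2%:R^-1 :> R by rewrite invr_ge0.
move: (m.+1%:R^-1) (m.+2%:R^-1) (ln _) => u v L u0 v0; nra.
Qed.

(** Factor by factor, [1 + p / k] is [(k + 1) / k] times [1 - (1 - p) / (k + 1)]. *)
Lemma growth1_damping p m : growth p 1 m = m.+1%:R * damping (1 - p) 2 m.
Proof.
elim: m => [|m IH]; first by rewrite /growth /damping !big_ord0 mulr1.
rewrite growthS IH /damping big_ord_recr /= add1n addn2 -[m.+2%:R]natr1; field.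
by rewrite !(nat1r, natr1) !pnatr_eq0.
Qed.

Lemma growth2_damping p m :
  growth (2 * p) 1 m = m.+1%:R * m.+2%:R / 2 * damping (2 * (1 - p)) 3 m.
Proof.
elim: m => [|m IH]; first by rewrite /growth /damping !big_ord0 mul1r divff ?mulr1 // pnatr_eq0.
rewrite growthS IH /damping big_ord_recr /= add1n addn3 -[m.+3%:R]natr1 -[m.+2%:R]natr1; field.
by rewrite !(nat1r, natr1) !pnatr_eq0.
Qed.

(** Crude but enough: the sum is either multiplied by [e] with about [B / e] terms, or divided by
    [B] with [O(B)] terms. *)
Lemma harmonic_le_sqrt m : \sum_(0 <= j < m) j.+1%:R^-1 <= 2 * Num.sqrt m%:R :> R.
Proof.
elim: m => [|m IH]; first by rewrite big_geq // mulr_ge0 // sqrtr_ge0.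
rewrite big_nat_recr //=; apply: (le_trans (lerD IH (lexx _))).
set x := Num.sqrt _; set y := Num.sqrt _.
have x0 : 0 <= x by exact: sqrtr_ge0.
have y1 : 1 <= y by rewrite -sqrtr1 ler_wsqrtr // ler1n.
have xy : x <= y by rewrite ler_wsqrtr // ler_nat.
have x2 : x ^+ 2 = m%:R by rewrite sqr_sqrtr.
have y2 : y ^+ 2 = m.+1%:R by rewrite sqr_sqrtr.
have diff : (y - x) * (y + x) = 1 by rewrite -subr_sqr x2 y2 -natr1 addrAC subrr add0r.
rewrite -y2 -lerBrDl -mulrBr.
rewrite (_ : y - x = (y + x)^-1); last first.
  by apply: (mulIf (x := y + x)); rewrite ?diff ?mulVf //; apply: lt0r_neq0; lra.
rewrite -[2]invrK -invfM lef_pV2 ?posrE.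
- nra.
- by rewrite exprn_gt0 //; lra.
- by rewrite mulr_gt0 // ?invr_gt0 //; lra.
Qed.

Lemma ln_le_harmonic m : ln m.+1%:R <= \sum_(0 <= j < m) j.+1%:R^-1 :> R.
Proof.
elim: m => [|m IH]; first by rewrite ln1 big_geq.
rewrite big_nat_recr //=; have [_ h] := ln_succ m.
by rewrite -[leLHS](subrK (ln m.+1%:R)) addrC; exact: lerD.
Qed.

End GrowthBounds.

Lemma powR_natE (R : realType) (p : R) n : (0 < n)%N ->
  n%:R `^ p = n%:R * expR (- ((1 - p) * ln n%:R)) :> R.
Proof.
move=> n0; have n0' : 0 < n%:R :> R by rewrite ltr0n.
have nE : n%:R = expR (ln n%:R) :> R by rewrite lnK ?posrE.
rewrite /powR gt_eqF // [X in _ = X * _]nE -expRD; congr expR; ring.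
Qed.

Lemma cvg_expR (R : realType) (u : nat -> R) l :
  u n @[n --> \oo] --> l -> expR (u n) @[n --> \oo] --> expR l.
Proof. by move=> ul; apply: continuous_cvg => //; exact: continuous_expR. Qed.

Section Asymptotics.
Variables (R : realType) (p : nat -> R).
Hypothesis p01 : forall n, 0 < p n < 1.
Hypothesis p_to1 : p n @[n --> \oo] --> (1 : R).
Hypothesis p_slow : ((1 - p n) * n%:R `^ p n) @[n --> \oo] --> +oo.

Let e n := 1 - p n.

Let e_gt0 n : 0 < e n. Proof. by rewrite subr_gt0; case/andP: (p01 n). Qed.
Lemma gap_cvg0 : e n @[n --> \oo] --> (0 : R).
Proof. by rewrite -[0](subrr 1); apply: cvgB => //; exact: cvg_cst. Qed.

Let e_le a : 0 < a -> \forall n \near \oo, e n <= a.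
Proof. by move=> a0; exact: (cvgr_le _ gap_cvg0). Qed.

Lemma damping_cvg (b : R) r (m : nat -> nat) : 0 < b -> (2 <= r <= 3)%N ->
  damping (b * e n) r (m n) * expR (b * e n * ln (m n).+1%:R) @[n --> \oo] --> (1 : R).
Proof.
move=> b0 r23.
apply: (@squeeze_cvgr _ _ _ _ (fun n => expR (- (2 * (b * e n)))) (fun n => expR (2 * (b * e n)))).
- near=> n; apply: damping_bounds => //; rewrite mulr_ge0 ?(ltW b0) ?(ltW (e_gt0 n)) //=.
  rewrite -ler_pdivlMl // mulr1; near: n; apply: e_le; by rewrite invr_gt0.
- rewrite -[X in _ --> X](_ : expR (- (2 * (b * 0))) = 1); last by rewrite !mulr0 oppr0 expR0.
  by apply: cvg_expR; apply: cvgN; do 2 (apply: cvgM; first exact: cvg_cst); exact: gap_cvg0.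
- rewrite -[X in _ --> X](_ : expR (2 * (b * 0)) = 1); last by rewrite !mulr0 expR0.
  by apply: cvg_expR; do 2 (apply: cvgM; first exact: cvg_cst); exact: gap_cvg0.
Unshelve. all: by end_near.
Qed.

Let damping1_cvg (m : nat -> nat) :
  damping (e n) 2 (m n) * expR (e n * ln (m n).+1%:R) @[n --> \oo] --> (1 : R).
Proof.
by have := @damping_cvg 1 2 m ltr01 isT; under eq_fun do rewrite !mul1r.
Qed.

Let inv_cvg0 : (n%:R^-1 : R) @[n --> \oo] --> (0 : R).
Proof.
have h := @cvg_harmonic R; have := cvg_shiftS (fun n => n%:R^-1 : R) (nbhs (0 : R)).
by rewrite propeqE => -[+ _]; apply.
Qed.

Let ln_diff_cvg0 : e n * (ln n.+1%:R - ln n%:R) @[n --> \oo] --> (0 : R).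
Proof.
have bound k : 0 <= e k.+1 * (ln k.+2%:R - ln k.+1%:R) <= e k.+1.
  have [h1 h2] := @ln_succ R k; have e0 := e_gt0 k.+1.
  have u0 : 0 <= k.+2%:R^-1 :> R by rewrite invr_ge0.
  have u1 : k.+1%:R^-1 <= 1 :> R by rewrite invf_le1 // ler1n.
  rewrite mulr_ge0 ?(ltW e0) ?(le_trans u0) //= -[leRHS]mulr1.
  by apply: ler_wpM2l; [exact: ltW | exact: le_trans u1].
apply: (@squeeze_cvgr _ _ _ _ (fun=> 0) (fun n => e n)); [|exact: cvg_cst|exact: gap_cvg0].
near=> n; have n0 : (0 < n)%N by near: n; exact: nbhs_infty_gt.
by rewrite -(prednK n0); exact: bound.
Unshelve. all: by end_near.
Qed.

Lemma growth1_cvg : growth (p n) 1 n / n%:R `^ p n @[n --> \oo] --> (1 : R).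
Proof.
have lim : damping (e n) 2 n * expR (e n * ln n.+1%:R) * ((1 + n%:R^-1) * expR (- (e n * (ln n.+1%:R - ln n%:R))))
    @[n --> \oo] --> (1 : R).
  rewrite -[X in _ --> X](_ : 1 * ((1 + 0) * expR (- 0)) = 1); last by rewrite oppr0 expR0; ring.
  apply: cvgM; first exact: (@damping1_cvg id).
  apply: cvgM; first by apply: cvgD; [exact: cvg_cst | exact: inv_cvg0].
  by apply: cvg_expR; exact: cvgN.
apply: cvg_trans lim; apply: near_eq_cvg; near=> n.
have n0 : (0 < n)%N by near: n; exact: nbhs_infty_gt.
rewrite growth1_damping powR_natE // -/(e n) mulrBr opprB addrC expRD !expRN -natr1.
field; rewrite ?expR_eq0 ?pnatr_eq0 -?lt0n ?n0 ?andbT //=.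
Unshelve. all: by end_near.
Qed.

(** The limit comes from [(n + 1) (n + 2) / 2] and compensates for the initial value 2 of the rising
    factorial. *)
Lemma growth2_cvg : growth (2 * p n) 1 n / (n%:R `^ p n) ^+ 2 @[n --> \oo] --> (1 / 2 : R).
Proof.
have lim : damping (2 * e n) 3 n * expR (2 * e n * ln n.+1%:R) *
   ((1 + n%:R^-1) * (1 + 2 * n%:R^-1) / 2 * expR (- (2 * (e n * (ln n.+1%:R - ln n%:R)))))
    @[n --> \oo] --> (1 / 2 : R).
  rewrite -[X in _ --> X](_ : 1 * ((1 + 0) * (1 + 2 * 0) / 2 * expR (- (2 * 0))) = 1 / 2); last first.
    by rewrite mulr0 oppr0 expR0; ring.
  apply: cvgM; first by apply: (@damping_cvg 2 3 id) => //; rewrite ltr0n.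
  apply: cvgM.
    apply: cvgM; last exact: cvg_cst.
    apply: cvgM; first by apply: cvgD; [exact: cvg_cst | exact: inv_cvg0].
    by apply: cvgD; [exact: cvg_cst | apply: cvgM; [exact: cvg_cst | exact: inv_cvg0]].
  apply: cvg_expR; apply: cvgN.
  by apply: cvgM; [exact: cvg_cst | exact: ln_diff_cvg0].
apply: cvg_trans lim; apply: near_eq_cvg; near=> n.
have n0 : (0 < n)%N by near: n; exact: nbhs_infty_gt.
rewrite growth2_damping powR_natE // -/(e n).
have -> : expR (- (2 * (e n * (ln n.+1%:R - ln n%:R)))) =
    (expR (2 * e n * ln n.+1%:R))^-1 * ((expR (- (e n * ln n%:R)))^-1) ^+ 2.
  by rewrite -!expRN opprK -expRM_natl -expRD; congr expR; ring.
rewrite -[n.+2%:R]natr1 -[n.+1%:R]natr1.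
field; rewrite ?expR_eq0 ?pnatr_eq0 -?lt0n ?n0 ?andbT //=.
Unshelve. all: by end_near.
Qed.

Section Horizon.
Variable B : R.
Hypothesis B_gt0 : 0 < B.

Definition horizon n : nat := Num.truncn (B / (1 - p n)).

Lemma horizon_bounds n : B - e n <= e n * (horizon n)%:R <= B.
Proof.
have Be : 0 <= B / e n by rewrite divr_ge0 // ltW.
rewrite lerBlDr -{2}[e n]mulr1 -mulrDr natr1; apply/andP; split.
  by rewrite mulrC -ler_pdivrMr // ltW // truncnS_gt.
by rewrite mulrC -ler_pdivlMr // truncn_le.
Qed.

Lemma horizon_cvg : e n * (horizon n)%:R @[n --> \oo] --> B.
Proof.
apply: (@squeeze_cvgr _ _ _ _ (fun n => B - e n) (fun=> B)); last exact: cvg_cst.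
  by near=> n; exact: horizon_bounds.
by rewrite -[X in _ --> X]subr0; apply: cvgB; [exact: cvg_cst | exact: gap_cvg0].
Unshelve. all: by end_near.
Qed.

Lemma horizonS_cvg : e n * (horizon n).+1%:R @[n --> \oo] --> B.
Proof.
rewrite -[X in _ --> X]addr0; under eq_fun do rewrite -natr1 mulrDr mulr1.
by apply: cvgD; [exact: horizon_cvg | exact: gap_cvg0].
Qed.

Lemma harmonic_horizon_cvg : e n * (\sum_(0 <= j < horizon n) j.+1%:R^-1) @[n --> \oo] --> (0 : R).
Proof.
apply: (@squeeze_cvgr _ _ _ _ (fun=> 0) (fun n => 2 * (Num.sqrt (e n) * Num.sqrt (e n * (horizon n)%:R)))).
- near=> n; apply/andP; split.
    by rewrite mulr_ge0 ?(ltW (e_gt0 n)) // sumr_ge0 // => j _; rewrite invr_ge0.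
  have sq : Num.sqrt (e n) * Num.sqrt (e n) = e n by rewrite -expr2 sqr_sqrtr ?(ltW (e_gt0 n)).
  rewrite (sqrtrM _ (ltW (e_gt0 n))).
  rewrite [leRHS](_ : _ = Num.sqrt (e n) * Num.sqrt (e n) * (2 * Num.sqrt (horizon n)%:R)); last by ring.
  rewrite sq.
  by apply: ler_wpM2l; [exact: ltW | exact: harmonic_le_sqrt].
- exact: cvg_cst.
- rewrite -[X in _ --> X](_ : 2 * (Num.sqrt 0 * Num.sqrt B) = 0); last by rewrite sqrtr0 mul0r mulr0.
  apply: cvgM; first exact: cvg_cst.
  by apply: cvgM; apply: continuous_cvg; do ?exact: sqrt_continuous;
     [exact: gap_cvg0 | exact: horizon_cvg].
Unshelve. all: by end_near.
Qed.

(** Up to the horizon the damping [m ^ (- e)] is asymptotically invisible, so the growth factors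
    behave there as for [p = 1]. *)
Lemma ln_horizon_cvg : e n * ln (horizon n).+1%:R @[n --> \oo] --> (0 : R).
Proof.
apply: (@squeeze_cvgr _ _ _ _ (fun=> 0) (fun n => e n * (\sum_(0 <= j < horizon n) j.+1%:R^-1))).
- near=> n; rewrite mulr_ge0 ?(ltW (e_gt0 n)) ?ln_ge0 ?ler1n //=.
  by apply: ler_wpM2l; [exact: ltW | exact: ln_le_harmonic].
- exact: cvg_cst.
- exact: harmonic_horizon_cvg.
Unshelve. all: by end_near.
Qed.

Lemma growth1_horizon_cvg : e n * growth (p n) 1 (horizon n) @[n --> \oo] --> B.
Proof.
have lim : e n * (horizon n).+1%:R * (damping (e n) 2 (horizon n) * expR (e n * ln (horizon n).+1%:R)) *
  expR (- (e n * ln (horizon n).+1%:R)) @[n --> \oo] --> B.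
  rewrite -[X in _ --> X](_ : B * 1 * expR (- 0) = B); last by rewrite oppr0 expR0 !mulr1.
  apply: cvgM; last by apply: cvg_expR; apply: cvgN; exact: ln_horizon_cvg.
  by apply: cvgM; [exact: horizonS_cvg | exact: damping1_cvg].
apply: cvg_trans lim; apply: near_eq_cvg; near=> n.
rewrite growth1_damping expRN; field; by rewrite gt_eqF ?expR_gt0.
Unshelve. all: by end_near.
Qed.

Lemma growth2_horizon_cvg : e n ^+ 2 * growth (2 * p n) 1 (horizon n) @[n --> \oo] --> B ^+ 2 / 2.
Proof.
have lim : e n * (horizon n).+1%:R * (e n * (horizon n).+1%:R + e n) / 2 *
  (damping (2 * e n) 3 (horizon n) * expR (2 * e n * ln (horizon n).+1%:R)) *
  expR (- (2 * (e n * ln (horizon n).+1%:R))) @[n --> \oo] --> B ^+ 2 / 2.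
  rewrite -[X in _ --> X](_ : B * (B + 0) / 2 * 1 * expR (- (2 * 0)) = B ^+ 2 / 2); last first.
    by rewrite mulr0 oppr0 expR0; ring.
  apply: cvgM; last first.
    by apply: cvg_expR; apply: cvgN; apply: cvgM; [exact: cvg_cst | exact: ln_horizon_cvg].
  apply: cvgM; last by apply: (@damping_cvg 2 3 horizon) => //; rewrite ltr0n.
  apply: cvgM; last exact: cvg_cst.
  apply: cvgM; first exact: horizonS_cvg.
  by apply: cvgD; [exact: horizonS_cvg | exact: gap_cvg0].
apply: cvg_trans lim; apply: near_eq_cvg; near=> n.
rewrite growth2_damping expRN -[_.+2%:R]natr1 mulrA; field; by rewrite gt_eqF ?expR_gt0.
Unshelve. all: by end_near.
Qed.

(** [e n ^ p] tends to infinity and [n ^ p <= n], so [B / e] is eventually below [n]. *)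
Lemma horizon_le : \forall n \near \oo, (horizon n <= n)%N.
Proof.
near=> n; have n0 : (0 < n)%N by near: n; exact: nbhs_infty_gt.
have : B <= e n * n%:R `^ p n by near: n; exact: (cvgry_ge p_slow).
have np : n%:R `^ p n <= n%:R :> R.
  by rewrite -[leRHS](powRr1 (ler0n R n)) ler_powR ?ler1n // ltW //; case/andP: (p01 n).
move=> BN; rewrite -(ler_nat R) (le_trans (_ : _ <= B / e n)) //.
  by rewrite truncn_le (divr_ge0 (ltW B_gt0) (ltW (e_gt0 n))).
rewrite ler_pdivrMr // mulrC (le_trans BN) //; apply: ler_wpM2l => //; exact: ltW.
Unshelve. all: by end_near.
Qed.

End Horizon.

End Asymptotics.

(** * Comparison of the chain at two times *)

Lemma root_cluster_cvg (R : realType) (p : nat -> R) :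
  (forall n, 0 < p n < 1) -> p n @[n --> \oo] --> (1 : R) ->
  ((1 - p n) * n%:R `^ p n) @[n --> \oo] --> +oo ->
  forall eps : R, 0 < eps ->
  percP (p n) (fun F : graph n => eps < `|(root_cluster_size F)%:R / n%:R `^ p n - 1|)
     @[n --> \oo] --> (0 : R).
Proof.
move=> p01 p_to1 p_slow eps eps0.
pose g n := 2 * (growth (2 * p n) 1 n / (n%:R `^ p n) ^+ 2) - 2 * (growth (p n) 1 n / n%:R `^ p n) + 1.
have g_cvg : (eps ^+ 2)^-1 * g n @[n --> \oo] --> (0 : R).
  rewrite -[X in _ --> X](_ : (eps ^+ 2)^-1 * (2 * (1 / 2) - 2 * 1 + 1) = 0); last first.
    by rewrite (_ : _ - _ + _ = 0) ?mulr0 //; field.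
  apply: cvgM; first exact: cvg_cst.
  apply: cvgD; last exact: cvg_cst.
  apply: cvgB; apply: cvgM; do ?exact: cvg_cst; [exact: growth2_cvg | exact: growth1_cvg].
apply: (@squeeze_cvgr _ _ _ _ (fun=> 0) (fun n => (eps ^+ 2)^-1 * g n)) => //; last exact: cvg_cst.
near=> n; have n0 : (0 < n)%N by near: n; exact: nbhs_infty_gt.
have p0 : 0 <= p n by case/andP: (p01 n) => /ltW.
have p1 : p n <= 1 by case/andP: (p01 n) => _ /ltW.
have a0 : 0 < n%:R `^ p n :> R by apply: powR_gt0; rewrite ltr0n.
rewrite /g; move: (n%:R `^ p n) a0 => a a0.
pose phi (s : seq nat) : R := (eps < `|(nth 0%N s 0)%:R / a - 1|)%R%:R.
rewrite /percP (@percE_chain R (p n) n _ phi); last first.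
  by move=> F s Fs; rewrite /phi (root_cluster_sizeE Fs).
apply/andP; split; first by apply: chain_ge0 => // t _; rewrite /phi.
(* The bracket is [(x / a - 1) ^ 2 + x / a ^ 2]: the Chebyshev bound with a spare nonnegative term,
   chosen so that its mean is explicit. *)
pose phi2 (s : seq nat) : R := (eps ^+ 2)^-1 * (a ^- 2 * ((nth 0%N s 0)%:R * (nth 0%N s 0).+1%:R) +
   (- (2 / a) * (nth 0%N s 0)%:R + 1)).
apply: (@le_trans _ _ (iter n (chain_step (p n)) phi2 [:: 1%N])).
  apply: chain_le => // t _; rewrite /phi /phi2; set x := nth 0%N t 0.
  have eps2 : 0 < eps ^+ 2 by rewrite exprn_gt0.
  have x0 : 0 <= x%:R / a ^+ 2 :> R by rewrite divr_ge0 // sqr_ge0.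
  rewrite [X in _ <= _ * X](_ : _ = x%:R / a ^+ 2 + `|x%:R / a - 1| ^+ 2); last first.
    by rewrite real_normK ?num_real // -natr1; field; exact: lt0r_neq0.
  case: ltP => [h|_]; last by rewrite mulr_ge0 ?invr_ge0 ?(ltW eps2) // addr_ge0 // sqr_ge0.
  rewrite ler_pdivlMl // mulr1 (le_trans (_ : _ <= `|x%:R / a - 1| ^+ 2)) ?lerDr //.
  by rewrite ler_sqr ?nnegrE ?(ltW eps0) // ltW.
rewrite chainZ chainD chainZ chainD chainZ chain_cst // chain_root1 // chain_root2 //=.
rewrite le_eqVlt; apply/orP; left; apply/eqP; congr (_ * _); field; exact: lt0r_neq0.
Unshelve. all: by end_near.
Qed.

Lemma geq_total : total geq.
Proof. by move=> x y; exact: leq_total. Qed.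

Lemma geq_trans : transitive geq.
Proof. by move=> x y z /= yx xz; exact: leq_trans xz yx. Qed.

(** * Sorted sizes and test functions *)

Section OrderStatistics.
Variable R : realType.
Implicit Types (u v : seq nat) (a b eta : R) (P Q : pred nat).

Lemma nth_sort_geq P u i : (forall x y, (x <= y)%N -> P x -> P y) -> ~~ P 0%N ->
  P (nth 0%N (sort geq u) i) = (i < count P u)%N.
Proof.
move=> up P0; rewrite -(permP (permEl (perm_sort geq u)) P).
have : sorted geq (sort geq u) by apply: sort_sorted; exact: geq_total.
elim: (sort geq u) i => [|x w IH] i /=; first by rewrite nth_nil (negbTE P0).
move=> w_path; have w_sorted := path_sorted w_path.
have [Px|nPx] := boolP (P x); first by case: i => [|i] /=; rewrite ?Px // add1n ltnS IH.
have w_le : all (geq x) w := order_path_min geq_trans w_path.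
have w_nP : all (predC P) w.
  have x_nP : subpred (geq x) (predC P) by move=> y yx; apply: contra nPx; exact: up.
  exact: (seq.sub_all x_nP w_le).
have -> : count P w = 0%N by apply/eqP; rewrite -leqn0 leqNgt -has_count -all_predC.
case: i => [|i] /=; first by rewrite (negbTE nPx).
have [iw|wi] := ltnP i (size w); last by rewrite nth_default // (negbTE P0).
by apply/negbTE; exact: (all_nthP 0%N w_nP).
Qed.

Lemma count_nth_le P Q u v : ~~ P 0%N -> (forall j, P (nth 0%N u j) -> Q (nth 0%N v j)) ->
  ~~ Q 0%N -> (count P u <= count Q v)%N.
Proof.
move=> P0 PQ Q0.
have E (S : pred nat) w N : ~~ S 0%N -> (size w <= N)%N ->
    count S w = (\sum_(0 <= j < N) S (nth 0%N w j))%N.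
  move=> S0 wN; rewrite (@big_cat_nat _ _ _ (size w)) //= [X in (_ + X)%N]big_nat_cond.
  rewrite [X in (_ + X)%N]big1 => [|j /andP[/andP[wj _] _]]; last first.
    by rewrite nth_default // (negbTE S0).
  by rewrite addn0 -(big_nth 0%N xpredT (fun x => nat_of_bool (S x))) -sum1_count big_mkcond.
rewrite (E P u (size u + size v)%N) ?leq_addr // (E Q v (size u + size v)%N) ?leq_addl //.
by apply: leq_sum => j _; case: (boolP (P _)) => // /PQ ->.
Qed.

(** Sorting is nonexpansive in the sup norm: if the entry of rank [i] of [u] broke the bound, more
    than [i] entries of [v] would exceed its entry of rank [i]. *)
Lemma sort_dist_le1 a b eta u v i : 0 <= a -> 0 <= b -> 0 <= eta ->
  (forall j, a * (nth 0%N u j)%:R <= b * (nth 0%N v j)%:R + eta) ->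
  a * (nth 0%N (sort geq u) i)%:R <= b * (nth 0%N (sort geq v) i)%:R + eta.
Proof.
move=> a0 b0 eta0 uv; rewrite leNgt; apply/negP.
set V := nth 0%N (sort geq v) i => h.
pose P c := (b * V%:R + eta < a * c%:R); pose Q c := (b * V%:R < b * c%:R).
have upP x y : (x <= y)%N -> P x -> P y.
  by move=> xy Px; apply: lt_le_trans Px _; apply: ler_wpM2l => //; rewrite ler_nat.
have upQ x y : (x <= y)%N -> Q x -> Q y.
  by move=> xy Qx; apply: lt_le_trans Qx _; apply: ler_wpM2l => //; rewrite ler_nat.
have P0 : ~~ P 0%N by rewrite /P mulr0 -leNgt addr_ge0 // mulr_ge0.
have Q0 : ~~ Q 0%N by rewrite /Q mulr0 -leNgt mulr_ge0.
have : (i < count P u)%N by rewrite -nth_sort_geq.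
move/leq_trans => /(_ (count Q v)); rewrite -(nth_sort_geq v i upQ Q0) /Q -/V ltxx.
suff -> : (count P u <= count Q v)%N by move/(_ isT).
apply: count_nth_le => // j; rewrite /P /Q => Pj.
by rewrite -(ltrD2r eta); apply: lt_le_trans Pj (uv j).
Qed.

Lemma sort_dist_le a b eta u v i : 0 <= a -> 0 <= b ->
  (forall j, `|a * (nth 0%N u j)%:R - b * (nth 0%N v j)%:R| <= eta) ->
  `|a * (nth 0%N (sort geq u) i)%:R - b * (nth 0%N (sort geq v) i)%:R| <= eta.
Proof.
move=> a0 b0 uv; have eta0 : 0 <= eta by exact: le_trans (uv 0%N).
rewrite ler_norml lerBlDl lerNl opprB lerBlDl; apply/andP; split; apply: sort_dist_le1 => // j.
  by have := uv j; rewrite ler_norml => /andP[+ _]; rewrite lerNl opprB lerBlDl.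
by have := uv j; rewrite ler_norml => /andP[_]; rewrite lerBlDl.
Qed.

Lemma nth_sort_geq_le K v i : all (leq^~ K) v -> (nth 0%N (sort geq v) i <= K)%N.
Proof.
move=> vK; have [iv|vi] := ltnP i (size (sort geq v)); last by rewrite nth_default.
have vK' : all (leq^~ K) (sort geq v) by rewrite all_sort.
exact: (all_nthP 0%N vK').
Qed.

End OrderStatistics.

Section TopSizes.
Variables (R : realType) (l : nat).
Implicit Types (a b eta : R) (s t u v : seq nat) (f : 'rV[R]_l -> R).

Definition top_sizes a u : 'rV[R]_l := \row_(i < l) (a * (nth 0%N (sort geq u) i)%:R).

Lemma symmetric_top_sizes a : symmetric_fun (top_sizes a).
Proof.
move=> u v uv; apply/rowP => i; rewrite !mxE; congr (_ * (nth _ _ _)%:R).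
apply/perm_sortP => //.
- exact: geq_total.
- exact: geq_trans.
- by move=> x y; rewrite /= andbC -eqn_leq => /eqP.
Qed.

Lemma top_sizes_dev f M a b eta eta' (K : nat) t s :
  0 <= a -> 0 <= b -> 0 < eta -> 0 <= eta' -> (size t <= size s)%N ->
  (forall x, `|f x| <= M) ->
  (forall x y : 'rV[R]_l, (forall i, 0 <= y ord0 i <= b * K%:R) ->
     (forall i, `|x ord0 i - y ord0 i| <= eta) -> `|f x - f y| <= eta') ->
  `|f (top_sizes a (behead s)) - f (top_sizes b (seq.filter (leq^~ K) (behead t)))| <=
  eta' + 2 * M * large_count R K t + 2 * M / eta ^+ 2 * sq_dev a b K t s.
Proof.
move=> a0 b0 eta0 eta'0 ts fM uc.
have M0 : 0 <= M by exact: le_trans (fM 0).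
have lc0 : 0 <= large_count R K t by apply: stat_ge0 => [j|x].
have sd0 : 0 <= sq_dev a b K t s.
  by apply: sumr_ge0 => j _; rewrite mulr_ge0 ?tracked_ge0 ?sqr_ge0.
have eta2 : 0 < eta ^+ 2 by rewrite exprn_gt0.
have trivial_bound x y : `|f x - f y| <= 2 * M.
  by rewrite (le_trans (ler_normB _ _)) // mulrDl mul1r lerD.
have A0 : 0 <= 2 * M * large_count R K t by rewrite !mulr_ge0.
have B0 : 0 <= 2 * M / eta ^+ 2 * sq_dev a b K t s by rewrite !mulr_ge0 // invr_ge0 ltW.
have mid (x y z : R) : 0 <= x -> 0 <= z -> y <= x + y + z by move=> *; lra.
have right (x y z : R) : 0 <= x -> 0 <= z -> y <= x + z + y by move=> *; lra.
have [t_small|] := boolP (all (leq^~ K) (behead t)); last first.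
  move/allPn => [x xt xK]; apply: (le_trans (trivial_bound _ _)).
  suff h : 2 * M <= 2 * M * large_count R K t by apply: (le_trans h); exact: mid.
  rewrite ler_peMr ?mulr_ge0 //.
  have := nthP 0%N xt => -[j jt jE].
  have j1 : (j.+1 < size t)%N by rewrite -ltn_predRL -size_behead.
  rewrite /large_count /stat (bigD1 (Ordinal j1)) //= mul1r -nth_behead jE ltnNge xK.
  by rewrite lerDl sumr_ge0 // => k _; rewrite mulr_ge0.
have -> : seq.filter (leq^~ K) (behead t) = behead t by exact/all_filterP.
have [sd_lt|sd_ge] := ltP (sq_dev a b K t s) (eta ^+ 2); last first.
  apply: (le_trans (trivial_bound _ _)).
  suff h : 2 * M <= 2 * M / eta ^+ 2 * sq_dev a b K t s by apply: (le_trans h); exact: right.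
  by rewrite -mulrA ler_peMr ?mulr_ge0 // ler_pdivlMl // mulr1.
suff : `|f (top_sizes a (behead s)) - f (top_sizes b (behead t))| <= eta'.
  by move=> h; apply: (le_trans h); rewrite -addrA lerDl addr_ge0.
apply: uc => i; rewrite !mxE.
  rewrite mulr_ge0 //=; apply: ler_wpM2l => //; rewrite ler_nat; exact: nth_sort_geq_le.
apply: sort_dist_le => // j; rewrite !nth_behead.
have [js|sj] := ltnP j.+1 (size s); last first.
  rewrite !nth_default ?mulr0 ?subrr ?normr0 ?(ltW eta0) //; exact: leq_trans sj.
rewrite -ler_sqr ?nnegrE ?(ltW eta0) // real_normK ?num_real //.
apply: le_trans (ltW sd_lt).
rewrite /sq_dev (bigD1 (Ordinal js)) //=.
(* For a cluster born after [t] the default size 0 is tracked, so the same bound covers it. *)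
have -> : tracked R K t j.+1 = 1.
  rewrite /tracked /= -nth_behead; have [jt|tj] := ltnP j (size (behead t)).
    by rewrite (all_nthP 0%N t_small).
  by rewrite nth_default.
by rewrite mul1r lerDl sumr_ge0 // => k _; rewrite mulr_ge0 ?tracked_ge0 ?sqr_ge0.
Qed.

End TopSizes.

(** Only [y] is confined to a box: the rescaled final sizes, which take the role of [x], have no a
    priori bound. *)
Lemma unif_continuous_box (R : realType) l (f : 'rV[R]_l -> R) (L eps : R) :
  continuous f -> 0 < eps ->
  exists2 eta, 0 < eta & forall x y : 'rV[R]_l, (forall i, 0 <= y ord0 i <= L) ->
    (forall i, `|x ord0 i - y ord0 i| <= eta) -> `|f x - f y| <= eps.
Proof.
move=> cf eps0.
have : compact [set v : 'rV[R]_l | forall i, [set` `[0, L]] (v ord0 i)].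
  by apply: (@rV_compact R l (fun=> [set` `[0, L]])) => i; exact: segment_compact.
move/compact_near_coveringP => cov.
have [] := cov R (0^'+) (fun eta y => forall x : 'rV[R]_l, (forall i, `|x ord0 i - y ord0 i| <= eta) ->
    `|f x - f y| <= eps) _ _.
  move=> y _; have eps2 : 0 < eps / 2 by rewrite divr_gt0.
  have /cvgrPdist_lt/(_ _ eps2)/nbhs_ballP[d /= d0 fd] := cf y.
  have d2 : 0 < d / 2 by rewrite divr_gt0.
  exists (ball y (d / 2), [set eta | eta < d / 2]).
    split => /=; first by apply/nbhs_ballP; exists (d / 2).
    exact: nbhs_right_lt.
  move=> [y' eta] /= [[_ yy'] eta_lt] x xy'.
  rewrite (le_trans (ler_distD (f y) _ _)) // [eps]splitr lerD //.
    rewrite distrC; apply/ltW/fd; split => // i j; rewrite ord1.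
    rewrite /ball /= (le_lt_trans (ler_distD (y' ord0 j) _ _)) // [d]splitr ltrD //.
      exact: yy'.
    by rewrite distrC (le_lt_trans (xy' j)).
  apply/ltW/fd; split => // i j; rewrite ord1; apply: lt_le_trans (yy' _ _) _.
  by rewrite ler_pdivrMr // ler_pMr // ler1n.
move=> d /= d0 hd; exists (d / 2); first by rewrite divr_gt0.
move=> x y y_box xy; apply: (hd (d / 2)) => //=.
- by rewrite sub0r normrN gtr0_norm ?divr_gt0 // ltr_pdivrMr // ltr_pMr // ltr1n.
- by rewrite divr_gt0.
Qed.

Lemma chainB (R : realType) (p : R) m (phi psi : seq nat -> R) s :
  iter m (chain_step p) (fun t => phi t - psi t) s =
  iter m (chain_step p) phi s - iter m (chain_step p) psi s.
Proof.
rewrite -[X in _ = _ + X]mulN1r -chainZ -chainD.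
by apply: chain_ext => t; rewrite mulN1r.
Qed.

(** * From percolation to the walk *)

Section PercolationWalk.
Variables (R : realType) (p : nat -> R).
Hypothesis p01 : forall n, 0 < p n < 1.
Hypothesis p_to1 : p n @[n --> \oo] --> (1 : R).
Hypothesis p_slow : ((1 - p n) * n%:R `^ p n) @[n --> \oo] --> +oo.
Variables (B : R) (K : nat).
Hypothesis B_gt0 : 0 < B.

Let e n := 1 - p n.
Let m0 n := horizon p B n.
Let a n := (e n)^-1 / n%:R `^ p n.

Let e_gt0 n : 0 < e n. Proof. by rewrite subr_gt0; case/andP: (p01 n). Qed.

Let e_cvg0 : e n @[n --> \oo] --> (0 : R). Proof. exact: gap_cvg0. Qed.

Let growth_split (q : R) n : (m0 n <= n)%N -> 0 <= q ->
  growth q (m0 n).+1 (n - m0 n) = growth q 1 n / growth q 1 (m0 n).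
Proof.
move=> mn q0; rewrite -[X in growth q 1 X / _](subnKC mn) growthD add1n.
by rewrite mulrAC divff ?mul1r // lt0r_neq0 // growth_gt0.
Qed.

Let A1_cvg : a n * growth (p n) (m0 n).+1 (n - m0 n) @[n --> \oo] --> B^-1.
Proof.
have lim : (growth (p n) 1 n / n%:R `^ p n) / (e n * growth (p n) 1 (m0 n)) @[n --> \oo] --> B^-1.
  rewrite -[X in _ --> X]mul1r; apply: cvgM; first exact: growth1_cvg.
  by apply: cvgV; [exact: lt0r_neq0 | exact: growth1_horizon_cvg].
apply: cvg_trans lim; apply: near_eq_cvg; near=> n.
have mn : (m0 n <= n)%N by near: n; exact: horizon_le.
have p0 : 0 <= p n by case/andP: (p01 n) => /ltW.
have n0 : (0 < n)%N by near: n; exact: nbhs_infty_gt.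
have N0 : 0 < n%:R `^ p n :> R by apply: powR_gt0; rewrite ltr0n.
rewrite growth_split // /a; field.
by rewrite !lt0r_neq0 // growth_gt0.
Unshelve. all: by end_near.
Qed.

Let A2_cvg : a n ^+ 2 * growth (2 * p n) (m0 n).+1 (n - m0 n) @[n --> \oo] --> B^-1 ^+ 2.
Proof.
have lim : (growth (2 * p n) 1 n / (n%:R `^ p n) ^+ 2) / (e n ^+ 2 * growth (2 * p n) 1 (m0 n)) @[n --> \oo] --> B^-1 ^+ 2.
  rewrite -[X in _ --> X](_ : 1 / 2 / (B ^+ 2 / 2) = B^-1 ^+ 2); last by field; exact: lt0r_neq0.
  apply: cvgM; first exact: growth2_cvg.
  apply: cvgV; last exact: growth2_horizon_cvg.
  by rewrite lt0r_neq0 // divr_gt0 // exprn_gt0.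
apply: cvg_trans lim; apply: near_eq_cvg; near=> n.
have mn : (m0 n <= n)%N by near: n; exact: horizon_le.
have p0 : 0 <= 2 * p n by rewrite mulr_ge0 //; case/andP: (p01 n) => /ltW.
have n0 : (0 < n)%N by near: n; exact: nbhs_infty_gt.
have N0 : 0 < n%:R `^ p n :> R by apply: powR_gt0; rewrite ltr0n.
rewrite growth_split // /a; field.
by rewrite !lt0r_neq0 // growth_gt0.
Unshelve. all: by end_near.
Qed.

Let mu n := \sum_(0 <= k < K) e n * (m0 n).+1%:R / k.+1%:R.
Let hK : R := \sum_(0 <= k < K) k.+1%:R^-1.

Let mu_cvg : mu n @[n --> \oo] --> B * hK.
Proof.
rewrite /mu; under eq_fun do rewrite -mulr_sumr.
by apply: cvgM; [exact: horizonS_cvg | exact: cvg_cst].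
Qed.

Let dev n := `|a n ^+ 2 * growth (2 * p n) (m0 n).+1 (n - m0 n) -
   2 * a n * B^-1 * growth (p n) (m0 n).+1 (n - m0 n) + B^-1 ^+ 2| * (K%:R * mu n) +
   a n ^+ 2 * growth (2 * p n) (m0 n).+1 (n - m0 n) * (mu n + 2 * (1 - p n) / (2 * p n - 1) * (m0 n).+1%:R).

(** With [b = 1 / B], the coefficient of [K mu] tends to [b ^ 2 - 2 b ^ 2 + b ^ 2 = 0], so the
    factor [K] disappears and only the harmonic sum divided by [B] survives. *)
Let dev_cvg : dev n @[n --> \oo] --> (hK + 2) / B.
Proof.
have B0 := lt0r_neq0 B_gt0.
rewrite -[X in _ --> X](_ : `|B^-1 ^+ 2 - 2 * B^-1 * B^-1 + B^-1 ^+ 2| * (K%:R * (B * hK)) +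
   B^-1 ^+ 2 * (B * hK + 2 * B / (2 * 1 - 1)) = (hK + 2) / B); last first.
  rewrite (_ : _ + B^-1 ^+ 2 = 0); last by ring.
  by rewrite normr0 mul0r add0r (_ : 2 * 1 - 1 = 1 :> R); [field | ring].
apply: cvgD.
  apply: cvgM; last by apply: cvgM; [exact: cvg_cst | exact: mu_cvg].
  apply: cvg_norm; apply: cvgD; last exact: cvg_cst.
  apply: cvgB; first exact: A2_cvg.
  rewrite (_ : (fun n => _) = (fun n => 2 * B^-1 * (a n * growth (p n) (m0 n).+1 (n - m0 n)))).
    by apply: cvgM; [exact: cvg_cst | exact: A1_cvg].
  by apply/funext => n; ring.
apply: cvgM; first exact: A2_cvg.
apply: cvgD; first exact: mu_cvg.
rewrite (_ : (fun n => _) = (fun n => 2 * (e n * (m0 n).+1%:R) / (2 * p n - 1))); last first.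
  by apply/funext => n; rewrite -/(e n); ring.
apply: cvgM; first by apply: cvgM; [exact: cvg_cst | exact: horizonS_cvg].
apply: cvgV; first by rewrite lt0r_neq0 //; lra.
by apply: cvgB; [apply: cvgM; [exact: cvg_cst | exact: p_to1] | exact: cvg_cst].
Qed.

Variables (l : nat) (f : 'rV[R]_l -> R) (M eta eta' : R).
Hypotheses (eta_gt0 : 0 < eta) (eta'_ge0 : 0 <= eta').
Hypothesis fM : forall x, `|f x| <= M.
Hypothesis f_uc : forall x y : 'rV[R]_l, (forall i, 0 <= y ord0 i <= B^-1 * K%:R) ->
     (forall i, `|x ord0 i - y ord0 i| <= eta) -> `|f x - f y| <= eta'.

Let H t := f (top_sizes l B^-1 t).

Let symH : symmetric_fun H.
Proof. by move=> t u tu; rewrite /H (symmetric_top_sizes _ _ tu). Qed.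

Lemma percE_sub_chain n : (m0 n <= n)%N -> (0 < n)%N -> 1 / 2 < p n ->
  `|percE (p n) (fun F : graph n => f (\row_(i < l) ((1 - p n)^-1 / n%:R `^ p n * (other_cluster_size F i)%:R)))
    - iter (m0 n) (chain_step (p n)) (fun t => H (seq.filter (leq^~ K) (behead t))) [:: 1%N]| <=
  eta' + 2 * M * (e n * (m0 n).+1%:R / K.+1%:R) + 2 * M / eta ^+ 2 * dev n.
Proof.
move=> mn n0 p2; have p0 : 0 <= p n by case/andP: (p01 n) => /ltW.
have p1 : p n <= 1 by case/andP: (p01 n) => _ /ltW.
have M0 : 0 <= M by exact: le_trans (fM 0).
have a0 : 0 <= a n by rewrite /a divr_ge0 ?powR_ge0 // invr_ge0 ltW.
rewrite (@percE_chain R (p n) n _ (fun s => f (top_sizes l (a n) (behead s)))); last first.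
  move=> F s Fs; congr f; apply/rowP => i; rewrite !mxE.
  by rewrite (other_cluster_sizeE _ Fs).
(* Markov property at the horizon: the last [n - m0 n] steps form the inner expectation. *)
rewrite -[X in `|iter X _ _ _ - _|](subnKC mn) iterD -chainB.
set m := (n - m0 n)%N; set X := fun s : seq nat => f _.
apply: (@le_trans _ _ (iter (m0 n) (chain_step (p n)) (fun t => eta' + (2 * M * large_count R K t +
    2 * M / eta ^+ 2 * iter m (chain_step (p n)) (sq_dev (a n) B^-1 K t) t)) [:: 1%N])).
  apply: chain_norm_le => // t st.
  have t0 : (0 < sumn t)%N by exact: (@reachable_sumn_gt0 (m0 n) [:: 1%N]).
  (* What depends on [t] alone is a constant for the inner chain. *)
  rewrite -[X in `|_ - X|](chain_cst p0 p1 m _ t0) -chainB.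
  rewrite -[X in _ <= X + (_ + _)](chain_cst p0 p1 m _ t0) -[X in _ <= _ + (X + _)](chain_cst p0 p1 m _ t0).
  rewrite -chainZ -!chainD; apply: chain_norm_le => // s [_ ts _].
  rewrite addrA; apply: top_sizes_dev => //; rewrite invr_ge0 ltW //.
rewrite chainD chain_cst // chainD !chainZ -addrA lerD2l; apply: lerD.
  apply: ler_wpM2l; first by rewrite mulr_ge0.
  exact: chain_large_count.
apply: ler_wpM2l; first by apply: divr_ge0; [exact: mulr_ge0 | exact: sqr_ge0].
apply: chain_chain_sq_dev => //; rewrite invr_ge0 ltW //.
Qed.

Lemma percE_sub_walk tol : 0 < tol -> \forall n \near \oo,
  `|percE (p n) (fun F : graph n => f (\row_(i < l) ((1 - p n)^-1 / n%:R `^ p n * (other_cluster_size F i)%:R)))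
    - walkE (1 - p n) K (m0 n).+1 H| <=
  eta' + 2 * M * (B / K.+1%:R) + 2 * M / eta ^+ 2 * ((hK + 2) / B) + tol.
Proof.
move=> tol0.
pose harm n := \sum_(0 <= j < m0 n) j.+1%:R^-1 : R.
pose U n := eta' + 2 * M * (e n * (m0 n).+1%:R / K.+1%:R) + 2 * M / eta ^+ 2 * dev n +
  (2 * M * e n + M * (12 + 2 * K%:R ^+ 2) * (e n * (e n * (m0 n)%:R)) + 2 * M * K%:R * (e n * harm n)).
have U_cvg : U n @[n --> \oo] --> eta' + 2 * M * (B / K.+1%:R) + 2 * M / eta ^+ 2 * ((hK + 2) / B).
  rewrite -[X in _ --> X]addr0.
  rewrite -[X in _ --> _ + X](_ : 2 * M * 0 + M * (12 + 2 * K%:R ^+ 2) * (0 * B) + 2 * M * K%:R * 0 = 0); last first.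
    by rewrite mul0r !mulr0 !addr0.
  apply: cvgD.
    apply: cvgD; last by apply: cvgM; [exact: cvg_cst | exact: dev_cvg].
    apply: cvgD; first exact: cvg_cst.
    apply: cvgM; first exact: cvg_cst.
    by apply: cvgM; [exact: horizonS_cvg | exact: cvg_cst].
  apply: cvgD; last by apply: cvgM; [exact: cvg_cst | exact: harmonic_horizon_cvg].
  apply: cvgD; first by apply: cvgM; [exact: cvg_cst | exact: e_cvg0].
  apply: cvgM; first exact: cvg_cst.
  by apply: cvgM; [exact: e_cvg0 | exact: horizon_cvg].
near=> n.
apply: (@le_trans _ _ (U n)); last by near: n; apply: (cvgr_le _ U_cvg); rewrite ltrDl.
have p0 : 0 <= p n by case/andP: (p01 n) => /ltW.
have p1 : p n <= 1 by case/andP: (p01 n) => _ /ltW.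
apply: (le_trans (ler_distD (iter (m0 n) (chain_step (p n)) (fun t => H (seq.filter (leq^~ K) (behead t))) [:: 1%N]) _ _)).
apply: lerD.
  apply: percE_sub_chain.
  - by near: n; exact: horizon_le.
  - by near: n; exact: nbhs_infty_gt.
  - by near: n; apply: (cvgr_gt _ p_to1); lra.
have HM t : `|H t| <= M by exact: fM.
apply: (le_trans (chain_walk K p0 p1 (m0 n) symH HM)).
rewrite le_eqVlt; apply/orP; left; apply/eqP; rewrite -/(harm n) -/(e n); ring.
Unshelve. all: by end_near.
Qed.

End PercolationWalk.

(** * The Poisson side *)

Lemma continuous_expn_neg2 (R : realType) (x : R) : x != 0 -> {for x, continuous (fun a : R => a ^- 2)}.
Proof.
move=> x0; apply: cvgV; first by rewrite expf_neq0.
exact: exprn_continuous.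
Qed.

Lemma inv_square_intensity_itv (R : realType) (x y : R) : 0 < x -> x < y ->
  inv_square_intensity `]x, y] = (x^-1 - y^-1)%:E.
Proof.
move=> x0 xy; rewrite /inv_square_intensity.
have -> : `]x, y]%classic `&` [set a : R | 0 < a] = `]x, y]%classic.
  apply/seteqP; split => a /=; first by case.
  by move=> h; split => //; move: h; rewrite in_itv /= => /andP[+ _]; exact: lt_trans.
have pos a : a \in `[x, y] -> a != 0.
  by rewrite in_itv /= => /andP[xa _]; rewrite gt_eqF // (lt_le_trans x0).
have cont : {within `[x, y], continuous (fun a : R => a ^- 2)}.
  apply: continuous_in_subspaceT => a; rewrite inE /= => /pos.
  exact: continuous_expn_neg2.
have der (a : R) : a != 0 -> is_derive a (1 : R) (fun b : R => - b^-1) (a ^- 2).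
  move=> a0; have dV : derivable (fun b : R => b^-1) a 1 by apply: derivableV.
  apply: DeriveDef; first exact: derivableN.
  by rewrite deriveN // deriveV // derive_id /GRing.scale /= mulr1 opprK.
have cinv (a : R) : a != 0 -> {for a, continuous (fun b : R => - b^-1)}.
  by move=> a0; apply: cvgN; apply: cvgV => //; exact: cvg_id.
rewrite integral_itv_obnd_cbnd; last first.
  apply/measurable_EFinP; apply: (@measurable_funS _ _ _ _ `[x, y]) => //.
    exact: subset_itv_oc_cc.
  exact: subspace_continuous_measurable_fun.
rewrite (@continuous_FTC2 _ _ (fun b : R => - b^-1) x y xy cont).
- by rewrite -EFinB opprK addrC.
- split.
  + by move=> a; rewrite in_itv /= => /andP[xa ay]; have [] := der a (lt0r_neq0 (lt_trans x0 xa)).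
  + by apply: cvg_at_right_filter; apply: cinv; exact: lt0r_neq0.
  + by apply: cvg_at_left_filter; apply: cinv; rewrite lt0r_neq0 // (lt_trans x0).
- move=> a; rewrite in_itv /= => /andP[xa ay].
  by rewrite derive1E; have [_] := der a (lt0r_neq0 (lt_trans x0 xa)).
Qed.

Lemma inv_square_intensity_neg (R : realType) : inv_square_intensity [set a : R | a <= 0] = 0%E.
Proof.
rewrite /inv_square_intensity (_ : _ `&` _ = set0) ?integral_set0 //.
by apply/seteqP; split => a //= [] a0 /lt_geF; rewrite a0.
Qed.

Section RowMeasurable.
Context d (Om : measurableType d) (R : realType) (l : nat).

Lemma open_rational_ball (U : set 'rV[R]_l) (x : 'rV[R]_l) : open U -> U x ->
  exists q : 'rV[rat]_l, exists n : nat,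
    (forall i, `|ratr (q ord0 i) - x ord0 i| < n.+1%:R^-1) /\
    forall y : 'rV[R]_l, (forall i, `|ratr (q ord0 i) - y ord0 i| < n.+1%:R^-1) -> U y.
Proof.
move=> Uo Ux; have /nbhs_ballP[r /= r0 rU] := open_nbhs_nbhs (conj Uo Ux).
have r2 : 0 < r / 2 by rewrite divr_gt0.
pose n := Num.truncn (r / 2)^-1.
have nr : n.+1%:R^-1 < r / 2.
  by rewrite invf_plt ?posrE ?ltr0n // truncnS_gt.
have n0 : 0 < n.+1%:R^-1 :> R by rewrite invr_gt0 ltr0n.
have q_ex (i : 'I_l) : exists q : rat, `|ratr q - x ord0 i| < n.+1%:R^-1.
  have /rat_in_itvoo[q] : x ord0 i - n.+1%:R^-1 < x ord0 i + n.+1%:R^-1.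
    by rewrite ltrBlDr -addrA ltrDl addr_gt0.
  by rewrite in_itv /= => /andP[h1 h2]; exists q; rewrite ltr_distl h1 h2.
have [q qP] := choice q_ex.
exists (\row_i q i), n; split => [i|y qy]; first by rewrite mxE.
apply: rU; split => // i j; rewrite ord1 /ball /=.
have := qy j; have := qP j; rewrite mxE => xq qy'.
rewrite (le_lt_trans (ler_distD (ratr (q j)) _ _)) // [r]splitr ltrD //.
  by rewrite distrC (lt_trans xq).
exact: lt_trans qy' nr.
Qed.

(** The preimage of an open ray under [f] is open, hence a countable union of cubes with rational
    centres; cubes that stick out of it are replaced by the empty set. *)
Lemma measurable_comp_row (Z : nat -> Om -> R) (f : 'rV[R]_l -> R) :
  (forall i, measurable_fun setT (Z i)) -> continuous f ->
  measurable_fun setT (fun w => f (\row_(i < l) Z i w)).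
Proof.
move=> mZ cf; apply: (measurability _ (RGenOInfty.measurableE R)) => //.
move=> /= _ [_ [x ->] <-]; rewrite setTI.
pose U := f @^-1` `]x, +oo[.
have Uo : open U by apply: open_comp => // y _; exact: cf.
pose box (qn : 'rV[rat]_l * nat) : set Om :=
  \bigcap_(i in [set: 'I_l]) [set w | `|ratr (qn.1 ord0 i) - Z i w| < qn.2.+1%:R^-1].
pose good (qn : 'rV[rat]_l * nat) :=
  forall y : 'rV[R]_l, (forall i, `|ratr (qn.1 ord0 i) - y ord0 i| < qn.2.+1%:R^-1) -> U y.
rewrite [X in measurable X](_ : _ = \bigcup_(qn in [set: 'rV[rat]_l * nat]) (if `[< good qn >] then box qn else set0)).
  apply: countable_bigcupT_measurable; first exact: countableP.
  move=> qn; case: ifP => // _; apply: fin_bigcap_measurable => //.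
  move=> i _; rewrite [X in measurable X](_ : _ = Z i @^-1` `]ratr (qn.1 ord0 i) - qn.2.+1%:R^-1, ratr (qn.1 ord0 i) + qn.2.+1%:R^-1[).
    by rewrite -[X in measurable X]setTI; exact: mZ.
  by apply/seteqP; split => w /=; rewrite in_itv /= ltr_distlC.
apply/seteqP; split => w /=.
  move=> Uw; have [q [n [qw gq]]] := open_rational_ball Uo Uw.
  exists (q, n) => //; rewrite asboolT // => i _ /=.
  by have := qw i; rewrite mxE.
move=> [[q n] _]; case: asboolP => // gq wq.
by apply: gq => i; rewrite mxE; exact: wq.
Qed.

End RowMeasurable.

(** * Rounding the atoms to the grid *)

Section RankedAtomsRounding.
Variables (R : realType) (mu : {measure set R -> \bar R}) (z : nat -> R).
Hypothesis z_dec : forall i, z i.+1 < z i.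
Hypothesis mu_z : forall A, measurable A -> mu A = (\sum_(i <oo) \d_(z i) A)%E.

Lemma atoms_antitone i j : (i <= j)%N -> z j <= z i.
Proof. by move/subnK <-; elim: (j - i)%N => // m IH; rewrite addSn; exact/ltW/(lt_le_trans (z_dec _)). Qed.

(** Mass [k] means exactly [k] atoms and, the list being decreasing, these are the first [k]. *)
Lemma atom_above x k i : mu `]x, +oo[%classic = k%:R%:E -> (x < z i) = (i < k)%N.
Proof.
have mx : measurable (`]x, +oo[%classic : set R) by exact: measurable_itv.
rewrite mu_z // => muk.
have d0 j : (0 <= \d_(z j) (`]x, +oo[%classic : set R) :> \bar R)%E by exact: measure_ge0.
have dE j : \d_(z j) (`]x, +oo[%classic : set R) = (x < z j)%R%:R%:E :> \bar R.
  by rewrite diracE; congr ((nat_of_bool _)%:R)%:E; apply/idP/idP; rewrite inE /= in_itv /= andbT.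
apply/idP/idP => [xz|ik].
  have := @nneseries_lim_ge R (fun j => \d_(z j) (`]x, +oo[%classic : set R)) xpredT 0%N i.+1 (fun j _ _ => d0 j).
  rewrite muk big_nat_cond (eq_bigr (fun=> 1%:E)); last first.
    move=> j /andP[/andP[_ ji] _]; rewrite dE (lt_le_trans xz) //; exact: atoms_antitone.
  rewrite -big_nat_cond sumEFin lee_fin sumr_const_nat subn0 => h.
  by rewrite -(ler_nat R); exact: h.
rewrite ltNge; apply/negP => zx.
move: muk; rewrite (@nneseries_split _ _ 0%N i) //.
rewrite add0n eseries0 ?adde0; last first.
  move=> j ij _; rewrite dE ltNge (le_trans (atoms_antitone ij) zx) //.
move=> h.
have : (k%:R%:E <= i%:R%:E :> \bar R)%E.
  rewrite -h (@le_trans _ _ (\sum_(0 <= j < i) 1%:E)%E) //.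
    by apply: lee_sum => j _; rewrite dE lee_fin lern1 leq_b1.
  by rewrite sumEFin lee_fin sumr_const_nat subn0.
by rewrite lee_fin ler_nat leqNgt ik.
Qed.

Lemma count_ge_list K (c : 'I_K -> nat) (k : 'I_K) :
  count (leq k.+1) (count_list c) = (c k + count (leq k.+2) (count_list c))%N.
Proof.
rewrite -[X in (X + _)%N](count_mem_list c k) -count_predUI.
rewrite [X in (_ + X)%N](_ : _ = 0%N); last first.
  apply/eqP; rewrite -leqn0 leqNgt -has_count; apply/hasP => -[x _ /andP[/eqP ->]].
  by rewrite ltnn.
rewrite addn0; apply: eq_count => x /=.
by rewrite [in LHS]leq_eqVlt eq_sym.
Qed.

Lemma count_list_gt K (c : 'I_K -> nat) : count (leq K.+1) (count_list c) = 0%N.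
Proof.
apply/eqP; rewrite -leqn0 leqNgt -has_count -all_predC.
apply: sub_all (count_list_all c) => x /andP[_ xK] /=.
by rewrite -ltnNge ltnS.
Qed.

Variables (B : R) (K : nat) (c : 'I_K -> nat).
Hypothesis B_gt0 : 0 < B.
Hypothesis mu_cell : forall k : 'I_K, mu `]k.+1%:R / B, k.+2%:R / B]%classic = (c k)%:R%:E.
Hypothesis z0_le : z 0%N <= K.+1%:R / B.
Hypothesis z_gt0 : forall i, 0 < z i.

(** Downward induction on [k]: by [z0_le] no atom lies beyond [(K + 1) / B], and each cell adds its
    own count. *)
Lemma mu_above k : (k <= K)%N ->
  mu `]k.+1%:R / B, +oo[%classic = (count (leq k.+1) (count_list c))%:R%:E.
Proof.
move=> kK; rewrite -(subKn kK); elim: (K - k)%N (leq_subr k K) => [_|j IH jK].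
  rewrite subn0 count_list_gt mu_z; last exact: measurable_itv.
  rewrite eseries0 // => i _ _; rewrite diracE memNset // /= in_itv /= andbT; apply/negP.
  by rewrite -leNgt (le_trans _ z0_le) // atoms_antitone.
have jK' : (K - j.+1 < K)%N by lia.
have E : (K - j.+1).+1 = (K - j)%N by lia.
pose k0 : 'I_K := Ordinal jK'.
have -> : `]((K - j.+1).+1%:R / B), +oo[%classic =
   `](k0.+1%:R / B), (k0.+2%:R / B)]%classic `|` `](K - j).+1%:R / B, +oo[%classic.
  rewrite -E /=; apply: itv_bndbnd_setU; rewrite ?bnd_simp //.
  by rewrite ler_pM2r ?invr_gt0 // ler_nat.
rewrite measureU; [|exact: measurable_itv|exact: measurable_itv|]; last first.
  rewrite -E /=; apply/seteqP; split => // y /= [].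
  by rewrite !in_itv /= andbT => /andP[_ /le_lt_trans h] /h; rewrite ltxx.
transitivity (((c k0)%:R : R)%:E + ((count (leq (K - j).+1) (count_list c))%:R : R)%:E)%E.
  by congr (_ + _)%E; [exact: mu_cell | exact/IH/ltnW].
by rewrite -EFinD -natrD (count_ge_list c k0) /= E.
Qed.

(* The cell ](k + 1) / B, (k + 2) / B] has intensity [B / ((k + 1) (k + 2))], so
   rounding the atoms down to the grid gives exactly the limit law of the walk. *)
Lemma atom_rounding i :
  `|z i - B^-1 * (nth 0%N (sort geq (count_list c)) i)%:R| <= B^-1.
Proof.
set v := nth _ _ _.
have B0 : 0 < B^-1 by rewrite invr_gt0.
have above k : (k <= K)%N -> (k.+1%:R / B < z i) = (k < v)%N.
  move=> kK; rewrite (atom_above i (mu_above kK)) -(@nth_sort_geq (leq k.+1)) //.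
  by move=> x y xy kx; exact: leq_trans xy.
have vK : (v <= K)%N.
  by apply: nth_sort_geq_le; apply: sub_all (count_list_all c) => x /andP[].
have up : z i <= v.+1%:R / B by rewrite leNgt above // ltnn.
have low : v%:R / B <= z i.
  case: {up} v above vK => [|k] above kK; first by rewrite mul0r ltW.
  by apply/ltW; rewrite above // ltnW.
rewrite mulrC ler_norml lerBrDr lerBlDr; apply/andP; split.
  by rewrite (le_trans _ low) // gerDr oppr_le0 ltW.
by rewrite (le_trans up) // -natr1 mulrDl mul1r addrC.
Qed.

End RankedAtomsRounding.

Section BoundedExpectation.
Context d (Om : measurableType d) (R : realType) (P : probability Om R).
Implicit Types (X : Om -> R) (s : seq (R * set Om)).

Lemma bounded_Lfun X M : measurable_fun setT X -> (forall w, `|X w| <= M) -> X \in Lfun P 1.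
Proof.
move=> mX XM; apply/Lfun1_integrable; apply: measurable_bounded_integrable => //.
  by rewrite (le_lt_trans (probability_le1 P measurableT)) // ltry.
exists M; split; first exact: num_real.
by move=> y My w _ /=; apply: le_trans (XM w) (ltW My).
Qed.

Definition step_fun s w : R := \sum_(x <- s) x.1 * \1_(x.2) w.

Lemma step_fun_measurable s : (forall x, x \in s -> measurable x.2) -> measurable_fun setT (step_fun s).
Proof.
elim: s => [|x s IH] ms.
  by rewrite (_ : step_fun [::] = cst 0) //; apply/funext => w; rewrite /step_fun big_nil.
rewrite (_ : step_fun (x :: s) = (fun w => x.1 * \1_(x.2) w) \+ step_fun s); last first.
  by apply/funext => w; rewrite /step_fun big_cons.
apply: measurable_funD; last by apply: IH => y ys; apply: ms; rewrite in_cons ys orbT.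
apply: measurable_funM => //; apply: measurable_indic; apply: ms; exact: mem_head.
Qed.

Lemma step_fun_bounded s w : `|step_fun s w| <= \sum_(x <- s) `|x.1|.
Proof.
rewrite /step_fun (le_trans (ler_norm_sum _ _ _)) //; apply: ler_sum => x _.
rewrite normrM ler_piMr // ger0_norm ?indicE // lern1; exact: leq_b1.
Qed.

Lemma step_fun_Lfun s : (forall x, x \in s -> measurable x.2) -> step_fun s \in Lfun P 1.
Proof. by move=> ms; apply: bounded_Lfun (step_fun_measurable ms) (@step_fun_bounded s). Qed.

Lemma expectation_step_fun s : (forall x, x \in s -> measurable x.2) ->
  ('E_P[step_fun s])%E = (\sum_(x <- s) x.1 * fine (P x.2))%:E.
Proof.
elim: s => [|x s IH] ms.
  rewrite big_nil (_ : step_fun [::] = cst 0) ?expectation_cst //.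
  by apply/funext => w; rewrite /step_fun big_nil.
have mx : measurable x.2 by apply: ms; exact: mem_head.
have ms' y : y \in s -> measurable y.2 by move=> ys; apply: ms; rewrite in_cons ys orbT.
rewrite (_ : step_fun (x :: s) = (x.1 \o* \1_(x.2)) \+ step_fun s); last first.
  by apply/funext => w; rewrite /step_fun big_cons /= mulrC.
have ind_L : \1_(x.2) \in Lfun P 1.
  apply: (@bounded_Lfun _ 1); first exact: measurable_indic.
  by move=> w; rewrite ger0_norm ?indicE // lern1 leq_b1.
have Zind_L : x.1 \o* \1_(x.2) \in Lfun P 1.
  apply: (@bounded_Lfun _ `|x.1|); first by apply: measurable_funM => //; exact: measurable_indic.
  by move=> w /=; rewrite normrM ler_piMl // ger0_norm ?indicE // lern1 leq_b1.
rewrite expectationD //; last exact: step_fun_Lfun.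
rewrite expectationZl // expectation_indic // IH // big_cons EFinD EFinM fineK //.
exact: fin_num_measure.
Qed.

(** With step functions both as approximation and as error bound, the comparison becomes one between
    finite sums of probabilities; [r] records that the expectation is finite. *)
Lemma expectation_step_dist X (M : R) s t : measurable_fun setT X -> (forall w, `|X w| <= M) ->
  (forall x, x \in s -> measurable x.2) -> (forall x, x \in t -> measurable x.2) ->
  (forall w, 0 <= step_fun t w) ->
  {ae P, forall w, `|X w - step_fun s w| <= step_fun t w} ->
  exists2 r : R, ('E_P[X])%E = r%:E &
    `|r - \sum_(x <- s) x.1 * fine (P x.2)| <= \sum_(x <- t) x.1 * fine (P x.2).
Proof.
move=> mX XM ms mt t0 Xst.
have XL : X \in Lfun P 1 by exact: bounded_Lfun XM.
have /fineK EX := expectation_fin_num XL.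
exists (fine 'E_P[X]%E); first by [].
rewrite -lee_fin -(expectation_step_fun mt) -abse_EFin EFinB EX -(expectation_step_fun ms).
rewrite -expectationB //; last exact: step_fun_Lfun.
have mXs : measurable_fun setT (X \- step_fun s) by apply: measurable_funB => //; exact: step_fun_measurable.
rewrite unlock; apply: (le_trans (le_abse_integral P measurableT _)).
  exact/measurable_EFinP.
apply: ae_ge0_le_integral => //.
- by apply: measurableT_comp => //; exact/measurable_EFinP.
- by move=> w _; rewrite lee_fin.
- by apply/measurable_EFinP; exact: step_fun_measurable.
- by apply: filterS Xst => w h _ /=; rewrite lee_fin.
Qed.

End BoundedExpectation.

Section PoissonSide.
Context d (Om : measurableType d) (R : realType) (P : probability Om R).
Variables (N : R.-ker Om ~> R) (Z : nat -> {RV P >-> R}).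
Hypothesis N_poisson : poisson_random_measure P (@inv_square_intensity R) N.
Hypothesis Z_atoms : ranked_atoms N Z.

(** The half-line up to 0 has intensity 0, so [N] almost surely gives it mass 0, whereas an atom
    there would give it at least 1. *)
Lemma atoms_gt0 : {ae P, forall w, forall i, 0 < Z i w}.
Proof.
pose A0 : set R := [set a | a <= 0].
have mA0 : measurable A0.
  rewrite (_ : A0 = `]-oo, 0]%classic); first exact: measurable_itv.
  by apply/seteqP; split => a /=; rewrite in_itv.
have mN0 : measurable ((N ^~ A0) @^-1` [set 0%E]).
  by rewrite -[X in measurable X]setTI; exact: (measurable_kernel N A0 mA0 measurableT _ (emeasurable_set1 0%E)).
have PN0 : P ((N ^~ A0) @^-1` [set 0%E]) = 1%E.
  have := N_poisson.1 A0 mA0; rewrite inv_square_intensity_neg /= => /(_ 0%N).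
  by rewrite oppr0 expR0 expr0 fact0 divr1 mulr1.
have N0 : {ae P, forall w, N w A0 = 0%E}.
  exists (~` ((N ^~ A0) @^-1` [set 0%E])); split => //; first exact: measurableC.
  by rewrite probability_setC // PN0 subee.
apply: filterS2 Z_atoms N0 => w [_ NZ] Nw0 i; rewrite ltNge; apply/negP => Zi.
have := NZ _ mA0; rewrite Nw0 => sum0.
have := @nneseries_lim_ge R (fun j => \d_(Z j w) A0) xpredT 0%N i.+1 (fun j _ _ => measure_ge0 _ _).
rewrite -sum0 big_nat_recr //= diracE mem_set // => h.
have : (1%E <= 0%E :> \bar R)%E.
  by apply: le_trans h; rewrite leeDr // sume_ge0.
by rewrite lee_fin ler10.
Qed.

Variables (B : R) (K : nat).
Hypothesis B_gt0 : 0 < B.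

Definition cell (k : 'I_K) : set R := `]k.+1%:R / B, k.+2%:R / B]%classic.

Definition cells_event (c : 'I_K -> nat) : set Om :=
  \bigcap_(k in [set: 'I_K]) ((fun w => N w (cell k)) @^-1` [set (c k)%:R%:E]).

Lemma measurable_cell k : measurable (cell k).
Proof. exact: measurable_itv. Qed.

Lemma measurable_cells_event c : measurable (cells_event c).
Proof.
apply: fin_bigcap_measurable => // k _; rewrite -[X in measurable X]setTI.
exact: (measurable_kernel N (cell k) (measurable_cell k) measurableT _ (emeasurable_set1 _)).
Qed.

Lemma cell_intensity k : inv_square_intensity (cell k) = (poisson_rate B k.+1)%:E.
Proof.
have B0 := lt0r_neq0 B_gt0.
rewrite inv_square_intensity_itv; first last.
- by rewrite ltr_pM2r ?invr_gt0 // ltr_nat.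
- by rewrite divr_gt0.
congr EFin; rewrite /poisson_rate -[k.+2%:R]natr1; field.
by rewrite !(nat1r, natr1) !pnatr_eq0 B0.
Qed.

Lemma trivIset_cell : trivIset setT cell.
Proof.
apply/trivIsetP => i j _ _ ij; apply/seteqP; split => // x [].
rewrite /cell /= !in_itv /= => /andP[ix xi] /andP[jx xj].
have lt_nat (a b : nat) : a%:R / B < b%:R / B -> (a < b)%N.
  by rewrite ltr_pM2r ?invr_gt0 // ltr_nat.
have ij1 := lt_nat _ _ (lt_le_trans ix xj); have ji1 := lt_nat _ _ (lt_le_trans jx xi).
by case/eqP: ij; apply: val_inj => /=; lia.
Qed.

Lemma cells_event_prob c : P (cells_event c) = (poisson_list K B (count_list c))%:E.
Proof.
rewrite (N_poisson.2 K cell measurable_cell trivIset_cell (fun k => [set (c k)%:R%:E])); last first.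
  by move=> k; exact: emeasurable_set1.
congr EFin; rewrite poisson_list_count; apply: eq_bigr => k _.
have := N_poisson.1 (cell k) (measurable_cell k); rewrite cell_intensity => /(_ (c k)) ->.
by rewrite /poisson_weight.
Qed.

Variables (l : nat) (f : 'rV[R]_l -> R) (M eta : R) (m : nat).
Hypothesis cf : continuous f.
Hypothesis fM : forall x, `|f x| <= M.
Hypothesis eta_ge0 : 0 <= eta.
Hypothesis f_uc : forall x y : 'rV[R]_l, (forall i, 0 <= y ord0 i <= B^-1 * K%:R) ->
     (forall i, `|x ord0 i - y ord0 i| <= B^-1) -> `|f x - f y| <= eta.

Let far := [set w | K.+1%:R / B < Z 0%N w].
Let box := {ffun 'I_K -> 'I_m.+1}.
Let lst (c : box) := count_list (fun k => c k).

Lemma expectation_atoms :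
  exists2 r : R, ('E_P[fun w => f (\row_(i < l) Z i w)])%E = r%:E &
   `|r - \sum_(c : box) f (top_sizes l B^-1 (lst c)) * poisson_list K B (lst c)| <=
   eta + 2 * M * fine (P far) + M * (1 - \sum_(c : box) poisson_list K B (lst c)).
Proof.
have M0 : 0 <= M by exact: le_trans (fM 0).
pose E (c : box) := cells_event (fun k => c k).
pose s : seq (R * set Om) := [seq (f (top_sizes l B^-1 (lst c)), E c) | c <- index_enum box].
(* Where some event [E c] occurs it is unique, [- M] cancels [M], and [eta] plus [2 M] times the
   indicator of [far] remains; elsewhere [s] vanishes and [M] covers [f]. *)
pose t : seq (R * set Om) := (eta + M, setT) :: (2 * M, far) :: [seq (- M, E c) | c <- index_enum box].
have mE c : measurable (E c) by exact: measurable_cells_event.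
have mfar : measurable far.
  rewrite (_ : far = Z 0%N @^-1` `]K.+1%:R / B, +oo[).
    by rewrite -[X in measurable X]setTI; exact: measurable_funP.
  by apply/seteqP; split => w /=; rewrite in_itv /= andbT.
have sE w : step_fun s w = \sum_(c : box) f (top_sizes l B^-1 (lst c)) * \1_(E c) w.
  by rewrite /step_fun big_map.
have tE w : step_fun t w = eta + M + 2 * M * \1_far w - M * \sum_(c : box) \1_(E c) w.
  rewrite /step_fun !big_cons big_map /= indicT mulr1 addrA; congr (_ + _).
  by rewrite -mulNr mulr_sumr.
have E_uniq w c c' : E c w -> c' != c -> \1_(E c') w = 0 :> R.
  move=> Ec cc'; rewrite indicE memNset // => Ec'; case/eqP: cc'; apply/ffunP => k; apply: val_inj.
  have e1 : N w (cell k) = (c k)%:R%:E := Ec k I.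
  have e2 : N w (cell k) = (c' k)%:R%:E := Ec' k I.
  have h : (c' k)%:R%:E = (c k)%:R%:E :> \bar R by rewrite -e1 -e2.
  by apply/eqP; rewrite -(eqr_nat R) (EFin_inj h).
have sumE w c : E c w -> \sum_(c' : box) \1_(E c') w = 1 :> R.
  move=> Ec; rewrite (bigD1 c) //= big1 ?addr0 => [|c' cc']; last exact: E_uniq Ec cc'.
  by rewrite indicE mem_set.
have sumE_le w : \sum_(c : box) \1_(E c) w <= 1 :> R.
  have [[c Ec]|none] := pselect (exists c, E c w); first by rewrite (sumE w c).
  rewrite big1 // => c _; rewrite indicE memNset // => Ec; apply: none; by exists c.
have far0 w : 0 <= \1_far w :> R by rewrite indicE.
have t_ge0 w : 0 <= step_fun t w.
  rewrite tE; have := sumE_le w; have := far0 w; have := eta_ge0.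
  move: (\1_far w) (\sum_(_ : _) _) => a b; nra.
have [||x|x|||r Er rs] := @expectation_step_dist _ _ R P (fun w => f (\row_(i < l) Z i w)) M s t.
- by apply: (@measurable_comp_row _ _ _ _ (fun i => Z i)) => // i.
- by move=> w; exact: fM.
- by case/mapP => c _ ->; exact: mE.
- rewrite !in_cons => /or3P[/eqP ->|/eqP ->|/mapP[c _ ->]] /=; [exact: measurableT | exact: mfar | exact: mE].
- exact: t_ge0.
- apply: filterS2 Z_atoms atoms_gt0 => w [Z_dec NZ] Z_gt0.
  rewrite sE tE.
  have [[c Ec]|none] := pselect (exists c, E c w); last first.
    rewrite !big1 => [|c _|c _]; do ?by rewrite indicE memNset ?mulr0 // => Ec; apply: none; exists c.
    rewrite subr0 mulr0 subr0 (le_trans (fM _)) // -addrA addrCA lerDl addr_ge0 ?mulr_ge0 //.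
  rewrite (sumE w c) // (bigD1 c) //= big1 => [|c' cc']; last by rewrite (E_uniq w c c') ?mulr0.
  rewrite addr0 mulr1 indicE mem_set // mulr1 addrAC addrK.
  have [wfar|wfar] := pselect (far w).
    rewrite indicE mem_set // mulr1 (le_trans (ler_normB _ _)) //.
    rewrite (le_trans (lerD (fM _) (fM _))) // mulrDl mul1r lerDr //.
  rewrite indicE memNset // mulr0 addr0; apply: f_uc => i; rewrite !mxE.
    rewrite mulr_ge0 ?invr_ge0 ?(ltW B_gt0) //=; apply: ler_wpM2l; first by rewrite invr_ge0 ltW.
    rewrite ler_nat; apply: nth_sort_geq_le; apply: sub_all (count_list_all _) => x.
    by case/andP.
  apply: (@atom_rounding R (N w) (fun i => Z i w)) => //.
  - by move=> k; have := Ec k I.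
  - by rewrite leNgt; apply/negP.
exists r => //.
move: rs; rewrite big_map /= !big_cons big_map /= probability_setT /= mulr1.
rewrite (eq_bigr (fun c => f (top_sizes l B^-1 (lst c)) * poisson_list K B (lst c))); last first.
  by move=> c _; rewrite /E cells_event_prob.
rewrite [X in _ + (_ + X)](eq_bigr (fun c => - M * poisson_list K B (lst c))); last first.
  by move=> c _; rewrite /E cells_event_prob.
rewrite -mulr_sumr => /le_trans; apply; rewrite le_eqVlt; apply/orP; left; apply/eqP; ring.
Qed.

End PoissonSide.

Lemma measurable_RV_gt d (Om : measurableType d) (R : realType) (P : probability Om R)
  (X : {RV P >-> R}) (x : R) : measurable [set w | x < X w].
Proof.
rewrite (_ : [set _ | _] = X @^-1` `]x, +oo[).
  by rewrite -[X in measurable X]setTI; exact: measurable_funP.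
by apply/seteqP; split => w /=; rewrite in_itv /= andbT.
Qed.

Lemma tail_probability_small d (Om : measurableType d) (R : realType) (P : probability Om R)
  (X : {RV P >-> R}) (eps : R) : 0 < eps ->
  \forall L \near \oo, fine (P [set w | L%:R < X w]) <= eps.
Proof.
move=> eps0; pose F n := [set w | n%:R < X w].
have mF n : measurable (F n) by exact: measurable_RV_gt.
have F0 : \bigcap_n F n = set0.
  apply/seteqP; split => // w Fw; have := Fw (Num.truncn (X w)).+1 I.
  by rewrite /F /= => /lt_trans /(_ (truncnS_gt _)); rewrite ltxx.
have lim : P (F n) @[n --> \oo] --> 0%E.
  rewrite -(measure0 P) -F0; apply: nonincreasing_cvg_mu => //.
  - by rewrite (le_lt_trans (probability_le1 P (mF 0%N))) // ltry.
  - by rewrite F0.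
  - move=> i j ij; apply/subsetPset => w; rewrite /F /=.
    by apply: le_lt_trans; rewrite ler_nat.
have lim' : fine (P (F n)) @[n --> \oo] --> (0 : R) by exact: fine_cvg lim.
by apply: (cvgr_le _ lim').
Qed.

Lemma near_infty_ge (R : realType) (x : R) : \forall n \near \oo, x <= n%:R.
Proof. by near=> n; apply: ltW; near: n; exact: nbhs_infty_gtr. Unshelve. all: by end_near. Qed.

Theorem corollary1 (R : realType) (p : nat -> R)
  (p01 : forall n, 0 < p n < 1)
  (p_to1 : p n @[n --> \oo] --> (1 : R))
  (p_slow : forall k : nat,
     ((1 - p n) ^+ k * n%:R `^ p n) @[n --> \oo] --> +oo) :
  (forall eps : R, 0 < eps ->
     percP (p n) (fun F : graph n =>
       eps < `|(root_cluster_size F)%:R / n%:R `^ p n - 1|)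
     @[n --> \oo] --> (0 : R)) /\
  (forall (l : nat) (d : measure_display) (Om : measurableType d)
     (P : probability Om R) (N : R.-ker Om ~> R)
     (Z : nat -> {RV P >-> R}),
     poisson_random_measure P (@inv_square_intensity R) N ->
     ranked_atoms N Z ->
     forall f : 'rV[R]_l -> R, continuous f ->
       (exists M : R, forall x, `|f x| <= M) ->
       (percE (p n) (fun F : graph n =>
          f (\row_(i < l) ((1 - p n)^-1 / n%:R `^ p n *
                           (other_cluster_size F i)%:R))))%:E
         @[n --> \oo] --> ('E_P[fun w => f (\row_(i < l) Z i w)])%E).
Proof.
have slow1 : (1 - p n) * n%:R `^ p n @[n --> \oo] --> +oo.
  by have := p_slow 1%N; under eq_fun do rewrite expr1.
split; first exact: root_cluster_cvg.
move=> l d Om P N Z N_poisson Z_atoms f cf [M fM].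
have M0 : 0 <= M by exact: le_trans (fM 0).
pose E_n n := percE (p n) (fun F : graph n =>
          f (\row_(i < l) ((1 - p n)^-1 / n%:R `^ p n * (other_cluster_size F i)%:R))).
(* A use with trivial parameters, only to know that the expectation is finite before the real ones
   are chosen. *)
have [r0 Er0 _] : exists2 r : R, ('E_P[fun w => f (\row_(i < l) Z i w)])%E = r%:E & True.
  have [||r Er _] := @expectation_atoms d Om R P N Z N_poisson Z_atoms 1 0 ltr01 l f M (2 * M) 0 cf fM.
    by rewrite mulr_ge0.
    by move=> x y _ _; rewrite (le_trans (ler_normB _ _)) // mulrDl mul1r lerD.
  by exists r.
rewrite Er0; apply: cvg_EFin; first by near=> n.
apply/cvgrPdist_le => /= tol tol0; rewrite /=.
(* Nine errors are added up at the end. *)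
pose dl := tol / 9; have dl0 : 0 < dl by rewrite divr_gt0.
have M1 : 0 < 2 * M + 1 by rewrite ltr_wpDl // mulr_ge0.
(* Both sides are cut at level [L]: the largest atom rarely exceeds it, and with [K = L B] a cluster
   at the horizon exceeds [K] with limiting probability at most [1 / L]. *)
have [L [L1 LM Ltail]] : exists L : nat, [/\ (0 < L)%N, 2 * M / L%:R <= dl &
    2 * M * fine (P [set w | L%:R < Z 0%N w]) <= dl].
  have : \forall L \near \oo, [/\ (0 < L)%N, 2 * M / dl <= L%:R &
      fine (P [set w | L%:R < Z 0%N w]) <= dl / (2 * M + 1)].
    near=> L; split; near: L; first exact: nbhs_infty_gt.
      exact: near_infty_ge.
    by apply: tail_probability_small; rewrite divr_gt0.
  move=> [L _ /(_ L (leqnn L)) [L1 LM LP]]; exists L; split => //.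
    by rewrite ler_pdivrMr ?ltr0n // [leRHS]mulrC -ler_pdivrMr.
  apply: (@le_trans _ _ ((2 * M + 1) * (dl / (2 * M + 1)))).
    by apply: ler_pM => //; [exact: mulr_ge0 | exact: fine_ge0 | rewrite lerDl].
  by rewrite mulrC divfK // gt_eqF.
(* The order of the choices matters: [eta] depends on the box, hence on [L], and [B] must be large
   in terms of both. *)
have [eta eta0 f_uc] := unif_continuous_box L%:R cf dl0.
pose C := 2 * M / eta ^+ 2.
have C0 : 0 <= C by apply: divr_ge0; [exact: mulr_ge0 | exact: sqr_ge0].
have [q [q1 q_eta q_C]] : exists q : nat, [/\ (0 < q)%N, q%:R^-1 <= eta & C * ((2 * L%:R + 2) / q%:R) <= dl].
  have : \forall q \near \oo, [/\ (0 < q)%N, eta^-1 <= q%:R & C * (2 * L%:R + 2) / dl <= q%:R].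
    near=> q; split; near: q; first exact: nbhs_infty_gt.
      exact: near_infty_ge.
    exact: near_infty_ge.
  move=> [q _ /(_ q (leqnn q)) [q1 qe qC]]; exists q; split => //.
    by rewrite invf_ple ?posrE // ltr0n.
  by rewrite mulrA ler_pdivrMr ?ltr0n // [leRHS]mulrC -ler_pdivrMr.
have Q0 : 0 < q%:R :> R by rewrite ltr0n.
have Q1 : 1 <= q%:R :> R by rewrite ler1n.
(* The harmonic sum up to [L * q ^ 2] is [O(q)], hence negligible against [B]. *)
pose B : R := (q ^ 2)%:R; pose K := (L * q ^ 2)%N.
have B0 : 0 < B by rewrite ltr0n expn_gt0 q1.
have BE : B = q%:R ^+ 2 by rewrite /B natrX.
have BK : B^-1 * K%:R = L%:R by rewrite /K natrM -/B mulrCA mulVf ?mulr1 // gt_eqF.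
have Binv : B^-1 <= eta.
  apply: le_trans q_eta; rewrite BE lef_pV2 ?posrE ?exprn_gt0 //.
  by rewrite expr2 ler_peMl // ltW.
have hK : (\sum_(0 <= k < K) k.+1%:R^-1 + 2) / B <= (2 * L%:R + 2) / q%:R.
  have sqK : Num.sqrt K%:R <= L%:R * q%:R :> R.
    rewrite -[leRHS]ger0_norm ?mulr_ge0 // -sqrtr_sqr ler_wsqrtr // exprMn /K natrM natrX.
    by apply: ler_wpM2r; rewrite ?sqr_ge0 // expr2 ler_peMl // ler1n.
  rewrite ler_pdivrMr // (le_trans (lerD (harmonic_le_sqrt R K) (lexx 2))) // BE.
  rewrite (_ : _ / _ * _ = (2 * L%:R + 2) * q%:R); last by field; exact: lt0r_neq0.
  rewrite [leRHS]mulrDl lerD //; last by rewrite ler_peMr.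
  by rewrite -mulrA; apply: ler_wpM2l.
have f_uc1 (x y : 'rV[R]_l) : (forall i, 0 <= y ord0 i <= B^-1 * K%:R) ->
     (forall i, `|x ord0 i - y ord0 i| <= eta) -> `|f x - f y| <= dl.
  by rewrite BK; exact: f_uc.
have f_uc2 (x y : 'rV[R]_l) : (forall i, 0 <= y ord0 i <= B^-1 * K%:R) ->
     (forall i, `|x ord0 i - y ord0 i| <= B^-1) -> `|f x - f y| <= dl.
  by move=> y_box xy; apply: f_uc1 => // i; exact: le_trans (xy i) Binv.
have [m box_m] : exists m, M * (1 - \sum_(c : {ffun 'I_K -> 'I_m.+1}) poisson_list K B (count_list (fun k => c k))) <= dl.
  have lim : (fun m => M * (1 - \sum_(c : {ffun 'I_K -> 'I_m.+1}) poisson_list K B (count_list (fun k => c k)))) @ \oo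
      --> M * (1 - 1).
    by apply: cvgM; [exact: cvg_cst | apply: cvgB; [exact: cvg_cst | exact: poisson_box_cvg]].
  rewrite subrr mulr0 in lim.
  have : \forall m \near \oo, M * (1 - \sum_(c : {ffun 'I_K -> 'I_m.+1}) poisson_list K B (count_list (fun k => c k))) <= dl.
    exact: (cvgr_le _ lim).
  by move=> [m _ /(_ m (leqnn m))]; exists m.
have [r Er rS] := @expectation_atoms d Om R P N Z N_poisson Z_atoms B K B0 l f M dl m cf fM (ltW dl0) f_uc2.
have rr0 : r0 = r by apply: EFin_inj; rewrite -Er -Er0.
rewrite rr0.
have e01 n : 0 <= 1 - p n <= 1.
  by case/andP: (p01 n) => h1 h2; rewrite subr_ge0 (ltW h2) lerBlDr lerDl ltW.
have H_bound u : `|f (top_sizes l B^-1 u)| <= M by exact: fM.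
have symH : symmetric_fun (fun t => f (top_sizes l B^-1 t)).
  by move=> t u tu; rewrite (symmetric_top_sizes _ _ tu).
have far_le : 2 * M * fine (P [set w | K.+1%:R / B < Z 0%N w]) <= dl.
  apply: le_trans Ltail; apply: ler_wpM2l; first exact: mulr_ge0.
  have mgt x : measurable [set w | x < Z 0%N w] by exact: measurable_RV_gt.
  apply: fine_le; [exact: fin_num_measure | exact: fin_num_measure | apply: le_measure; rewrite ?inE //].
  move=> w /=; apply: le_lt_trans; rewrite -BK mulrC; apply: ler_wpM2r; rewrite ?ler_nat //.
  by rewrite invr_ge0 ltW.
have BKL : 2 * M * (B / K.+1%:R) <= dl.
  apply: le_trans LM; apply: ler_wpM2l; first exact: mulr_ge0.
  by rewrite ler_pdivrMr ?ltr0n // ler_pdivlMl ?ltr0n // /B -natrM ler_nat.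
near=> n.
have step1 : `|E_n n - walkE (1 - p n) K (horizon p B n).+1 (fun t => f (top_sizes l B^-1 t))| <=
    dl + 2 * M * (B / K.+1%:R) + 2 * M / eta ^+ 2 * ((\sum_(0 <= k < K) k.+1%:R^-1 + 2) / B) + dl.
  near: n; exact: (percE_sub_walk p01 p_to1 slow1 B0 eta0 (ltW dl0) fM f_uc1 dl0).
have step2 : `|walkE (1 - p n) K (horizon p B n).+1 (fun t => f (top_sizes l B^-1 t)) -
    \sum_(c : {ffun 'I_K -> 'I_m.+1}) f (top_sizes l B^-1 (count_list (fun k => c k))) *
        poisson_list K B (count_list (fun k => c k))| <=
  M * (1 - \sum_(c : {ffun 'I_K -> 'I_m.+1}) poisson_list K B (count_list (fun k => c k))) + dl.
  near: n; apply: (walk_poisson K (e := fun n => 1 - p n) (m := fun n => (horizon p B n).+1) m B0 e01 _ _ symH H_bound dl0).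
    exact: gap_cvg0.
  exact: horizonS_cvg.
rewrite -/(E_n n).
move: step1 step2 rS; set W := walkE _ _ _ _; set S := \sum_(c : _) _ * _; set T := \sum_(c : _) _ in box_m *.
move=> step1 step2 rS.
have hC : 2 * M / eta ^+ 2 * ((\sum_(0 <= k < K) k.+1%:R^-1 + 2) / B) <= dl.
  by apply: le_trans q_C; apply: ler_wpM2l.
have -> : tol = dl + (dl + (dl + (dl + (dl + (dl + (dl + (dl + dl))))))) by rewrite /dl; field.
rewrite distrC in step1; rewrite distrC in step2.
apply: le_trans (ler_distD S _ _) _.
apply: le_trans (lerD rS (le_trans (ler_distD W _ _) (lerD step2 step1))) _.
move: far_le BKL hC box_m.
move: (2 * M * fine _) (2 * M * (B / _)) (2 * M / eta ^+ 2 * _) (M * (1 - T)) => x1 x2 x3 x4.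
by move=> *; lra.
Unshelve. all: by end_near.
Qed.
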